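(* Let $p\in[1,2)$. There exist a time $T>0$ and a smooth function $\theta_0$ on $\mathbb{R}^2$ with $\|\theta_0\|_{C^2(\mathbb{R}^2)}\le 1$ such that for every modulus of continuity $\rho$ there exists a smooth, divergence-free, time-dependent vector field $u(t,x)$ on $[0,\infty)\times\mathbb{R}^2$ with $\big\|\sup_t|u(t,\cdot)|\big\|_{L^p(\mathbb{R}^2)}\le 1$ such that the smooth solution $\theta$ of $$\partial_t\theta+u\cdot\nabla\theta-\Delta\theta=0,\qquad \theta(0,\cdot)=\theta_0,$$ breaks the modulus $\rho$ at some time $t\le T$.
   Context: A modulus of continuity is a continuous non-decreasing function $\rho:[0,\infty)\to[0,\infty)$ with $\rho(0)=0$. A function $\theta$ on $(t_0,t_1)\times\mathbb{R}^2$ breaks $\rho$ at time $t$ if there exist $x,y\in\mathbb{R}^2$ with $|\theta(t,x)-\theta(t,y)|>\rho(|x-y|)$. *)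

(* Defs.v *)
From Stdlib Require Import Reals List.
Open Scope R_scope.

Definition cont3_on (D : R -> R -> R -> Prop) (g : R -> R -> R -> R) : Prop :=
  forall t x y, D t x y -> forall eps, 0 < eps -> exists delta, 0 < delta /\
    forall t' x' y', Rabs (t' - t) < delta -> Rabs (x' - x) < delta ->
      Rabs (y' - y) < delta -> Rabs (g t' x' y' - g t x y) < eps.

Definition cont2 (g : R -> R -> R) : Prop :=
  forall x y eps, 0 < eps -> exists delta, 0 < delta /\
    forall x' y', Rabs (x' - x) < delta -> Rabs (y' - y) < delta ->
      Rabs (g x' y' - g x y) < eps.

(* C^infinity on an open set D of R^3: f lies in a family of continuous
   functions closed under taking each of the three partial derivatives
   (i.e. all iterated partial derivatives exist on D and are continuous). *)
Definition smooth3_on (D : R -> R -> R -> Prop) (f : R -> R -> R -> R) : Prop :=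
  exists S : (R -> R -> R -> R) -> Prop, S f /\
    forall g, S g ->
      cont3_on D g /\
      (exists g1, S g1 /\ forall t x y, D t x y ->
          derivable_pt_lim (fun s => g s x y) t (g1 t x y)) /\
      (exists g2, S g2 /\ forall t x y, D t x y ->
          derivable_pt_lim (fun s => g t s y) x (g2 t x y)) /\
      (exists g3, S g3 /\ forall t x y, D t x y ->
          derivable_pt_lim (fun s => g t x s) y (g3 t x y)).

Definition smooth3 (f : R -> R -> R -> R) : Prop :=
  smooth3_on (fun _ _ _ => True) f.

Definition smooth2 (f : R -> R -> R) : Prop :=
  exists S : (R -> R -> R) -> Prop, S f /\
    forall g, S g ->
      cont2 g /\
      (exists g1, S g1 /\ forall x y,
          derivable_pt_lim (fun s => g s y) x (g1 x y)) /\
      (exists g2, S g2 /\ forall x y,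
          derivable_pt_lim (fun s => g x s) y (g2 x y)).

(* ||f||_{C^2(R^2)} <= M, with the convention
   ||f||_{C^2} = sum_{|alpha| <= 2} sup |D^alpha f|. *)
Definition C2_norm_le (f : R -> R -> R) (M : R) : Prop :=
  exists f1 f2 f11 f12 f22 : R -> R -> R,
    (forall x y, derivable_pt_lim (fun s => f s y) x (f1 x y)) /\
    (forall x y, derivable_pt_lim (fun s => f x s) y (f2 x y)) /\
    (forall x y, derivable_pt_lim (fun s => f1 s y) x (f11 x y)) /\
    (forall x y, derivable_pt_lim (fun s => f1 x s) y (f12 x y)) /\
    (forall x y, derivable_pt_lim (fun s => f2 x s) y (f22 x y)) /\
    exists a0 a1 a2 a11 a12 a22,
      a0 + a1 + a2 + a11 + a12 + a22 <= M /\
      forall x y,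
        Rabs (f x y) <= a0 /\ Rabs (f1 x y) <= a1 /\ Rabs (f2 x y) <= a2 /\
        Rabs (f11 x y) <= a11 /\ Rabs (f12 x y) <= a12 /\ Rabs (f22 x y) <= a22.

Definition norm2 (a b : R) : R := sqrt (a * a + b * b).

Definition div_free (u1 u2 : R -> R -> R -> R) : Prop :=
  forall t x y, 0 <= t -> exists a b,
    derivable_pt_lim (fun s => u1 t s y) x a /\
    derivable_pt_lim (fun s => u2 t x s) y b /\ a + b = 0.

Record step := mkStep { ra : R; rb : R; rc : R; rd : R; rh : R }.

Definition in_step (s : step) (x y : R) : Prop :=
  ra s <= x < rb s /\ rc s <= y < rd s.

Definition step_value (s : step) : R :=
  rh s * (rb s - ra s) * (rd s - rc s).

Fixpoint steps_sum (l : list step) : R :=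
  match l with nil => 0 | s :: l' => step_value s + steps_sum l' end.

Definition pairwise_disjoint (l : list step) : Prop :=
  forall i j d, (i < length l)%nat -> (j < length l)%nat -> i <> j ->
    forall x y, ~ (in_step (nth i l d) x y /\ in_step (nth j l d) x y).

(* || sup_{t >= 0} |u(t,.)| ||_{L^p(R^2)} <= M, i.e.
   int_{R^2} (sup_{t>=0} |u(t,x)|)^p dx <= M^p, where the integral of the
   nonnegative lower semicontinuous function F = (sup_t |u|)^p is taken as the
   supremum of integrals of nonnegative step functions on disjoint rectangles
   lying (strictly) below F (this coincides with the Lebesgue integral for
   lower semicontinuous F). *)
Definition sup_time_Lp_le (u1 u2 : R -> R -> R -> R) (p M : R) : Prop :=
  forall l : list step, pairwise_disjoint l ->
    (forall s, In s l ->
       ra s < rb s /\ rc s < rd s /\ 0 < rh s /\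
       forall x y, in_step s x y -> exists t, 0 <= t /\
         0 < norm2 (u1 t x y) (u2 t x y) /\
         rh s < Rpower (norm2 (u1 t x y) (u2 t x y)) p) ->
    steps_sum l <= Rpower M p.

Definition modulus (rho : R -> R) : Prop :=
  (forall r, 0 <= r -> continuity_pt rho r) /\
  (forall r s, 0 <= r -> r <= s -> rho r <= rho s) /\
  (forall r, 0 <= r -> 0 <= rho r) /\
  rho 0 = 0.

Definition breaks_at (theta : R -> R -> R -> R) (rho : R -> R) (t : R) : Prop :=
  exists x1 x2 y1 y2,
    Rabs (theta t x1 x2 - theta t y1 y2) > rho (norm2 (x1 - y1) (x2 - y2)).

Definition is_solution (u1 u2 : R -> R -> R -> R) (theta0 : R -> R -> R)
    (theta : R -> R -> R -> R) : Prop :=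
  smooth3_on (fun t _ _ => 0 < t) theta /\
  (exists M, forall t x y, 0 <= t -> Rabs (theta t x y) <= M) /\
  (forall x y, theta 0 x y = theta0 x y) /\
  (forall x y eps, 0 < eps -> exists delta, 0 < delta /\
     forall t x' y', 0 < t < delta -> Rabs (x' - x) < delta ->
       Rabs (y' - y) < delta -> Rabs (theta t x' y' - theta0 x y) < eps) /\
  exists Dt Dx Dy Dxx Dyy : R -> R -> R -> R,
    forall t x y, 0 < t ->
      derivable_pt_lim (fun s => theta s x y) t (Dt t x y) /\
      derivable_pt_lim (fun s => theta t s y) x (Dx t x y) /\
      derivable_pt_lim (fun s => theta t x s) y (Dy t x y) /\
      derivable_pt_lim (fun s => Dx t s y) x (Dxx t x y) /\
      derivable_pt_lim (fun s => Dy t x s) y (Dyy t x y) /\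
      Dt t x y + u1 t x y * Dx t x y + u2 t x y * Dy t x y
        - (Dxx t x y + Dyy t x y) = 0.

(* Main.v *)
Require Import Defs.
From Stdlib Require Import ZArith Reals List Lra Lia.
From Stdlib Require Import Classical ClassicalEpsilon FunctionalExtensionality.
From Coquelicot Require Import Coquelicot.
From mathcomp Require filter.
Open Scope R_scope.

(* An explicit vortex dipole, concentrated at scale z(t) around (z(t), 0) and its
   mirror image, pushes a bump centred at (z(t), 0) towards the origin.  With
   P = z^2 and speed about P^(-gam - 1/2), gam > 0, the bump shrinks from a fixed
   scale to an arbitrarily small one faster than diffusion erodes it: the explicit
   quadratic bump A (1 - 400 |X - (z,0)|^2 / z^2) is a subsolution whose amplitude A
   stays bounded below.  Since |u| decays like |X|^(-7) away from the vortex, the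
   supremum in time is at most of order |X|^(-1-2gam), which lies in L^p near 0 when
   (1 + 2 gam) p < 2, with small norm if the motion starts close to the origin.  The
   symmetric difference theta(t,x,y) - theta(t,-x,y) stays above the bump on x > 0 by
   the maximum principle, so theta has an oscillation bounded below over an
   arbitrarily small distance.  Existence of the solution comes from an explicit Euler
   scheme, whose stability in every C^k is immediate because the data are smooth, and
   an ultrafilter limit replaces compactness. *)

(** * Limits along an ultrafilter *)

(** The order of quantifiers shapes the proof: the time and the datum precede [rho], so [rho] may
    influence only the final width [e] of the motion, and every other constant must be uniform in
    [e]. With [R = ramp], comparable to [t0 - t + e] before [t0], the motion is [P = R^b] with
    [b = 1 / (1 + gam)], for which [P'] is of order [P^(- gam)]. Diffusion costs the bump a factor
    governed by the integral of [1 / P], that is of [R^(- b)]; since [b < 1] it converges uniformly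
    in [e], and this fixes the lower bound [A0] of the amplitude before [rho] is known. The bump
    survives advection only if the flow near its centre is almost a rigid translation: a strain of
    the natural size [|P'| / P] would compete with the gain from shrinking. The dipole is therefore
    tuned so that its velocity gradient vanishes at [(z, 0)]. The norm in the statement is a
    supremum over step functions on rectangles. A majorant of the form [c f(x) f(y)] turns it into
    increments of a bounded monotone primitive of [f], a finite computation. *)

Record free_ultrafilter (U : (nat -> Prop) -> Prop) : Prop := {
  fu_false : ~ U (fun _ => False);
  fu_and : forall A B, U A -> U B -> U (fun n => A n /\ B n);
  fu_mono : forall A B : nat -> Prop, (forall n, A n -> B n) -> U A -> U B;
  fu_compl : forall A, U A \/ U (fun n => ~ A n);
  fu_tail : forall N, U (fun n => (N <= n)%nat) }.

(** An ultrafilter extending the Fréchet filter of tails. It gives limits of bounded sequences at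
    all points and for all derivatives simultaneously, in the role usually played by diagonal
    subsequences. *)
Lemma free_ultrafilter_exists : exists U, free_ultrafilter U.
Proof.
  set (F := fun A : nat -> Prop => exists N, forall n, (N <= n)%nat -> A n).
  assert (PF : filter.ProperFilter F).
  { constructor.
    - intros [N HN]. exact (HN N (Nat.le_refl N)).
    - constructor.
      + exists 0%nat. intros; exact I.
      + intros A B [N HN] [M HM]. exists (Nat.max N M). intros n Hn.
        split; [apply HN | apply HM]; lia.
      + intros A B HAB [N HN]. exists N. intros n Hn. apply HAB, HN, Hn. }
  destruct (filter.ultraFilterLemma PF) as [G [UG FG]].
  exists G.
  destruct (@filter.ultra_proper _ _ UG) as [GE [GT GI GS]].
  constructor.
  - exact GE.
  - intros A B HA HB. exact (GI A B HA HB).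
  - intros A B HAB HA. exact (GS A B HAB HA).
  - intros A. exact (filter.in_ultra_setVsetC A UG).
  - intros N. apply FG. exists N. tauto.
Qed.

Definition is_ulim (U : (nat -> Prop) -> Prop) (u : nat -> R) (l : R) : Prop :=
  forall eps, 0 < eps -> U (fun n => Rabs (u n - l) < eps).

Definition ulim (U : (nat -> Prop) -> Prop) (u : nat -> R) : R :=
  epsilon (inhabits 0) (is_ulim U u).

Lemma fu_ex U : free_ultrafilter U -> forall A, U A -> exists n, A n.
Proof.
  intros HU A HA. apply NNPP. intros HN. apply (fu_false U HU).
  apply (fu_mono U HU A); [|exact HA]. intros n Hn. apply HN. now exists n.
Qed.

(** The limit is the supremum of those [x] for which [x <= u n] holds on a set of [U]; maximality of
    [U] supplies the upper estimate. *)
Lemma ulim_spec U u M : free_ultrafilter U -> (forall n, Rabs (u n) <= M) ->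
  is_ulim U u (ulim U u).
Proof.
  intros HU HM. apply (epsilon_spec (inhabits 0) (is_ulim U u)).
  assert (HM' : forall n, - M <= u n <= M).
  { intros n. specialize (HM n). apply Rabs_le_between in HM. lra. }
  destruct (completeness (fun x => U (fun n => x <= u n))) as [l [Hl1 Hl2]].
  - exists M. intros x Hx. destruct (fu_ex U HU _ Hx) as [n Hn].
    specialize (HM' n). lra.
  - exists (- M). apply (fu_mono U HU (fun n => (0 <= n)%nat)).
    + intros n _. apply HM'.
    + apply (fu_tail U HU).
  - exists l. intros eps Heps.
    assert (H1 : U (fun n => l - eps < u n)).
    { apply NNPP. intros HN. assert (l <= l - eps); [|lra]. apply Hl2.
      intros x Hx. apply Rnot_lt_le. intros Hlt. apply HN.
      eapply (fu_mono U HU); [|exact Hx]. simpl; intros; lra. }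
    assert (H2 : U (fun n => u n < l + eps)).
    { destruct (fu_compl U HU (fun n => l + eps <= u n)) as [H|H].
      - apply Hl1 in H. lra.
      - eapply (fu_mono U HU); [|exact H]. simpl; intros; lra. }
    eapply (fu_mono U HU); [|exact (fu_and U HU _ _ H1 H2)].
    simpl; intros n [? ?]. apply Rabs_def1; lra.
Qed.

Lemma is_ulim_unique U u l l' : free_ultrafilter U ->
  is_ulim U u l -> is_ulim U u l' -> l = l'.
Proof.
  intros HU H H'. apply NNPP. intros Hne.
  assert (He : 0 < Rabs (l - l') / 2).
  { assert (0 < Rabs (l - l')) by (apply Rabs_pos_lt; lra). lra. }
  destruct (fu_ex U HU _ (fu_and U HU _ _ (H _ He) (H' _ He))) as [n [H1 H2]].
  assert (Rabs (l - l') <= Rabs (u n - l) + Rabs (u n - l')).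
  { replace (l - l') with (- (u n - l) + (u n - l')) by ring.
    eapply Rle_trans; [apply Rabs_triang|]. rewrite Rabs_Ropp. lra. }
  lra.
Qed.

Lemma ulim_eq U u l : free_ultrafilter U -> is_ulim U u l -> ulim U u = l.
Proof.
  intros HU H. apply (is_ulim_unique U u); auto.
  apply (epsilon_spec (inhabits 0) (is_ulim U u)). now exists l.
Qed.

Lemma is_ulim_plus U u v l m : free_ultrafilter U ->
  is_ulim U u l -> is_ulim U v m -> is_ulim U (fun n => u n + v n) (l + m).
Proof.
  intros HU Hu Hv eps He. assert (He2 : 0 < eps / 2) by lra.
  eapply (fu_mono U HU); [|exact (fu_and U HU _ _ (Hu _ He2) (Hv _ He2))].
  simpl. intros n [H1 H2]. replace (u n + v n - (l + m)) with ((u n - l) + (v n - m)) by ring.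
  eapply Rle_lt_trans; [apply Rabs_triang|]. lra.
Qed.

Lemma is_ulim_scal U c u l : free_ultrafilter U ->
  is_ulim U u l -> is_ulim U (fun n => c * u n) (c * l).
Proof.
  intros HU Hu eps He.
  assert (0 <= Rabs c) by apply Rabs_pos.
  assert (He2 : 0 < eps / (Rabs c + 1)) by (apply Rdiv_lt_0_compat; lra).
  eapply (fu_mono U HU); [|exact (Hu _ He2)].
  simpl. intros n H1. rewrite <- Rmult_minus_distr_l, Rabs_mult.
  assert (Rabs (u n - l) * (Rabs c + 1) < eps).
  { apply (Rmult_lt_compat_r (Rabs c + 1)) in H1; [|lra].
    unfold Rdiv in H1. rewrite Rmult_assoc, Rinv_l in H1; lra. }
  assert (0 <= Rabs (u n - l)) by apply Rabs_pos. nra.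
Qed.

(** The bound may vary with [n], so that discretisation errors vanishing with the mesh disappear
    from the limiting inequality. *)
Lemma is_ulim_abs_le U u l K (k : R) : free_ultrafilter U -> is_ulim U u l ->
  is_lim_seq K k -> (forall n, Rabs (u n) <= K n) -> Rabs l <= k.
Proof.
  intros HU Hu HK Hb. apply Rnot_lt_le. intros Hlt.
  assert (He : 0 < (Rabs l - k) / 2) by lra.
  apply is_lim_seq_spec in HK. unfold is_lim_seq' in HK.
  destruct (HK (mkposreal _ He)) as [N HN]. simpl in HN.
  destruct (fu_ex U HU _ (fu_and U HU _ _ (Hu _ He) (fu_tail U HU N))) as [n [H1 H2]].
  specialize (HN n H2). specialize (Hb n).
  apply Rabs_def2 in HN.
  assert (Rabs l <= Rabs (u n - l) + Rabs (u n)).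
  { replace l with (- (u n - l) + u n) at 1 by ring.
    eapply Rle_trans; [apply Rabs_triang|]. rewrite Rabs_Ropp. lra. }
  lra.
Qed.

(** * Functions with bounded partial derivatives *)

(** The boolean names the direction, [true] for the first variable. Partial derivatives are
    derivatives at [0] of a shift, so both directions share the same lemmas. *)
Definition sh (b : bool) (h : R) (f : R -> R -> R) (x y : R) : R :=
  if b then f (x + h) y else f x (y + h).

Definition pd (b : bool) (f : R -> R -> R) (x y : R) : R :=
  Derive (fun s => sh b s f x y) 0.

Definition dq (b : bool) (h : R) (f : R -> R -> R) (x y : R) : R :=
  / h * sh b h f x y + - / h * f x y.

(** One constant bounds all iterated partials up to order [k], in every order of differentiation.
    Continuity is not part of the definition: it follows from the bound one order higher. *)
Fixpoint Bd (k : nat) (M : R) (f : R -> R -> R) : Prop :=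
  (forall x y, Rabs (f x y) <= M) /\
  match k with
  | O => True
  | S k' => forall b, (forall x y, ex_derive (fun s => sh b s f x y) 0) /\ Bd k' M (pd b f)
  end.

Fixpoint D (w : list bool) (f : R -> R -> R) : R -> R -> R :=
  match w with nil => f | b :: w' => D w' (pd b f) end.

Lemma Bd_abs k M f x y : Bd k M f -> Rabs (f x y) <= M.
Proof. destruct k; intros [H _]; apply H. Qed.

Lemma Bd_ge0 k M f : Bd k M f -> 0 <= M.
Proof. intros H. eapply Rle_trans; [apply Rabs_pos | exact (Bd_abs k M f 0 0 H)]. Qed.

Lemma Bd_ex k M f b x y : Bd (S k) M f -> ex_derive (fun s => sh b s f x y) 0.
Proof. intros [_ H]. exact (proj1 (H b) x y). Qed.

Lemma Bd_pd k M f b : Bd (S k) M f -> Bd k M (pd b f).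
Proof. intros [_ H]. exact (proj2 (H b)). Qed.

Lemma Bd_weaken k : forall M N f, M <= N -> Bd k M f -> Bd k N f.
Proof.
  induction k as [|k IH]; intros M N f HMN [H1 H2]; (split; [intros; eapply Rle_trans; eauto|]).
  - exact I.
  - intros b. destruct (H2 b) as [H3 H4]. split; [exact H3|]. exact (IH M N _ HMN H4).
Qed.

Lemma Bd_pred k : forall M f, Bd (S k) M f -> Bd k M f.
Proof.
  induction k as [|k IH]; intros M f [H1 H2]; (split; [exact H1|]).
  - exact I.
  - intros b. destruct (H2 b) as [H3 H4]. split; [exact H3|]. exact (IH M _ H4).
Qed.

Lemma Bd_D w : forall k M f, Bd (length w + k) M f -> Bd k M (D w f).
Proof.
  induction w as [|b w IH]; intros k M f H; [exact H|].
  apply IH. exact (Bd_pd _ _ _ b H).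
Qed.

Lemma sh_0 b f x y : sh b 0 f x y = f x y.
Proof. unfold sh. destruct b; f_equal; ring. Qed.

Lemma sh_sh b b' h h' f x y : sh b h (sh b' h' f) x y = sh b' h' (sh b h f) x y.
Proof. destruct b, b'; unfold sh; try reflexivity; f_equal; ring. Qed.

Lemma is_derive_sh b f x y s0 : (forall x y, ex_derive (fun s => sh b s f x y) 0) ->
  is_derive (fun s => sh b s f x y) s0 (sh b s0 (pd b f) x y).
Proof.
  intros H.
  set (x' := if b then x + s0 else x). set (y' := if b then y else y + s0).
  assert (E : sh b s0 (pd b f) x y = pd b f x' y') by (unfold sh, x', y'; destruct b; reflexivity).
  rewrite E.
  apply (is_derive_ext (fun s => sh b (s - s0) f x' y')).
  - intros s. unfold sh, x', y'. destruct b; f_equal; ring.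
  - replace (pd b f x' y') with (scal 1 (pd b f x' y')) by (unfold scal; simpl; unfold mult; simpl; ring).
    apply (is_derive_comp (fun s => sh b s f x' y') (fun s => s - s0)).
    + replace (s0 - s0) with 0 by ring. apply Derive_correct, H.
    + auto_derive; auto.
Qed.

Lemma pd_unique b f g : (forall x y, is_derive (fun s => sh b s f x y) 0 (g x y)) -> pd b f = g.
Proof. intros H. extensionality x. extensionality y. apply is_derive_unique, H. Qed.

Lemma increment_le (phi dphi : R -> R) M a b : (forall s, is_derive phi s (dphi s)) ->
  (forall s, Rabs (dphi s) <= M) -> Rabs (phi a - phi b) <= M * Rabs (a - b).
Proof.
  intros H HM.
  destruct (MVT_gen phi b a dphi) as [c [_ Hc]].
  - intros s _. apply H.
  - intros s _. apply derivable_continuous_pt. exists (dphi s). apply is_derive_Reals, H.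
  - rewrite Hc, Rabs_mult. apply Rmult_le_compat_r; [apply Rabs_pos | apply HM].
Qed.

Lemma Bd_lipschitz k M f b h x y : Bd (S k) M f ->
  Rabs (sh b h f x y - f x y) <= M * Rabs h.
Proof.
  intros H. pose proof (Bd_pd _ _ _ b H) as H3.
  rewrite <- (sh_0 b f x y) at 1. replace h with (h - 0) at 2 by ring.
  apply (increment_le (fun s => sh b s f x y) (fun s => sh b s (pd b f) x y)).
  - intros s. apply is_derive_sh. intros; eapply Bd_ex, H.
  - intros s. unfold sh; destruct b; eapply Bd_abs; exact H3.
Qed.

Lemma is_derive_lin b c d f g x y df dg :
  is_derive (fun s => sh b s f x y) 0 df -> is_derive (fun s => sh b s g x y) 0 dg ->
  is_derive (fun s => sh b s (fun x y => c * f x y + d * g x y) x y) 0 (c * df + d * dg).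
Proof.
  intros Hf Hg.
  apply (is_derive_ext (fun s => c * sh b s f x y + d * sh b s g x y)).
  - intros s. unfold sh; destruct b; reflexivity.
  - apply (is_derive_plus (fun s => c * sh b s f x y) (fun s => d * sh b s g x y));
      apply is_derive_scal; assumption.
Qed.

Lemma Bd_lin k : forall c d M N f g, Bd k M f -> Bd k N g ->
  Bd k (Rabs c * M + Rabs d * N) (fun x y => c * f x y + d * g x y).
Proof.
  induction k as [|k IH]; intros c d M N f g [Hf1 Hf2] [Hg1 Hg2].
  all: split; [intros x y; eapply Rle_trans; [apply Rabs_triang|]; rewrite !Rabs_mult;
    apply Rplus_le_compat; apply Rmult_le_compat_l; auto using Rabs_pos|].
  - exact I.
  - intros b. destruct (Hf2 b) as [Hf3 Hf4]. destruct (Hg2 b) as [Hg3 Hg4].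
    assert (E : forall x y, is_derive (fun s => sh b s (fun x y => c * f x y + d * g x y) x y) 0
      (c * pd b f x y + d * pd b g x y)).
    { intros x y. apply is_derive_lin; apply Derive_correct; auto. }
    split.
    + intros x y. eexists. apply E.
    + rewrite (pd_unique _ _ _ E). apply IH; assumption.
Qed.

Lemma Bd_plus k M N f g : Bd k M f -> Bd k N g -> Bd k (M + N) (fun x y => f x y + g x y).
Proof.
  intros Hf Hg. generalize (Bd_lin k 1 1 M N f g Hf Hg).
  rewrite Rabs_R1. replace (1 * M + 1 * N) with (M + N) by ring.
  replace (fun x y => 1 * f x y + 1 * g x y) with (fun x y => f x y + g x y); [tauto|].
  extensionality x; extensionality y; ring.
Qed.

Lemma Bd_scal k c M f : Bd k M f -> Bd k (Rabs c * M) (fun x y => c * f x y).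
Proof.
  intros Hf. generalize (Bd_lin k c 0 M M f f Hf Hf).
  rewrite Rabs_R0. replace (Rabs c * M + 0 * M) with (Rabs c * M) by ring.
  replace (fun x y => c * f x y + 0 * f x y) with (fun x y => c * f x y); [tauto|].
  extensionality x; extensionality y; ring.
Qed.

Lemma is_derive_prod b f g x y df dg :
  is_derive (fun s => sh b s f x y) 0 df -> is_derive (fun s => sh b s g x y) 0 dg ->
  is_derive (fun s => sh b s (fun x y => f x y * g x y) x y) 0 (df * g x y + f x y * dg).
Proof.
  intros Hf Hg.
  apply (is_derive_ext (fun s => sh b s f x y * sh b s g x y)).
  - intros s. unfold sh; destruct b; reflexivity.
  - pattern (f x y); rewrite <- (sh_0 b f x y). pattern (g x y); rewrite <- (sh_0 b g x y).
    apply (is_derive_mult (fun s => sh b s f x y) (fun s => sh b s g x y)); auto.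
    intros; apply Rmult_comm.
Qed.

(** The factor [2 ^ k] counts Leibniz terms: each differentiation doubles the number of products. *)
Lemma Bd_mult k : forall M N f g, Bd k M f -> Bd k N g ->
  Bd k (2 ^ k * M * N) (fun x y => f x y * g x y).
Proof.
  induction k as [|k IH]; intros M N f g Hf Hg.
  - split; [|exact I]. intros x y. rewrite Rabs_mult. simpl. rewrite Rmult_1_l.
    apply Rmult_le_compat; auto using Rabs_pos; eapply Bd_abs; eauto.
  - assert (0 <= M) by exact (Bd_ge0 _ _ _ Hf). assert (0 <= N) by exact (Bd_ge0 _ _ _ Hg).
    assert (Hp : 1 <= 2 ^ k) by (apply pow_R1_Rle; lra).
    assert (HMN : 0 <= M * N) by nra.
    split.
    + intros x y. rewrite Rabs_mult.
      apply Rle_trans with (M * N).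
      * apply Rmult_le_compat; auto using Rabs_pos; eapply Bd_abs; eauto.
      * simpl. nra.
    + intros b. pose proof (Bd_pred _ _ _ Hf) as Hf'. pose proof (Bd_pred _ _ _ Hg) as Hg'.
      destruct Hf as [_ Hf2]. destruct Hg as [_ Hg2].
      destruct (Hf2 b) as [Hf3 Hf4]. destruct (Hg2 b) as [Hg3 Hg4].
      assert (E : forall x y, is_derive (fun s => sh b s (fun x y => f x y * g x y) x y) 0
        (pd b f x y * g x y + f x y * pd b g x y)).
      { intros x y. apply is_derive_prod; apply Derive_correct; auto. }
      split; [intros x y; eexists; apply E|].
      rewrite (pd_unique _ _ _ E).
      replace (2 ^ S k * M * N) with (2 ^ k * M * N + 2 ^ k * M * N) by (simpl; ring).
      apply (Bd_plus k _ _ (fun x y => pd b f x y * g x y) (fun x y => f x y * pd b g x y));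
        apply IH; assumption.
Qed.

Lemma pd_sh b b' h f : pd b' (sh b h f) = sh b h (pd b' f).
Proof.
  extensionality x; extensionality y.
  transitivity (Derive (fun s => sh b h (sh b' s f) x y) 0).
  - unfold pd. apply Derive_ext. intros s. apply sh_sh.
  - unfold sh at 1 3. destruct b; reflexivity.
Qed.

Lemma Bd_sh k : forall M f b h, Bd k M f -> Bd k M (sh b h f).
Proof.
  induction k as [|k IH]; intros M f b h Hf.
  all: split; [intros x y; unfold sh; destruct b; eapply Bd_abs; eauto|].
  - exact I.
  - intros b'. destruct Hf as [_ Hf]. destruct (Hf b') as [Hf1 Hf2].
    split.
    + intros x y.
      apply (ex_derive_ext (fun s => sh b h (sh b' s f) x y)); [intros; apply sh_sh|].
      unfold sh at 1. destruct b; apply Hf1.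
    + rewrite pd_sh. apply IH, Hf2.
Qed.

Lemma pd_lin k M N b c d f g : Bd (S k) M f -> Bd (S k) N g ->
  pd b (fun x y => c * f x y + d * g x y) = (fun x y => c * pd b f x y + d * pd b g x y).
Proof.
  intros Hf Hg. apply pd_unique. intros x y.
  apply is_derive_lin; apply Derive_correct; [eapply Bd_ex, Hf | eapply Bd_ex, Hg].
Qed.

Lemma pd_dq k M b b' h f : Bd (S k) M f -> pd b' (dq b h f) = dq b h (pd b' f).
Proof.
  intros H. unfold dq at 1. rewrite (pd_lin k M M) by auto using Bd_sh.
  now rewrite pd_sh.
Qed.

(** By the mean value theorem a difference quotient costs one derivative but keeps the constant for
    every [h]. This uniformity in the mesh is what makes the scheme stable in every order. *)
Lemma Bd_dq k : forall M f b h, h <> 0 -> Bd (S k) M f -> Bd k M (dq b h f).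
Proof.
  assert (A : forall k M f b h, h <> 0 -> Bd (S k) M f -> forall x y, Rabs (dq b h f x y) <= M).
  { intros k' M f b h Hh H x y. unfold dq.
    replace (/ h * sh b h f x y + - / h * f x y) with (/ h * (sh b h f x y - f x y)) by ring.
    assert (0 < Rabs h) by now apply Rabs_pos_lt.
    rewrite Rabs_mult, Rabs_inv.
    apply Rmult_le_reg_l with (Rabs h); auto.
    rewrite <- Rmult_assoc, Rinv_r, Rmult_1_l, (Rmult_comm (Rabs h)) by lra.
    now apply Bd_lipschitz with k'. }
  induction k as [|k IH]; intros M f b h Hh H; (split; [apply (A _ _ _ _ _ Hh H)|]).
  - exact I.
  - intros b'. split.
    + intros x y. pose proof (Bd_pred _ _ _ H) as H'.
      pose proof (Bd_lin _ (/ h) (- / h) _ _ _ _ (Bd_sh _ _ _ b h H') H') as HL.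
      exact (Bd_ex _ _ _ b' x y HL).
    + rewrite (pd_dq (S k) M) by assumption. apply IH; [assumption|]. exact (Bd_pd _ _ _ b' H).
Qed.

Lemma is_derive_shift (phi : R -> R) x l :
  is_derive (fun s => phi (x + s)) 0 l <-> is_derive phi x l.
Proof.
  split; intros H.
  - apply (is_derive_ext (fun s => phi (x + (s - x)))); [intros; f_equal; ring|].
    replace l with (scal 1 l) by (unfold scal; simpl; unfold mult; simpl; ring).
    apply (is_derive_comp (fun s => phi (x + s)) (fun s => s - x)).
    + now rewrite Rminus_diag.
    + auto_derive; auto.
  - replace l with (scal 1 l) by (unfold scal; simpl; unfold mult; simpl; ring).
    apply (is_derive_comp phi (fun s => x + s)).
    + now rewrite Rplus_0_r.
    + auto_derive; auto.
Qed.

Lemma is_derive_sh_true f x y l :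
  is_derive (fun s => sh true s f x y) 0 l <-> is_derive (fun s => f s y) x l.
Proof. exact (is_derive_shift (fun s => f s y) x l). Qed.

Lemma is_derive_sh_false f x y l :
  is_derive (fun s => sh false s f x y) 0 l <-> is_derive (fun s => f x s) y l.
Proof. exact (is_derive_shift (fun s => f x s) y l). Qed.

Lemma Derive_shift (phi : R -> R) x : Derive (fun s => phi (x + s)) 0 = Derive phi x.
Proof.
  unfold Derive. f_equal. apply Lim_ext. intros h. now rewrite Rplus_0_l, Rplus_0_r.
Qed.

Lemma Bd_continuity_2d k M f x y : Bd (S k) M f -> continuity_2d_pt f x y.
Proof.
  intros H eps. pose proof (Bd_ge0 _ _ _ H) as HM.
  assert (Hd : 0 < eps / (2 * M + 1)) by (apply Rdiv_lt_0_compat; [apply cond_pos | lra]).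
  exists (mkposreal _ Hd). simpl. intros u v Hu Hv.
  pose proof (Bd_lipschitz k M f true (u - x) x v H) as H1.
  pose proof (Bd_lipschitz k M f false (v - y) x y H) as H2.
  unfold sh in H1, H2. replace (x + (u - x)) with u in H1 by ring.
  replace (y + (v - y)) with v in H2 by ring.
  replace (f u v - f x y) with ((f u v - f x v) + (f x v - f x y)) by ring.
  eapply Rle_lt_trans; [apply Rabs_triang|].
  set (d := eps / (2 * M + 1)) in *.
  assert (E : d * (2 * M + 1) = eps) by (unfold d; field; lra).
  assert (M * Rabs (u - x) <= M * d) by (apply Rmult_le_compat_l; lra).
  assert (M * Rabs (v - y) <= M * d) by (apply Rmult_le_compat_l; lra).
  lra.
Qed.

(** Schwarz's theorem; the third order is there because continuity of the second derivatives is read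
    off from bounds on the third ones. *)
Lemma pd_comm k M b b' f : Bd (S (S (S k))) M f -> pd b (pd b' f) = pd b' (pd b f).
Proof.
  assert (A : Bd (S (S (S k))) M f -> pd true (pd false f) = pd false (pd true f)).
  { intros H. extensionality x; extensionality y.
    assert (E1 : forall g x y, pd true g x y = Derive (fun z => g z y) x)
      by (intros g u v; exact (Derive_shift (fun z => g z v) u)).
    assert (E2 : forall g x y, pd false g x y = Derive (fun z => g x z) y)
      by (intros g u v; exact (Derive_shift (fun z => g u z) v)).
    rewrite E1, E2.
    rewrite (Derive_ext (fun z => pd false f z y) (fun z => Derive (fun t => f z t) y))
      by (intros; apply E2).
    rewrite (Derive_ext (fun z => pd true f x z) (fun z => Derive (fun t => f t z) x))
      by (intros; apply E1).
    pose proof (Bd_pd _ _ _ true H) as Ht. pose proof (Bd_pd _ _ _ false H) as Hf.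
    apply Schwarz.
    - exists (mkposreal 1 Rlt_0_1). intros u v _ _.
      repeat split.
      + destruct (Bd_ex _ _ _ true u v H) as [l Hl]. exists l. exact (proj1 (is_derive_sh_true f u v l) Hl).
      + destruct (Bd_ex _ _ _ false u v H) as [l Hl]. exists l. exact (proj1 (is_derive_sh_false f u v l) Hl).
      + destruct (Bd_ex _ _ _ true u v Hf) as [l Hl]. exists l. apply (proj1 (is_derive_sh_true (pd false f) u v l)) in Hl.
        eapply is_derive_ext; [|exact Hl]. intros; apply E2.
      + destruct (Bd_ex _ _ _ false u v Ht) as [l Hl]. exists l. apply (proj1 (is_derive_sh_false (pd true f) u v l)) in Hl.
        eapply is_derive_ext; [|exact Hl]. intros; apply E1.
    - apply (continuity_2d_pt_ext (pd true (pd false f))).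
      + intros u v. rewrite E1. apply Derive_ext. intros; apply E2.
      + eapply Bd_continuity_2d. exact (Bd_pd _ _ _ true Hf).
    - apply (continuity_2d_pt_ext (pd false (pd true f))).
      + intros u v. rewrite E2. apply Derive_ext. intros; apply E1.
      + eapply Bd_continuity_2d. exact (Bd_pd _ _ _ false Ht). }
  intros H. destruct b, b'; auto. symmetry; auto.
Qed.

(** The quotient equals the derivative at an intermediate shift of size at most [|h|], and the
    second derivative controls the difference. Higher orders follow because [pd] commutes with [dq]
    and with itself. *)
Lemma Bd_dq_sub_pd k : forall M f b h, h <> 0 -> Bd (S (S k)) M f ->
  Bd k (M * Rabs h) (fun x y => 1 * dq b h f x y + -1 * pd b f x y).
Proof.
  assert (A : forall k M f b h, h <> 0 -> Bd (S (S k)) M f -> forall x y,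
    Rabs (1 * dq b h f x y + -1 * pd b f x y) <= M * Rabs h).
  { intros k' M f b h Hh H x y.
    assert (Hex : forall x y, ex_derive (fun s => sh b s f x y) 0) by (intros; eapply Bd_ex, H).
    destruct (MVT_gen (fun s => sh b s f x y) 0 h (fun s => sh b s (pd b f) x y)) as [c [Hc1 Hc2]].
    - intros s _. apply is_derive_sh, Hex.
    - intros s _. apply derivable_continuous_pt. exists (sh b s (pd b f) x y).
      apply is_derive_Reals, is_derive_sh, Hex.
    - rewrite sh_0 in Hc2. unfold dq.
      replace (1 * (/ h * sh b h f x y + - / h * f x y) + -1 * pd b f x y)
        with (/ h * (sh b h f x y - f x y) - pd b f x y) by ring.
      rewrite Hc2. replace (/ h * (sh b c (pd b f) x y * (h - 0)) - pd b f x y)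
        with (sh b c (pd b f) x y - pd b f x y) by (field; auto).
      eapply Rle_trans; [eapply Bd_lipschitz; exact (Bd_pd _ _ _ b H)|].
      apply Rmult_le_compat_l; [apply (Bd_ge0 _ _ _ H)|].
      revert Hc1. unfold Rmin, Rmax. destruct (Rle_dec 0 h); intros;
        unfold Rabs; repeat destruct Rcase_abs; lra. }
  induction k as [|k IH]; intros M f b h Hh H; (split; [apply (A _ _ _ _ _ Hh H)|]).
  - exact I.
  - pose proof (Bd_dq (S k) M f b h Hh (Bd_pred _ _ _ H)) as H1.
    pose proof (Bd_pred _ _ _ (Bd_pd _ _ _ b H)) as H2.
    intros b'. split.
    + intros x y. exact (Bd_ex _ _ _ b' x y (Bd_lin _ 1 (-1) _ _ _ _ H1 H2)).
    + rewrite (pd_lin k M M) by assumption.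
      rewrite (pd_dq (S (S k)) M) by assumption.
      rewrite (pd_comm k M b' b) by assumption.
      apply IH; [assumption|]. exact (Bd_pd _ _ _ b' H).
Qed.

Lemma is_derive_quadratic (phi : R -> R) x l C r : 0 < r ->
  (forall s, Rabs s < r -> Rabs (phi (x + s) - phi x - s * l) <= C * s ^ 2) ->
  is_derive phi x l.
Proof.
  intros Hr H. apply is_derive_Reals. intros eps He.
  assert (HC : 0 < Rabs C + 1) by (pose proof (Rabs_pos C); lra).
  assert (Hd : 0 < Rmin r (eps / (Rabs C + 1))).
  { apply Rmin_pos; [auto | apply Rdiv_lt_0_compat; auto]. }
  exists (mkposreal _ Hd). simpl. intros h Hh Hlt.
  assert (H1 : Rabs h < r) by (eapply Rlt_le_trans; [exact Hlt | apply Rmin_l]).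
  assert (H2 : Rabs h < eps / (Rabs C + 1)) by (eapply Rlt_le_trans; [exact Hlt | apply Rmin_r]).
  specialize (H h H1).
  assert (Hp : 0 < Rabs h) by now apply Rabs_pos_lt.
  replace ((phi (x + h) - phi x) / h - l) with (/ h * (phi (x + h) - phi x - h * l)) by (field; auto).
  rewrite Rabs_mult, Rabs_inv.
  apply Rmult_lt_reg_l with (Rabs h); auto.
  rewrite <- Rmult_assoc, Rinv_r, Rmult_1_l by lra.
  eapply Rle_lt_trans; [exact H|].
  assert (C * h ^ 2 <= Rabs C * (Rabs h * Rabs h)).
  { replace (h ^ 2) with (Rabs h * Rabs h) by (rewrite <- Rabs_mult, Rabs_pos_eq; nra).
    apply Rmult_le_compat_r; [nra | apply Rle_abs]. }
  assert (Rabs h * (Rabs C + 1) < eps).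
  { apply Rmult_lt_reg_r with (/ (Rabs C + 1)); [now apply Rinv_0_lt_compat|].
    rewrite Rmult_assoc, Rinv_r; lra. }
  nra.
Qed.

Definition ulimf U (f : nat -> R -> R -> R) : R -> R -> R :=
  fun x y => ulim U (fun n => f n x y).

Definition unif_smooth (f : nat -> R -> R -> R) : Prop :=
  forall k, exists M, forall n, Bd k M (f n).

Lemma is_ulimf U f k M x y : free_ultrafilter U -> (forall n, Bd k M (f n)) ->
  is_ulim U (fun n => f n x y) (ulimf U f x y).
Proof.
  intros HU H. apply ulim_spec with M; auto. intros n. eapply Bd_abs, H.
Qed.

(** The first-order Taylor remainder is at most [M s^2] uniformly in [n], so it survives the
    pointwise limit and identifies the derivative of the limit. *)
Lemma is_derive_ulimf U f k M b x y : free_ultrafilter U -> (forall n, Bd (S (S k)) M (f n)) ->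
  is_derive (fun s => sh b s (ulimf U f) x y) 0 (ulimf U (fun n => pd b (f n)) x y).
Proof.
  intros HU H. apply is_derive_quadratic with M 1; [lra|]. intros s _.
  rewrite Rplus_0_l, sh_0.
  assert (L : is_ulim U (fun n => sh b s (f n) x y + -1 * f n x y + - s * pd b (f n) x y)
    (sh b s (ulimf U f) x y + -1 * ulimf U f x y + - s * ulimf U (fun n => pd b (f n)) x y)).
  { apply is_ulim_plus; [assumption| |].
    - apply is_ulim_plus; [assumption| |].
      + unfold sh; destruct b; eapply is_ulimf; eassumption.
      + apply is_ulim_scal; [assumption|]. eapply is_ulimf; eassumption.
    - apply is_ulim_scal; [assumption|].
      apply (is_ulimf U (fun n => pd b (f n)) (S k) M); [assumption|].
      intros n. exact (Bd_pd _ _ _ b (H n)). }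
  replace (sh b s (ulimf U f) x y - ulimf U f x y - s * ulimf U (fun n => pd b (f n)) x y)
    with (sh b s (ulimf U f) x y + -1 * ulimf U f x y + - s * ulimf U (fun n => pd b (f n)) x y) by ring.
  apply (is_ulim_abs_le U _ _ (fun _ => M * s ^ 2) (M * s ^ 2) HU L); [apply is_lim_seq_const|].
  intros n. destruct (Req_dec s 0) as [->|Hs].
  { rewrite sh_0. replace (f n x y + -1 * f n x y + - 0 * pd b (f n) x y) with 0 by ring.
    rewrite Rabs_R0. lra. }
  pose proof (Bd_abs _ _ _ x y (Bd_dq_sub_pd k M (f n) b s Hs (H n))) as A.
  replace (sh b s (f n) x y + -1 * f n x y + - s * pd b (f n) x y)
    with (s * (1 * dq b s (f n) x y + -1 * pd b (f n) x y)) by (unfold dq; field; auto).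
  rewrite Rabs_mult. replace (s ^ 2) with (Rabs s * Rabs s) by (rewrite <- Rabs_mult, Rabs_pos_eq; nra).
  pose proof (Rabs_pos s). nra.
Qed.

Lemma pd_ulimf U f k M b : free_ultrafilter U -> (forall n, Bd (S (S k)) M (f n)) ->
  pd b (ulimf U f) = ulimf U (fun n => pd b (f n)).
Proof. intros HU H. apply pd_unique. intros. eapply is_derive_ulimf; eassumption. Qed.

Lemma Bd_ulimf U : free_ultrafilter U -> forall k M f, (forall n, Bd (S k) M (f n)) ->
  Bd k M (ulimf U f).
Proof.
  intros HU. induction k as [|k IH]; intros M f H; split.
  1, 3: intros x y; eapply (is_ulim_abs_le U _ _ (fun _ => M) M HU);
    [eapply is_ulimf; eassumption | apply is_lim_seq_const | intros n; eapply Bd_abs, H].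
  - exact I.
  - intros b. split.
    + intros x y. eexists. eapply is_derive_ulimf; eassumption.
    + rewrite (pd_ulimf U f k M) by assumption. apply IH.
      intros n. exact (Bd_pd _ _ _ b (H n)).
Qed.

Lemma unif_smooth_pd f b : unif_smooth f -> unif_smooth (fun n => pd b (f n)).
Proof.
  intros H k. destruct (H (S k)) as [M HM]. exists M. intros n. exact (Bd_pd _ _ _ b (HM n)).
Qed.

Lemma D_ulimf U w : free_ultrafilter U -> forall f, unif_smooth f ->
  D w (ulimf U f) = ulimf U (fun n => D w (f n)).
Proof.
  intros HU. induction w as [|b w IH]; intros f H; [reflexivity|].
  simpl. destruct (H 2%nat) as [M HM]. rewrite (pd_ulimf U f 0 M) by assumption.
  apply IH. now apply unif_smooth_pd.
Qed.

Lemma unif_smooth_D f w : unif_smooth f -> unif_smooth (fun n => D w (f n)).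
Proof.
  intros H k. destruct (H (length w + k)%nat) as [M HM]. exists M. intros n. apply Bd_D, HM.
Qed.

Lemma is_ulimf_D U f w x y : free_ultrafilter U -> unif_smooth f ->
  is_ulim U (fun n => D w (f n) x y) (D w (ulimf U f) x y).
Proof.
  intros HU H. rewrite D_ulimf by assumption.
  destruct (unif_smooth_D f w H O) as [M HM].
  exact (is_ulimf U (fun n => D w (f n)) O M x y HU HM).
Qed.

Lemma D_lin w : forall M N c d f g, Bd (length w) M f -> Bd (length w) N g ->
  D w (fun x y => c * f x y + d * g x y) = (fun x y => c * D w f x y + d * D w g x y).
Proof.
  induction w as [|b w IH]; intros M N c d f g Hf Hg; [reflexivity|].
  simpl. rewrite (pd_lin (length w) M N) by assumption.
  apply IH with M N; [exact (Bd_pd _ _ _ b Hf) | exact (Bd_pd _ _ _ b Hg)].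
Qed.

(** * The explicit Euler scheme *)

(** Closure under derivatives makes each bound hold at every order. Derivatives exist for all real
    [t], as [smooth3] requires, but bounds are asked only for [t >= 0], because the time profile
    used later grows as [t] tends to minus infinity. *)
Definition bounded_family (F : (R -> R -> R -> R) -> Prop) : Prop :=
  forall g, F g ->
    cont3_on (fun _ _ _ => True) g /\
    (exists M, forall t x y, 0 <= t -> Rabs (g t x y) <= M) /\
    (exists g1, F g1 /\ forall t x y, derivable_pt_lim (fun s => g s x y) t (g1 t x y)) /\
    (exists g2, F g2 /\ forall t x y, derivable_pt_lim (fun s => g t s y) x (g2 t x y)) /\
    (exists g3, F g3 /\ forall t x y, derivable_pt_lim (fun s => g t x s) y (g3 t x y)).

Lemma family_pd F g b : bounded_family F -> F g ->
  exists g', F g' /\ forall t x y, is_derive (fun s => sh b s (g t) x y) 0 (g' t x y).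
Proof.
  intros HF Hg. destruct (HF g Hg) as (_ & _ & _ & (g2 & H2 & E2) & (g3 & H3 & E3)).
  destruct b; [exists g2 | exists g3]; (split; [assumption|]); intros t x y.
  - apply (proj2 (is_derive_sh_true (g t) x y _)). apply is_derive_Reals, E2.
  - apply (proj2 (is_derive_sh_false (g t) x y _)). apply is_derive_Reals, E3.
Qed.

Lemma family_Bd F : bounded_family F -> forall k g, F g ->
  exists M, forall t, 0 <= t -> Bd k M (g t).
Proof.
  intros HF. induction k as [|k IH]; intros g Hg;
    destruct (HF g Hg) as (_ & (M & HM) & _).
  - exists M. intros t Ht. split; [|exact I]. intros; now apply HM.
  - destruct (family_pd F g true HF Hg) as (g1 & H1 & E1).
    destruct (family_pd F g false HF Hg) as (g2 & H2 & E2).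
    destruct (IH g1 H1) as [M1 HM1]. destruct (IH g2 H2) as [M2 HM2].
    exists (Rmax M (Rmax M1 M2)). intros t Ht. split.
    + intros x y. eapply Rle_trans; [now apply HM | apply Rmax_l].
    + intros [|].
      * split; [intros; eexists; apply E1|].
        rewrite (pd_unique _ _ _ (E1 t)). eapply Bd_weaken; [|now apply HM1].
        eapply Rle_trans; [apply Rmax_l | apply Rmax_r].
      * split; [intros; eexists; apply E2|].
        rewrite (pd_unique _ _ _ (E2 t)). eapply Bd_weaken; [|now apply HM2].
        eapply Rle_trans; apply Rmax_r.
Qed.

Lemma increment_nonneg_le (phi dphi : R -> R) M a b : 0 <= a -> 0 <= b ->
  (forall s, is_derive phi s (dphi s)) ->
  (forall s, 0 <= s -> Rabs (dphi s) <= M) -> Rabs (phi a - phi b) <= M * Rabs (a - b).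
Proof.
  intros Ha Hb H HM.
  destruct (MVT_gen phi b a dphi) as [c [Hc1 Hc]].
  - intros s _. apply H.
  - intros s _. apply derivable_continuous_pt. exists (dphi s). apply is_derive_Reals, H.
  - rewrite Hc, Rabs_mult. apply Rmult_le_compat_r; [apply Rabs_pos | apply HM].
    eapply Rle_trans; [|apply Hc1]. now apply Rmin_glb.
Qed.

Lemma family_Bd_time F : bounded_family F -> forall k g, F g ->
  exists M, forall t t', 0 <= t -> 0 <= t' ->
    Bd k (M * Rabs (t - t')) (fun x y => 1 * g t x y + -1 * g t' x y).
Proof.
  intros HF. induction k as [|k IH]; intros g Hg.
  all: destruct (HF g Hg) as (_ & _ & (gt & Hgt & Et) & _);
    destruct (HF gt Hgt) as (_ & (M & HM) & _);
    assert (A : forall t t' x y, 0 <= t -> 0 <= t' ->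
      Rabs (1 * g t x y + -1 * g t' x y) <= M * Rabs (t - t'))
    by (intros t t' x y Ht Ht'; replace (1 * g t x y + -1 * g t' x y) with (g t x y - g t' x y) by ring;
      apply (increment_nonneg_le (fun s => g s x y) (fun s => gt s x y)); auto;
      intros; apply is_derive_Reals, Et).
  - exists M. intros t t' Ht Ht'. split; [|exact I]. intros; now apply A.
  - destruct (family_pd F g true HF Hg) as (g1 & H1 & E1).
    destruct (family_pd F g false HF Hg) as (g2 & H2 & E2).
    destruct (IH g1 H1) as [M1 HM1]. destruct (IH g2 H2) as [M2 HM2].
    exists (Rmax M (Rmax M1 M2)). intros t t' Ht Ht'.
    assert (Ha := Rabs_pos (t - t')).
    split.
    + intros x y. eapply Rle_trans; [now apply A | apply Rmult_le_compat_r; [auto|apply Rmax_l]].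
    + assert (G : forall b g', (forall t x y, is_derive (fun s => sh b s (g t) x y) 0 (g' t x y)) ->
        forall x y, is_derive (fun s => sh b s (fun x y => 1 * g t x y + -1 * g t' x y) x y) 0
          (1 * g' t x y + -1 * g' t' x y)).
      { intros b g' Eb x y. apply is_derive_lin; apply Eb. }
      intros [|].
      * split; [intros; eexists; apply (G true g1 E1)|].
        rewrite (pd_unique _ _ _ (G true g1 E1)). eapply Bd_weaken; [|now apply HM1].
        apply Rmult_le_compat_r; [auto|]. eapply Rle_trans; [apply Rmax_l | apply Rmax_r].
      * split; [intros; eexists; apply (G false g2 E2)|].
        rewrite (pd_unique _ _ _ (G false g2 E2)). eapply Bd_weaken; [|now apply HM2].
        apply Rmult_le_compat_r; [auto|]. eapply Rle_trans; apply Rmax_r.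
Qed.

Lemma pd_mult k M N b f g : Bd (S k) M f -> Bd (S k) N g ->
  pd b (fun x y => f x y * g x y) = (fun x y => 1 * (pd b f x y * g x y) + 1 * (f x y * pd b g x y)).
Proof.
  intros Hf Hg. apply pd_unique. intros x y.
  replace (1 * (pd b f x y * g x y) + 1 * (f x y * pd b g x y))
    with (pd b f x y * g x y + f x y * pd b g x y) by ring.
  apply is_derive_prod; apply Derive_correct; [eapply Bd_ex, Hf | eapply Bd_ex, Hg].
Qed.

(** The mean of forward and backward quotients is the centred difference; [lap], a forward quotient
    of a backward one, is the three-point second difference. *)
Definition ctr (b : bool) (h : R) (f : R -> R -> R) (x y : R) : R :=
  / 2 * dq b h f x y + / 2 * dq b (- h) f x y.

Definition lap (b : bool) (h : R) (f : R -> R -> R) : R -> R -> R := dq b h (dq b (- h) f).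

Definition genh1 (v : R -> R -> R) (b : bool) (h : R) (f : R -> R -> R) (x y : R) : R :=
  1 * lap b h f x y + -1 * (v x y * ctr b h f x y).

Definition genh (v : bool -> R -> R -> R) (h : R) (f : R -> R -> R) (x y : R) : R :=
  1 * genh1 (v true) true h f x y + 1 * genh1 (v false) false h f x y.

Definition gen1 (v : R -> R -> R) (b : bool) (f : R -> R -> R) (x y : R) : R :=
  1 * pd b (pd b f) x y + -1 * (v x y * pd b f x y).

Definition gen (v : bool -> R -> R -> R) (f : R -> R -> R) (x y : R) : R :=
  1 * gen1 (v true) true f x y + 1 * gen1 (v false) false f x y.

Lemma Bd_ctr k M b h f : h <> 0 -> Bd (S k) M f -> Bd k M (ctr b h f).
Proof.
  intros Hh H.
  replace M with (Rabs (/ 2) * M + Rabs (/ 2) * M) by (rewrite Rabs_pos_eq; lra).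
  apply (Bd_lin k (/ 2) (/ 2)); apply Bd_dq; auto; lra.
Qed.

Lemma Bd_lap k M b h f : h <> 0 -> Bd (S (S k)) M f -> Bd k M (lap b h f).
Proof. intros Hh H. apply Bd_dq; auto. apply Bd_dq; auto. lra. Qed.

Lemma Bd_sub k M N f g : Bd k M f -> Bd k N g -> Bd k (M + N) (fun x y => 1 * f x y + -1 * g x y).
Proof.
  intros Hf Hg. replace (M + N) with (Rabs 1 * M + Rabs (-1) * N).
  - now apply (Bd_lin k 1 (-1)).
  - rewrite Rabs_R1, Rabs_left by lra. ring.
Qed.

Lemma Bd_add k M N f g : Bd k M f -> Bd k N g -> Bd k (M + N) (fun x y => 1 * f x y + 1 * g x y).
Proof.
  intros Hf Hg. replace (M + N) with (Rabs 1 * M + Rabs 1 * N) by (rewrite Rabs_R1; ring).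
  now apply (Bd_lin k 1 1).
Qed.

Lemma Bd_genh k M V v h f : h <> 0 -> (forall b, Bd k V (v b)) -> Bd (S (S k)) M f ->
  Bd k (2 * (1 + 2 ^ k * V) * M) (genh v h f).
Proof.
  intros Hh Hv Hf.
  replace (2 * (1 + 2 ^ k * V) * M) with ((M + 2 ^ k * V * M) + (M + 2 ^ k * V * M)) by ring.
  apply (Bd_add k _ _ (genh1 (v true) true h f) (genh1 (v false) false h f));
    apply (Bd_sub k); try (now apply Bd_lap); apply (Bd_mult k); auto;
    apply Bd_ctr; auto; now apply Bd_pred.
Qed.

Lemma Bd_genh_sub_gen k M V v h f : h <> 0 -> (forall b, Bd k V (v b)) -> Bd (S (S (S k))) M f ->
  Bd k (2 * (2 + 2 ^ k * V) * M * Rabs h) (fun x y => 1 * genh v h f x y + -1 * gen v f x y).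
Proof.
  intros Hh Hv Hf. assert (Hh' : - h <> 0) by lra.
  assert (Hm := Rabs_Ropp h).
  assert (Q : forall b, Bd k (M * Rabs h + M * Rabs h + 2 ^ k * V * (M * Rabs h))
    (fun x y => 1 * genh1 (v b) b h f x y + -1 * gen1 (v b) b f x y)).
  { intros b. pose proof (Bd_dq (S (S k)) M f b (- h) Hh' Hf) as H1.
    pose proof (Bd_dq_sub_pd k M _ b h Hh H1) as H2.
    rewrite (pd_dq (S (S k)) M) in H2 by assumption.
    pose proof (Bd_dq_sub_pd k M _ b (- h) Hh' (Bd_pd _ _ _ b Hf)) as H3.
    pose proof (Bd_dq_sub_pd k M _ b h Hh (Bd_pred _ _ _ Hf)) as H4.
    pose proof (Bd_dq_sub_pd k M _ b (- h) Hh' (Bd_pred _ _ _ Hf)) as H5.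
    rewrite Hm in H3, H5.
    pose proof (Bd_lin k (/ 2) (/ 2) _ _ _ _ H4 H5) as H6.
    replace (Rabs (/ 2) * (M * Rabs h) + Rabs (/ 2) * (M * Rabs h)) with (M * Rabs h) in H6
      by (rewrite (Rabs_pos_eq (/ 2)); lra).
    pose proof (Bd_sub _ _ _ _ _ (Bd_add _ _ _ _ _ H2 H3) (Bd_mult k _ _ _ _ (Hv b) H6)) as H7.
    refine (eq_ind _ (Bd k _) H7 _ _).
    extensionality x; extensionality y. unfold genh1, gen1, lap, ctr. field. }
  replace (2 * (2 + 2 ^ k * V) * M * Rabs h) with
    ((M * Rabs h + M * Rabs h + 2 ^ k * V * (M * Rabs h)) +
     (M * Rabs h + M * Rabs h + 2 ^ k * V * (M * Rabs h))) by ring.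
  refine (eq_ind _ (Bd k _) (Bd_add _ _ _ _ _ (Q true) (Q false)) _ _).
  extensionality x; extensionality y. unfold genh, gen. ring.
Qed.

Lemma Bd_genh_drift k M V v v' h f : h <> 0 ->
  (forall b, Bd k V (fun x y => 1 * v b x y + -1 * v' b x y)) -> Bd (S k) M f ->
  Bd k (2 * (2 ^ k * V * M)) (fun x y => 1 * genh v h f x y + -1 * genh v' h f x y).
Proof.
  intros Hh Hv Hf.
  pose proof (fun b => Bd_mult k _ _ _ _ (Hv b) (Bd_ctr k M b h f Hh Hf)) as Q.
  pose proof (Bd_scal k (-1) _ _ (Bd_add _ _ _ _ _ (Q true) (Q false))) as H.
  replace (Rabs (-1) * (2 ^ k * V * M + 2 ^ k * V * M)) with (2 * (2 ^ k * V * M)) in H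
    by (rewrite Rabs_left by lra; ring).
  refine (eq_ind _ (Bd k _) H _ _).
  extensionality x; extensionality y. unfold genh, genh1. ring.
Qed.

Lemma Bd_gen_drift k M V v v' f :
  (forall b, Bd k V (fun x y => 1 * v b x y + -1 * v' b x y)) -> Bd (S k) M f ->
  Bd k (2 * (2 ^ k * V * M)) (fun x y => 1 * gen v f x y + -1 * gen v' f x y).
Proof.
  intros Hv Hf.
  pose proof (fun b => Bd_mult k _ _ _ _ (Hv b) (Bd_pd k M f b Hf)) as Q.
  pose proof (Bd_scal k (-1) _ _ (Bd_add _ _ _ _ _ (Q true) (Q false))) as H.
  replace (Rabs (-1) * (2 ^ k * V * M + 2 ^ k * V * M)) with (2 * (2 ^ k * V * M)) in H
    by (rewrite Rabs_left by lra; ring).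
  refine (eq_ind _ (Bd k _) H _ _).
  extensionality x; extensionality y. unfold gen, gen1. ring.
Qed.

Lemma genh_lin v h c d f g :
  genh v h (fun x y => c * f x y + d * g x y) = (fun x y => c * genh v h f x y + d * genh v h g x y).
Proof.
  extensionality x; extensionality y.
  unfold genh, genh1, lap, ctr, dq, sh. ring.
Qed.

Definition euler (v : bool -> R -> R -> R) (tau h : R) (f : R -> R -> R) (x y : R) : R :=
  1 * f x y + tau * genh v h f x y.

(** The exponential rate of the order-[k] bounds. The increment comes from the commutator of one
    derivative with the drift term: two directions, [2 ^ k'] Leibniz terms, and one more derivative
    on the drift. *)
Fixpoint growth (V : nat -> R) (k : nat) : R :=
  match k with O => 0 | S k' => growth V k' + 2 * (2 ^ k' * V (S k')) end.

(* Under the CFL condition the scheme replaces a value by a convex combination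
   of neighbouring values. *)
Lemma euler_max_principle v V tau h M f : 0 < h -> h ^ 2 = 8 * tau -> h * V <= 2 ->
  (forall b x y, Rabs (v b x y) <= V) -> (forall x y, Rabs (f x y) <= M) ->
  forall x y, Rabs (euler v tau h f x y) <= M.
Proof.
  intros Hh Htau HV Hv Hf x y.
  set (a := v true x y). set (b := v false x y).
  assert (Ha : Rabs a <= V) by apply Hv. assert (Hb : Rabs b <= V) by apply Hv.
  apply Rabs_le_between in Ha. apply Rabs_le_between in Hb.
  (* With [tau = h^2 / 8] the centre keeps the weight 1/2 and each neighbour has weight 1/8 up to a
     drift correction of size at most [h V / 16], hence a nonnegative one when [h V <= 2]; the
     weights sum to 1. *)
  assert (E : euler v tau h f x y =
    / 2 * f x y + ((/ 8 - h * a / 16) * f (x + h) y + (/ 8 + h * a / 16) * f (x + - h) y)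
    + ((/ 8 - h * b / 16) * f x (y + h) + (/ 8 + h * b / 16) * f x (y + - h))).
  { replace tau with (h ^ 2 / 8) by lra.
    unfold euler, genh, genh1, lap, ctr, dq, sh, a, b.
    replace (x + h + - h) with x by ring. replace (y + h + - h) with y by ring.
    field. lra. }
  assert (B : forall w z, 0 <= w -> Rabs z <= M -> - (w * M) <= w * z <= w * M).
  { intros w z Hw Hz. apply Rabs_le_between in Hz. split; nra. }
  assert (Wa : - 2 <= h * a <= 2) by (split; nra).
  assert (Wb : - 2 <= h * b <= 2) by (split; nra).
  rewrite E. apply Rabs_le_between.
  pose proof (B (/ 2) (f x y) ltac:(lra) (Hf _ _)).
  pose proof (B (/ 8 - h * a / 16) (f (x + h) y) ltac:(lra) (Hf _ _)).
  pose proof (B (/ 8 + h * a / 16) (f (x + - h) y) ltac:(lra) (Hf _ _)).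
  pose proof (B (/ 8 - h * b / 16) (f x (y + h)) ltac:(lra) (Hf _ _)).
  pose proof (B (/ 8 + h * b / 16) (f x (y + - h)) ltac:(lra) (Hf _ _)).
  lra.
Qed.

(** No derivative is lost, but the constant degenerates as [h] tends to 0. This bound serves only to
    justify differentiating the scheme and never enters a final estimate. *)
Lemma Bd_dq_crude k M b h f : Bd k M f -> exists N, Bd k N (dq b h f).
Proof.
  intros H. eexists. exact (Bd_lin k (/ h) (- / h) _ _ _ _ (Bd_sh _ _ _ b h H) H).
Qed.

Lemma pd_genh1 k M V v b b' h f : Bd (S k) V v -> Bd (S k) M f ->
  pd b' (genh1 v b h f) =
  (fun x y => 1 * genh1 v b h (pd b' f) x y + -1 * (pd b' v x y * ctr b h f x y)).
Proof.
  intros Hv Hf.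
  destruct (Bd_dq_crude _ _ b h f Hf) as [N1 H1].
  destruct (Bd_dq_crude _ _ b (- h) f Hf) as [N2 H2].
  destruct (Bd_dq_crude _ _ b h _ H2) as [N3 H3].
  pose proof (Bd_lin _ (/ 2) (/ 2) _ _ _ _ H1 H2) as H4.
  unfold genh1 at 1. unfold lap, ctr at 1.
  rewrite (pd_lin k _ _ b' 1 (-1) _ _ H3 (Bd_mult _ _ _ _ _ Hv H4)).
  rewrite (pd_mult k _ _ b' _ _ Hv H4).
  rewrite (pd_lin k _ _ b' (/ 2) (/ 2) _ _ H1 H2).
  rewrite (pd_dq k _ _ _ _ _ H2), !(pd_dq k _ _ _ _ _ Hf).
  extensionality x; extensionality y. unfold genh1, lap, ctr. ring.
Qed.

Lemma Bd_genh1_crude k M V v b h f : Bd k V v -> Bd k M f -> exists N, Bd k N (genh1 v b h f).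
Proof.
  intros Hv Hf.
  destruct (Bd_dq_crude _ _ b h f Hf) as [N1 H1].
  destruct (Bd_dq_crude _ _ b (- h) f Hf) as [N2 H2].
  destruct (Bd_dq_crude _ _ b h _ H2) as [N3 H3].
  pose proof (Bd_lin _ (/ 2) (/ 2) _ _ _ _ H1 H2) as H4.
  eexists. exact (Bd_sub _ _ _ _ _ H3 (Bd_mult _ _ _ _ _ Hv H4)).
Qed.

(** A derivative of the scheme is the scheme applied to the derivative, minus [tau] times the
    derivative of the drift times [ctr]. The latter is bounded at order [k] by the order [S k] bound
    on [f], uniformly in [h], so the estimate closes without loss of derivatives. *)
Lemma Bd_euler v V tau h : 0 < h -> h ^ 2 = 8 * tau -> h * V O <= 2 ->
  (forall k b, Bd k (V k) (v b)) ->
  forall k M f, Bd k M f -> Bd k ((1 + growth V k * tau) * M) (euler v tau h f).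
Proof.
  intros Hh Htau HV Hv. assert (Ht : 0 <= tau) by nra.
  assert (P : forall M f k, Bd k M f -> forall x y, Rabs (euler v tau h f x y) <= M).
  { intros M f k H. apply euler_max_principle with (V O); auto.
    - intros b x y. eapply Bd_abs, Hv.
    - intros x y. eapply Bd_abs, H. }
  assert (G : forall k, 0 <= growth V k).
  { induction k as [|k IHk]; simpl; [lra|].
    pose proof (Bd_ge0 _ _ _ (Hv (S k) true)). pose proof (pow_le 2 k ltac:(lra)). nra. }
  induction k as [|k IH]; intros M f H.
  { split; [|exact I]. simpl. replace ((1 + 0 * tau) * M) with M by ring.
    exact (P M f O H). }
  pose proof (Bd_ge0 _ _ _ H) as HM.
  split.
  - intros x y. eapply Rle_trans; [exact (P M f (S k) H x y)|].
    pose proof (Rmult_le_pos _ _ (G (S k)) Ht). nra.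
  - intros b'.
    destruct (Bd_genh1_crude _ _ _ _ true h _ (Hv (S k) true) H) as [N1 H1].
    destruct (Bd_genh1_crude _ _ _ _ false h _ (Hv (S k) false) H) as [N2 H2].
    pose proof (Bd_add _ _ _ _ _ H1 H2) as H3.
    split.
    { intros x y. exact (Bd_ex _ _ _ b' x y (Bd_lin _ 1 tau _ _ _ _ H H3)). }
    unfold euler, genh.
    rewrite (pd_lin k _ _ b' 1 tau _ _ H H3), (pd_lin k _ _ b' 1 1 _ _ H1 H2).
    rewrite !(pd_genh1 k _ _ _ _ b' h f (Hv (S k) _) H).
    pose proof (IH _ _ (Bd_pd _ _ _ b' H)) as H4.
    assert (Q : forall b, Bd k (2 ^ k * V (S k) * M) (fun x y => pd b' (v b) x y * ctr b h f x y)).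
    { intros b. apply (Bd_mult k); [exact (Bd_pd _ _ _ b' (Hv (S k) b))|].
      apply Bd_ctr; [lra | exact H]. }
    pose proof (Bd_lin k 1 (- tau) _ _ _ _ H4 (Bd_add _ _ _ _ _ (Q true) (Q false))) as H5.
    rewrite Rabs_R1, Rabs_Ropp, Rabs_pos_eq in H5 by assumption.
    replace ((1 + growth V (S k) * tau) * M) with
      (1 * ((1 + growth V k * tau) * M) + tau * (2 ^ k * V (S k) * M + 2 ^ k * V (S k) * M))
      by (simpl growth; ring).
    refine (eq_ind _ (Bd k _) H5 _ _).
    extensionality x; extensionality y. unfold euler, genh. ring.
Qed.

Lemma exp_le_exp x y : x <= y -> exp x <= exp y.
Proof. intros [H| ->]; [left; now apply exp_increasing | apply Rle_refl]. Qed.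

Lemma Bd_gen k M V v f : (forall b, Bd k V (v b)) -> Bd (S (S k)) M f ->
  Bd k (2 * (1 + 2 ^ k * V) * M) (gen v f).
Proof.
  intros Hv Hf.
  replace (2 * (1 + 2 ^ k * V) * M) with ((M + 2 ^ k * V * M) + (M + 2 ^ k * V * M)) by ring.
  apply (Bd_add k _ _ (gen1 (v true) true f) (gen1 (v false) false f));
    (apply (Bd_sub k); [exact (Bd_pd _ _ _ _ (Bd_pd _ _ _ _ Hf))|]); apply (Bd_mult k); auto;
    exact (Bd_pd _ _ _ _ (Bd_pred _ _ _ Hf)).
Qed.

Definition drift_bounds (u : bool -> R -> R -> R -> R) (V W : nat -> R) : Prop :=
  (forall k b t, 0 <= t -> Bd k (V k) (u b t)) /\
  (forall k b t t', 0 <= t -> 0 <= t' ->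
    Bd k (W k * Rabs (t - t')) (fun x y => 1 * u b t x y + -1 * u b t' x y)).

Lemma drift_bounds_ge0 u V W k : drift_bounds u V W -> 0 <= V k /\ 0 <= W k.
Proof.
  intros [HV HW]. split; [exact (Bd_ge0 _ _ _ (HV k true 0 (Rle_refl 0)))|].
  pose proof (Bd_ge0 _ _ _ (HW k true 0 1 (Rle_refl 0) Rle_0_1)) as H.
  rewrite Rminus_0_l, Rabs_Ropp, Rabs_R1 in H. lra.
Qed.

Fixpoint traj (u : bool -> R -> R -> R -> R) (f0 : R -> R -> R) (tau h : R) (j : nat)
  : R -> R -> R :=
  match j with
  | O => f0
  | S j' => euler (fun b => u b (INR j' * tau)) tau h (traj u f0 tau h j')
  end.

Section Scheme.
Context (u : bool -> R -> R -> R -> R) (V W : nat -> R) (f0 : R -> R -> R) (M0 : nat -> R).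
Context (Hu : drift_bounds u V W) (Hf0 : forall k, Bd k (M0 k) f0).

Let K (T : R) (k : nat) : R := exp (growth V k * T) * M0 k.

Lemma growth_ge0 k : 0 <= growth V k.
Proof.
  induction k as [|k IHk]; simpl; [lra|].
  destruct (drift_bounds_ge0 u V W (S k) Hu). pose proof (pow_le 2 k ltac:(lra)). nra.
Qed.

(** Discrete Gronwall: the one-step factor [1 + growth V k * tau] is at most the corresponding
    exponential. *)
Lemma traj_Bd tau h : 0 < h -> h ^ 2 = 8 * tau -> h * V O <= 2 ->
  forall k j, Bd k (exp (growth V k * (INR j * tau)) * M0 k) (traj u f0 tau h j).
Proof.
  intros Hh Htau HV k j. assert (Ht : 0 <= tau) by nra.
  induction j as [|j IH].
  - simpl. rewrite Rmult_0_l, Rmult_0_r, exp_0, Rmult_1_l. apply Hf0.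
  - assert (Hj : 0 <= INR j * tau) by (apply Rmult_le_pos; auto using pos_INR).
    pose proof (Bd_euler (fun b => u b (INR j * tau)) V tau h Hh Htau HV
      (fun k b => proj1 Hu k b _ Hj) k _ _ IH) as H.
    eapply Bd_weaken; [|exact H].
    rewrite <- Rmult_assoc. apply Rmult_le_compat_r; [exact (Bd_ge0 _ _ _ (Hf0 k))|].
    rewrite S_INR. replace (growth V k * ((INR j + 1) * tau)) with
      (growth V k * tau + growth V k * (INR j * tau)) by ring.
    rewrite exp_plus. apply Rmult_le_compat_r; [left; apply exp_pos|].
    apply exp_ineq1_le.
Qed.

Lemma traj_Bd_time tau h T k j : 0 < h -> h ^ 2 = 8 * tau -> h * V O <= 2 ->
  INR j * tau <= T -> Bd k (K T k) (traj u f0 tau h j).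
Proof.
  intros Hh Htau HV HT. eapply Bd_weaken; [|apply traj_Bd; auto].
  apply Rmult_le_compat_r; [exact (Bd_ge0 _ _ _ (Hf0 k))|].
  apply exp_le_exp. apply Rmult_le_compat_l; [apply growth_ge0 | assumption].
Qed.

Let B (T : R) (k : nat) : R := 2 * (1 + 2 ^ k * V k) * K T (S (S k)).

Lemma B_ge0 T k : 0 <= B T k.
Proof.
  unfold B, K. destruct (drift_bounds_ge0 u V W k Hu). pose proof (pow_le 2 k ltac:(lra)).
  pose proof (Bd_ge0 _ _ _ (Hf0 (S (S k)))). pose proof (exp_pos (growth V (S (S k)) * T)).
  apply Rmult_le_pos; nra.
Qed.

Lemma traj_genh_Bd tau h T k j : 0 < h -> h ^ 2 = 8 * tau -> h * V O <= 2 ->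
  INR j * tau <= T ->
  Bd k (B T k) (genh (fun b => u b (INR j * tau)) h (traj u f0 tau h j)).
Proof.
  intros Hh Htau HV HT. assert (Ht : 0 <= tau) by nra. apply Bd_genh; [lra| |].
  - intros b. apply Hu. apply Rmult_le_pos; auto using pos_INR.
  - now apply traj_Bd_time.
Qed.

Lemma traj_increment tau h T k j m : 0 < h -> h ^ 2 = 8 * tau -> h * V O <= 2 ->
  INR (j + m) * tau <= T ->
  Bd k (INR m * tau * B T k)
    (fun x y => 1 * traj u f0 tau h (j + m) x y + -1 * traj u f0 tau h j x y).
Proof.
  intros Hh Htau HV HT. assert (Ht : 0 <= tau) by nra. induction m as [|m IH].
  - rewrite Nat.add_0_r in *. pose proof (Bd_scal k 0 _ _ (traj_Bd_time tau h T k j Hh Htau HV HT)) as H.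
    rewrite Rabs_R0, Rmult_0_l in H. simpl INR. rewrite !Rmult_0_l.
    refine (eq_ind _ (Bd k _) H _ _). extensionality x; extensionality y. ring.
  - rewrite Nat.add_succ_r in *.
    assert (HT' : INR (j + m) * tau <= T) by (rewrite S_INR in HT; nra).
    pose proof (Bd_lin k 1 tau _ _ _ _ (IH HT') (traj_genh_Bd tau h T k _ Hh Htau HV HT')) as H.
    rewrite Rabs_R1, Rabs_pos_eq in H by assumption. rewrite S_INR.
    replace ((INR m + 1) * tau * B T k) with (1 * (INR m * tau * B T k) + tau * B T k) by ring.
    refine (eq_ind _ (Bd k _) H _ _). extensionality x; extensionality y.
    simpl traj. unfold euler. ring.
Qed.

Let E (T : R) (k : nat) : R :=
  2 * (1 + 2 ^ k * V k) * B T (S (S k)) + 2 * (2 ^ k * W k * K T (S k)).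

Lemma E_ge0 T k : 0 <= E T k.
Proof.
  unfold E. destruct (drift_bounds_ge0 u V W k Hu). pose proof (pow_le 2 k ltac:(lra)).
  pose proof (B_ge0 T (S (S k))).
  assert (0 <= K T (S k)).
  { unfold K. pose proof (Bd_ge0 _ _ _ (Hf0 (S k))). pose proof (exp_pos (growth V (S k) * T)). nra. }
  apply Rplus_le_le_0_compat.
  - apply Rmult_le_pos; nra.
  - apply Rmult_le_pos; [lra|]. apply Rmult_le_pos; nra.
Qed.

Lemma traj_second_order tau h T k j m : 0 < h -> h ^ 2 = 8 * tau -> h * V O <= 2 ->
  INR (j + m) * tau <= T ->
  Bd k (E T k * (INR m * tau) ^ 2)
    (fun x y => 1 * (1 * traj u f0 tau h (j + m) x y + -1 * traj u f0 tau h j x y)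
      + - (INR m * tau) * genh (fun b => u b (INR j * tau)) h (traj u f0 tau h j) x y).
Proof.
  intros Hh Htau HV HT. assert (Ht : 0 <= tau) by nra. induction m as [|m IH].
  - rewrite Nat.add_0_r in *. pose proof (Bd_scal k 0 _ _ (traj_Bd_time tau h T k j Hh Htau HV HT)) as H.
    rewrite Rabs_R0, Rmult_0_l in H. simpl INR. rewrite !Rmult_0_l.
    replace (E T k * 0 ^ 2) with 0 by ring.
    refine (eq_ind _ (Bd k _) H _ _). extensionality x; extensionality y. ring.
  - rewrite Nat.add_succ_r in *.
    assert (HT' : INR (j + m) * tau <= T) by (rewrite S_INR in HT; nra).
    assert (Hj0 : 0 <= INR j * tau) by (apply Rmult_le_pos; auto using pos_INR).
    assert (Hjm0 : 0 <= INR (j + m) * tau) by (apply Rmult_le_pos; auto using pos_INR).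
    assert (Hm0 : 0 <= INR m * tau) by (apply Rmult_le_pos; auto using pos_INR).
    assert (Hj : INR j * tau <= T) by (rewrite plus_INR in HT'; pose proof (pos_INR m); nra).
    pose proof (Bd_genh k _ _ (fun b => u b (INR (j + m) * tau)) h _ ltac:(lra)
      (fun b => proj1 Hu k b _ Hjm0) (traj_increment tau h T (S (S k)) j m Hh Htau HV HT')) as H1.
    rewrite genh_lin in H1.
    pose proof (Bd_genh_drift k _ _ (fun b => u b (INR (j + m) * tau)) (fun b => u b (INR j * tau)) h _
      ltac:(lra) (fun b => proj2 Hu k b _ _ Hjm0 Hj0)
      (traj_Bd_time tau h T (S k) j Hh Htau HV Hj)) as H2.
    replace (Rabs (INR (j + m) * tau - INR j * tau)) with (INR m * tau) in H2
      by (rewrite plus_INR, Rabs_pos_eq; lra).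
    pose proof (Bd_lin k 1 tau _ _ _ _ (IH HT') (Bd_add _ _ _ _ _ H1 H2)) as H.
    rewrite Rabs_R1, (Rabs_pos_eq tau) in H by assumption.
    eapply Bd_weaken; [|refine (eq_ind _ (Bd k _) H _ _)].
    + rewrite S_INR.
      replace (1 * (E T k * (INR m * tau) ^ 2) + tau *
        (2 * (1 + 2 ^ k * V k) * (INR m * tau * B T (S (S k))) +
         2 * (2 ^ k * (W k * (INR m * tau)) * K T (S k))))
        with (E T k * ((INR m * tau) ^ 2 + tau * (INR m * tau))) by (unfold E; ring).
      apply Rmult_le_compat_l; [apply E_ge0 | nra].
    + extensionality x; extensionality y. rewrite S_INR.
      simpl traj. unfold euler. ring.
Qed.

Definition fl (x : R) : nat := Z.to_nat (Int_part x).

Lemma fl_spec x : 0 <= x -> INR (fl x) <= x < INR (fl x) + 1.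
Proof.
  intros Hx. unfold fl. destruct (base_Int_part x) as [H1 H2].
  assert (H : (0 <= Int_part x)%Z).
  { assert (-1 < Int_part x)%Z; [|lia]. apply lt_IZR. lra. }
  rewrite INR_IZR_INZ, Z2Nat.id by assumption. lra.
Qed.

Lemma fl_neg x : x <= 0 -> fl x = O.
Proof.
  intros Hx. unfold fl. destruct (base_Int_part x) as [H1 H2].
  assert (H : (Int_part x <= 0)%Z) by (apply le_IZR; lra).
  destruct (Int_part x); simpl; auto; lia.
Qed.

Lemma fl_le x y : 0 <= x -> x <= y -> (fl x <= fl y)%nat.
Proof.
  intros Hx Hxy. destruct (fl_spec x Hx). destruct (fl_spec y ltac:(lra)).
  assert (fl x < S (fl y))%nat; [|lia]. apply INR_lt. rewrite S_INR. lra.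
Qed.

Let C (T : R) (k : nat) : R := 2 * (2 + 2 ^ k * V k) * K T (S (S (S k))).
Let C' (T : R) (k : nat) : R := 2 * (2 ^ k * W k * K T (S k)).

(** The same expansion between arbitrary times, rounded down to the grid. As the mesh tends to 0
    only the term in [s^2] survives. *)
Lemma traj_taylor tau h T k t s : 0 < h -> h ^ 2 = 8 * tau -> h * V O <= 2 ->
  0 <= t -> 0 <= s -> t + s <= T ->
  Bd k (E T k * (s + tau) ^ 2 + tau * B T k + s * (C T k * h + C' T k * tau))
    (fun x y => 1 * (1 * traj u f0 tau h (fl ((t + s) / tau)) x y
                     + -1 * traj u f0 tau h (fl (t / tau)) x y)
      + - s * gen (fun b => u b t) (traj u f0 tau h (fl (t / tau))) x y).
Proof.
  intros Hh Htau HV Ht0 Hs HT. assert (Ht : 0 < tau) by nra.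
  assert (Hd : forall r, 0 <= r -> 0 <= r / tau) by (intros; apply Rdiv_le_0_compat; auto).
  assert (Hm : forall r, r / tau * tau = r) by (intros; field; lra).
  set (j := fl (t / tau)). set (j' := fl ((t + s) / tau)).
  assert (Hjj : (j <= j')%nat).
  { apply fl_le; [now apply Hd|]. apply Rmult_le_compat_r; [left; now apply Rinv_0_lt_compat | lra]. }
  destruct (fl_spec (t / tau) (Hd _ Ht0)) as [Hj1 Hj2]. fold j in Hj1, Hj2.
  destruct (fl_spec ((t + s) / tau) (Hd (t + s) ltac:(lra))) as [Hj3 Hj4]. fold j' in Hj3, Hj4.
  apply (Rmult_le_compat_r tau) in Hj1, Hj3; [|lra..].
  apply (Rmult_lt_compat_r tau) in Hj2, Hj4; [|lra..].
  rewrite Hm in Hj1, Hj2, Hj3, Hj4.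
  set (m := (j' - j)%nat). assert (Ej : j' = (j + m)%nat) by lia.
  rewrite Ej in *. rewrite plus_INR in Hj3, Hj4.
  assert (Hj0 : 0 <= INR j * tau) by (apply Rmult_le_pos; [apply pos_INR | lra]).
  assert (HjT : INR j * tau <= T) by lra.
  assert (HjmT : INR (j + m) * tau <= T) by (rewrite plus_INR; lra).
  assert (Hmt : Rabs (INR m * tau - s) <= tau) by (apply Rabs_le; lra).
  (* Four errors: the second-order remainder, the rounding of [s] to [m tau], differences in place
     of derivatives, and the drift taken at [j tau] instead of [t]. *)
  pose proof (traj_second_order tau h T k j m Hh Htau HV HjmT) as R1.
  pose proof (Bd_scal k (INR m * tau - s) _ _ (traj_genh_Bd tau h T k j Hh Htau HV HjT)) as R2.
  pose proof (Bd_scal k s _ _ (Bd_genh_sub_gen k _ _ (fun b => u b (INR j * tau)) h _ ltac:(lra)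
    (fun b => proj1 Hu k b _ Hj0) (traj_Bd_time tau h T _ j Hh Htau HV HjT))) as R3.
  pose proof (Bd_scal k s _ _ (Bd_gen_drift k _ _ (fun b => u b (INR j * tau)) (fun b => u b t) _
    (fun b => proj2 Hu k b _ _ Hj0 Ht0) (traj_Bd_time tau h T _ j Hh Htau HV HjT))) as R4.
  pose proof (Bd_plus _ _ _ _ _ (Bd_plus _ _ _ _ _ R1 R2) (Bd_plus _ _ _ _ _ R3 R4)) as H.
  eapply Bd_weaken; [|refine (eq_ind _ (Bd k _) H _ _)].
  - rewrite (Rabs_pos_eq s), (Rabs_pos_eq h) by lra.
    assert (Hjt : Rabs (INR j * tau - t) <= tau) by (apply Rabs_le; lra).
    assert (Hm0 : 0 <= INR m * tau) by (apply Rmult_le_pos; [apply pos_INR | lra]).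
    assert (I1 : E T k * (INR m * tau) ^ 2 <= E T k * (s + tau) ^ 2).
    { apply Rmult_le_compat_l; [apply E_ge0|]. apply pow_incr. lra. }
    assert (I2 : Rabs (INR m * tau - s) * B T k <= tau * B T k).
    { apply Rmult_le_compat_r; [apply B_ge0 | assumption]. }
    assert (I3 : 2 * (2 ^ k * (W k * Rabs (INR j * tau - t)) * K T (S k)) <= C' T k * tau).
    { replace (2 * (2 ^ k * (W k * Rabs (INR j * tau - t)) * K T (S k)))
        with (C' T k * Rabs (INR j * tau - t)) by (unfold C'; ring).
      apply Rmult_le_compat_l; [|assumption]. unfold C'.
      destruct (drift_bounds_ge0 u V W k Hu). pose proof (pow_le 2 k ltac:(lra)).
      assert (0 <= K T (S k)).
      { unfold K. pose proof (Bd_ge0 _ _ _ (Hf0 (S k))). pose proof (exp_pos (growth V (S k) * T)). nra. }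
      apply Rmult_le_pos; [lra|]. apply Rmult_le_pos; nra. }
    apply (Rmult_le_compat_l s) in I3; [|assumption].
    unfold C. lra.
  - extensionality x; extensionality y. ring.
Qed.

(** The summand [2 * V O ^ 2] enforces the CFL condition for every [n]: then
    [h^2 (V O)^2 = 8 tau (V O)^2 <= 4]. *)
Let tau_ (n : nat) : R := / (INR n + 1 + 2 * (V O) ^ 2).
Let h_ (n : nat) : R := sqrt (8 * tau_ n).

Lemma tau_pos n : 0 < tau_ n.
Proof. apply Rinv_0_lt_compat. pose proof (pos_INR n). nra. Qed.

Lemma h_spec n : 0 < h_ n /\ h_ n ^ 2 = 8 * tau_ n /\ h_ n * V O <= 2.
Proof.
  pose proof (tau_pos n) as Ht.
  assert (H2 : h_ n ^ 2 = 8 * tau_ n) by (unfold h_; rewrite pow2_sqrt; lra).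
  assert (H1 : 0 < h_ n) by (apply sqrt_lt_R0; lra).
  repeat split; auto. apply Rsqr_incr_0; [|destruct (drift_bounds_ge0 u V W 0 Hu); nra | lra].
  unfold Rsqr. replace (h_ n * V O * (h_ n * V O)) with (h_ n ^ 2 * V O ^ 2) by ring.
  rewrite H2.
  assert (tau_ n * (INR n + 1 + 2 * V O ^ 2) = 1).
  { unfold tau_. apply Rinv_l. pose proof (pos_INR n). nra. }
  pose proof (pos_INR n). nra.
Qed.

Lemma tau_lim : is_lim_seq tau_ 0.
Proof.
  apply (is_lim_seq_le_le (fun _ => 0) _ (fun n => / (INR n + 1))).
  - intros n. split; [left; apply tau_pos|]. apply Rinv_le_contravar; pose proof (pos_INR n); nra.
  - apply is_lim_seq_const.
  - apply (is_lim_seq_ext (fun n => / INR (S n))); [intros; now rewrite S_INR|].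
    apply (is_lim_seq_incr_1 (fun n => / INR n)).
    replace (Finite 0) with (Rbar_inv p_infty) by reflexivity.
    apply is_lim_seq_inv; [apply is_lim_seq_INR | discriminate].
Qed.

Lemma h_lim : is_lim_seq h_ 0.
Proof.
  rewrite <- sqrt_0. apply is_lim_seq_continuous.
  - apply continuity_pt_sqrt. lra.
  - replace (Finite 0) with (Rbar_mult 8 0) by (simpl; f_equal; ring).
    apply is_lim_seq_scal_l, tau_lim.
Qed.

Context (U : (nat -> Prop) -> Prop) (HU : free_ultrafilter U).

Let approx (t : R) (n : nat) : R -> R -> R := traj u f0 (tau_ n) (h_ n) (fl (t / tau_ n)).

Definition limit_solution (t : R) : R -> R -> R := ulimf U (approx t).

Lemma approx_Bd T t k n : 0 <= T -> t <= T -> Bd k (K T k) (approx t n).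
Proof.
  intros HT Ht. destruct (h_spec n) as (H1 & H2 & H3). pose proof (tau_pos n) as Hp.
  apply traj_Bd_time; auto. destruct (Rle_dec t 0) as [H|H].
  - rewrite fl_neg; [simpl; lra|].
    apply Rmult_le_reg_r with (tau_ n); auto. unfold Rdiv.
    rewrite Rmult_assoc, Rinv_l; lra.
  - assert (Hd : 0 <= t / tau_ n) by (apply Rdiv_le_0_compat; lra).
    destruct (fl_spec _ Hd) as [Hj _]. apply (Rmult_le_compat_r (tau_ n)) in Hj; [|lra].
    unfold Rdiv in Hj at 2. rewrite Rmult_assoc, Rinv_l in Hj; lra.
Qed.

Lemma approx_smooth t : unif_smooth (approx t).
Proof.
  intros k. exists (K (Rmax 0 t) k). intros n. apply approx_Bd; [apply Rmax_l | apply Rmax_r].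
Qed.

Lemma limit_solution_Bd T t k : 0 <= T -> t <= T -> Bd k (K T (S k)) (limit_solution t).
Proof. intros HT Ht. apply Bd_ulimf; [assumption|]. intros n. now apply approx_Bd. Qed.

Lemma limit_solution_bounded t x y : Rabs (limit_solution t x y) <= M0 O.
Proof.
  apply (is_ulim_abs_le U (fun n => approx t n x y) _ (fun _ => M0 O)); [assumption| | apply is_lim_seq_const|].
  - destruct (approx_smooth t O) as [M HM]. now apply (is_ulimf U (approx t) O M).
  - intros n. pose proof (approx_Bd (Rmax 0 t) t O n (Rmax_l _ _) (Rmax_r _ _)) as H.
    pose proof (Bd_abs _ _ _ x y H) as H'. unfold K in H'. simpl growth in H'.
    rewrite Rmult_0_l, exp_0, Rmult_1_l in H'. exact H'.
Qed.

Lemma limit_solution_initial : limit_solution 0 = f0.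
Proof.
  extensionality x; extensionality y. apply ulim_eq; [assumption|].
  intros eps He. apply (fu_mono U HU (fun n => (0 <= n)%nat)); [|apply (fu_tail U HU)].
  intros n _. unfold approx. rewrite fl_neg by (unfold Rdiv; lra). simpl.
  now rewrite Rminus_diag, Rabs_R0.
Qed.

Lemma gen_ulimf v f : unif_smooth f -> gen v (ulimf U f) = ulimf U (fun n => gen v (f n)).
Proof.
  intros Hf. extensionality x; extensionality y. symmetry. apply ulim_eq; [assumption|].
  unfold gen, gen1.
  repeat (apply is_ulim_plus || apply is_ulim_scal); try assumption.
  all: first [ exact (is_ulimf_D U f (true :: true :: nil) x y HU Hf)
    | exact (is_ulimf_D U f (false :: false :: nil) x y HU Hf)
    | exact (is_ulimf_D U f (true :: nil) x y HU Hf)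
    | exact (is_ulimf_D U f (false :: nil) x y HU Hf) ].
Qed.

(** This is the equation in incremental form, for all spatial derivatives at once. The remainder
    constant depends only on [T] and the order, which later yields differentiability in time. *)
Lemma limit_solution_taylor T w : exists c, forall t s x y, 0 <= t -> 0 <= s -> t + s <= T ->
  Rabs (D w (limit_solution (t + s)) x y - D w (limit_solution t) x y
    - s * D w (gen (fun b => u b t) (limit_solution t)) x y) <= c * s ^ 2.
Proof.
  set (k := length w). exists (E T k). intros t s x y Ht Hs HT.
  assert (Sg : unif_smooth (fun n => gen (fun b => u b t) (approx t n))).
  { intros i. destruct (approx_smooth t (S (S i))) as [M HM].
    eexists. intros n. apply Bd_gen; [intros b; now apply Hu | apply HM]. }
  assert (L : is_ulim U
    (fun n => 1 * (1 * D w (approx (t + s) n) x y + -1 * D w (approx t n) x y)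
       + - s * D w (gen (fun b => u b t) (approx t n)) x y)
    (1 * (1 * D w (limit_solution (t + s)) x y + -1 * D w (limit_solution t) x y)
       + - s * D w (gen (fun b => u b t) (limit_solution t)) x y)).
  { apply is_ulim_plus; [assumption| |]; (apply is_ulim_scal; [assumption|]).
    - apply is_ulim_plus; [assumption| |]; (apply is_ulim_scal; [assumption|]);
        apply is_ulimf_D; auto using approx_smooth.
    - unfold limit_solution. rewrite gen_ulimf by apply approx_smooth.
      exact (is_ulimf_D U (fun n => gen (fun b => u b t) (approx t n)) w x y HU Sg). }
  set (L' := D w (limit_solution (t + s)) x y - D w (limit_solution t) x y
    - s * D w (gen (fun b => u b t) (limit_solution t)) x y).
  match type of L with is_ulim _ _ ?l => replace l with L' in L by (unfold L'; ring) end.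
  apply (is_ulim_abs_le U _ _ (fun n => E T k * (s + tau_ n) ^ 2 + tau_ n * B T k
    + s * (C T k * h_ n + C' T k * tau_ n)) _ HU L).
  - replace (E T k * s ^ 2) with
      (E T k * ((s + 0) * ((s + 0) * 1)) + 0 * B T k + s * (C T k * 0 + C' T k * 0)) by ring.
    pose proof tau_lim as Lt. pose proof h_lim as Lh.
    assert (Ls : is_lim_seq (fun n => s + tau_ n) (s + 0))
      by (apply is_lim_seq_plus'; [apply is_lim_seq_const | exact Lt]).
    apply (is_lim_seq_plus' (fun n => E T k * (s + tau_ n) ^ 2 + tau_ n * B T k)).
    + apply (is_lim_seq_plus' (fun n => E T k * (s + tau_ n) ^ 2)).
      * apply (is_lim_seq_mult' (fun _ => E T k)); [apply is_lim_seq_const|].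
        apply (is_lim_seq_mult' _ (fun n => (s + tau_ n) * 1)); [exact Ls|].
        apply (is_lim_seq_mult' _ (fun _ => 1)); [exact Ls | apply is_lim_seq_const].
      * apply (is_lim_seq_mult' _ (fun _ => B T k)); [exact Lt | apply is_lim_seq_const].
    + apply (is_lim_seq_mult' (fun _ => s)); [apply is_lim_seq_const|].
      apply (is_lim_seq_plus' (fun n => C T k * h_ n)).
      * apply (is_lim_seq_mult' (fun _ => C T k)); [apply is_lim_seq_const | exact Lh].
      * apply (is_lim_seq_mult' (fun _ => C' T k)); [apply is_lim_seq_const | exact Lt].
  - intros n. destruct (h_spec n) as (H1 & H2 & H3).
    pose proof (traj_taylor (tau_ n) (h_ n) T k t s H1 H2 H3 Ht Hs HT) as H.
    destruct (approx_smooth (t + s) k) as [Ma HMa]. destruct (approx_smooth t k) as [Mb HMb].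
    destruct (Sg k) as [Mc HMc]. specialize (HMa n). specialize (HMb n). specialize (HMc n).
    fold (approx (t + s) n) in H. fold (approx t n) in H.
    pose proof (eq_ind_r (fun i => Bd i _ _) H (Nat.add_0_r k)) as H0.
    pose proof (Bd_abs _ _ _ x y (Bd_D w O _ _ H0)) as H'.
    rewrite (D_lin w _ _ 1 (- s) _ _ (Bd_lin k 1 (-1) _ _ _ _ HMa HMb) HMc) in H'.
    rewrite (D_lin w _ _ 1 (-1) _ _ HMa HMb) in H'. rewrite Nat.add_0_r in H'. exact H'.
Qed.
End Scheme.

(** * Existence of smooth solutions *)

(** The family witnessing smoothness of the solution. It is stable under time derivatives because
    the equation trades them for spatial derivatives and products with the drift. *)
Inductive solution_algebra (F : (R -> R -> R -> R) -> Prop) (theta : R -> R -> R -> R)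
  : (R -> R -> R -> R) -> Prop :=
| sa_drift g : F g -> solution_algebra F theta g
| sa_deriv w : solution_algebra F theta (fun t => D w (theta t))
| sa_lin c d f g : solution_algebra F theta f -> solution_algebra F theta g ->
    solution_algebra F theta (fun t x y => c * f t x y + d * g t x y)
| sa_mult f g : solution_algebra F theta f -> solution_algebra F theta g ->
    solution_algebra F theta (fun t x y => f t x y * g t x y).

Lemma pd_D b w f : pd b (D w f) = D (w ++ b :: nil) f.
Proof. revert f. induction w as [|a w IH]; intros f; [reflexivity|]. apply IH. Qed.

Section Regularity.
Context (F : (R -> R -> R -> R) -> Prop) (HF : bounded_family F).
Context (u : bool -> R -> R -> R -> R) (Hu : forall b, F (u b)).
Context (theta : R -> R -> R -> R).
Context (theta_Bd : forall T k, 0 <= T -> exists M, forall t, t <= T -> Bd k M (theta t)).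
Context (theta_taylor : forall T w, exists c, forall t s x y, 0 <= t -> 0 <= s -> t + s <= T ->
  Rabs (D w (theta (t + s)) x y - D w (theta t) x y
    - s * D w (gen (fun b => u b t) (theta t)) x y) <= c * s ^ 2).

Let Alg := solution_algebra F theta.

Lemma alg_pd b g : Alg g -> exists g', Alg g' /\
  forall t x y, is_derive (fun s => sh b s (g t) x y) 0 (g' t x y).
Proof.
  induction 1 as [g Hg|w|c d f g Hf (f' & Hf' & Ef) Hg (g' & Hg' & Eg)|f g Hf (f' & Hf' & Ef) Hg (g' & Hg' & Eg)].
  - destruct (family_pd F g b HF Hg) as (g' & Hg' & E). exists g'. split; [now apply sa_drift | exact E].
  - exists (fun t => D (w ++ b :: nil) (theta t)). split; [apply sa_deriv|]. intros t x y.
    rewrite <- pd_D. apply Derive_correct.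
    destruct (theta_Bd (Rmax 0 t) (length w + 1) (Rmax_l _ _)) as [M HM].
    exact (Bd_ex _ _ _ b x y (Bd_D w 1 M _ (HM t (Rmax_r _ _)))).
  - exists (fun t x y => c * f' t x y + d * g' t x y). split; [now apply sa_lin|].
    intros t x y. now apply is_derive_lin.
  - exists (fun t x y => 1 * (f' t x y * g t x y) + 1 * (f t x y * g' t x y)). split.
    + apply (sa_lin F theta 1 1 (fun t x y => f' t x y * g t x y) (fun t x y => f t x y * g' t x y));
        now apply sa_mult.
    + intros t x y. rewrite !Rmult_1_l. now apply is_derive_prod.
Qed.

Lemma alg_D w : forall g, Alg g -> exists g', Alg g' /\ forall t, D w (g t) = g' t.
Proof.
  induction w as [|b w IH]; intros g Hg.
  - exists g. split; auto.
  - destruct (alg_pd b g Hg) as (g1 & H1 & E1). destruct (IH g1 H1) as (g' & Hg' & E).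
    exists g'. split; [assumption|]. intros t. simpl. rewrite (pd_unique _ _ _ (E1 t)). apply E.
Qed.

Lemma alg_gen : Alg (fun t => gen (fun b => u b t) (theta t)).
Proof.
  assert (Q : forall b, Alg (fun t x y => 1 * D (b :: b :: nil) (theta t) x y
    + -1 * (u b t x y * D (b :: nil) (theta t) x y))).
  { intros b. apply (sa_lin F theta 1 (-1) (fun t => D (b :: b :: nil) (theta t))
      (fun t x y => u b t x y * D (b :: nil) (theta t) x y)).
    - apply sa_deriv.
    - apply (sa_mult F theta (u b) (fun t => D (b :: nil) (theta t))).
      + now apply sa_drift.
      + apply sa_deriv. }
  exact (sa_lin F theta 1 1 _ _ (Q true) (Q false)).
Qed.

Lemma drift_Bd k : exists V, forall b t, 0 <= t -> Bd k V (u b t).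
Proof.
  destruct (family_Bd F HF k _ (Hu true)) as [V1 H1].
  destruct (family_Bd F HF k _ (Hu false)) as [V2 H2].
  exists (Rmax V1 V2). intros [|] t Ht; (eapply Bd_weaken; [|auto]); [apply Rmax_l | apply Rmax_r].
Qed.

Lemma gen_bounded T w : 0 <= T -> exists G, forall t x y, 0 <= t <= T ->
  Rabs (D w (gen (fun b => u b t) (theta t)) x y) <= G.
Proof.
  intros HT. destruct (drift_Bd (length w + 0)) as [V HV].
  destruct (theta_Bd T (S (S (length w + 0))) HT) as [M HM].
  eexists. intros t x y [Ht HtT].
  apply (Bd_abs 0), Bd_D. apply Bd_gen; [intros b; now apply HV | now apply HM].
Qed.

(** The two properties go through the induction together: the Lipschitz bound of a product uses the
    size of both factors. *)
Lemma alg_bounded_lipschitz T g : 0 <= T -> Alg g -> exists c, 0 <= c /\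
  (forall t x y, 0 <= t <= T -> Rabs (g t x y) <= c) /\
  (forall t s x y, 0 <= t -> 0 <= s -> t + s <= T -> Rabs (g (t + s) x y - g t x y) <= c * s).
Proof.
  intros HT.
  induction 1 as [g Hg|w|c d f g Hf (a & Ha & A1 & A2) Hg (b & Hb & B1 & B2)|f g Hf (a & Ha & A1 & A2) Hg (b & Hb & B1 & B2)].
  - destruct (family_Bd F HF 0 g Hg) as [M HM]. destruct (family_Bd_time F HF 0 g Hg) as [N HN].
    exists (Rmax M N). pose proof (Bd_ge0 _ _ _ (HM 0 (Rle_refl 0))).
    split; [eapply Rle_trans; [eassumption | apply Rmax_l]|]. split.
    + intros t x y [Ht _]. eapply Rle_trans; [apply (Bd_abs 0), HM, Ht | apply Rmax_l].
    + intros t s x y Ht Hs _. pose proof (Bd_abs _ _ _ x y (HN (t + s) t ltac:(lra) Ht)) as H'.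
      simpl in H'. replace (t + s - t) with s in H' by ring. rewrite (Rabs_pos_eq s Hs) in H'.
      replace (1 * g (t + s) x y + -1 * g t x y) with (g (t + s) x y - g t x y) in H' by ring.
      eapply Rle_trans; [exact H'|]. apply Rmult_le_compat_r; [assumption | apply Rmax_r].
  - destruct (theta_Bd T (length w + 0) HT) as [M HM].
    destruct (gen_bounded T w HT) as [G HG]. destruct (theta_taylor T w) as [c Hc].
    set (N := G + Rabs c * T).
    assert (HM0 : 0 <= M) by exact (Bd_ge0 _ _ _ (HM T (Rle_refl T))).
    exists (Rmax M N). split; [eapply Rle_trans; [eassumption | apply Rmax_l]|]. split.
    + intros t x y [_ Ht]. eapply Rle_trans; [apply (Bd_abs 0), Bd_D, HM, Ht | apply Rmax_l].
    + intros t s x y Ht Hs Hts. specialize (Hc t s x y Ht Hs Hts).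
      specialize (HG t x y ltac:(lra)). set (g := D w (gen (fun b => u b t) (theta t)) x y) in *.
      replace (D w (theta (t + s)) x y - D w (theta t) x y) with
        ((D w (theta (t + s)) x y - D w (theta t) x y - s * g) + s * g) by ring.
      eapply Rle_trans; [apply Rabs_triang|]. rewrite Rabs_mult, (Rabs_pos_eq s) by assumption.
      apply Rle_trans with (N * s); [|apply Rmult_le_compat_r; [assumption | apply Rmax_r]].
      assert (c * s ^ 2 <= Rabs c * T * s).
      { apply Rle_trans with (Rabs c * (s * s)).
        - replace (c * s ^ 2) with (c * (s * s)) by ring.
          apply Rmult_le_compat_r; [nra | apply Rle_abs].
        - rewrite Rmult_assoc. apply Rmult_le_compat_l; [apply Rabs_pos | nra]. }
      unfold N. nra.
  - pose proof (Rabs_pos c) as Hc0. pose proof (Rabs_pos d) as Hd0.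
    exists (Rabs c * a + Rabs d * b). split; [nra|]. split.
    + intros t x y Ht. eapply Rle_trans; [apply Rabs_triang|]. rewrite !Rabs_mult.
      apply Rplus_le_compat; apply Rmult_le_compat_l; auto.
    + intros t s x y Ht Hs Hts.
      replace (c * f (t + s) x y + d * g (t + s) x y - (c * f t x y + d * g t x y)) with
        (c * (f (t + s) x y - f t x y) + d * (g (t + s) x y - g t x y)) by ring.
      eapply Rle_trans; [apply Rabs_triang|]. rewrite !Rabs_mult, Rmult_plus_distr_r, !Rmult_assoc.
      apply Rplus_le_compat; apply Rmult_le_compat_l; auto.
  - exists (a * b + 2 * (a * b)). split; [nra|]. split.
    + intros t x y Ht. rewrite Rabs_mult.
      apply Rle_trans with (a * b); [apply Rmult_le_compat; auto using Rabs_pos | nra].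
    + intros t s x y Ht Hs Hts.
      replace (f (t + s) x y * g (t + s) x y - f t x y * g t x y) with
        ((f (t + s) x y - f t x y) * g (t + s) x y + f t x y * (g (t + s) x y - g t x y)) by ring.
      eapply Rle_trans; [apply Rabs_triang|]. rewrite !Rabs_mult.
      assert (I1 : Rabs (f (t + s) x y - f t x y) * Rabs (g (t + s) x y) <= (a * s) * b)
        by (apply Rmult_le_compat; auto using Rabs_pos; apply B1; lra).
      assert (I2 : Rabs (f t x y) * Rabs (g (t + s) x y - g t x y) <= a * (b * s))
        by (apply Rmult_le_compat; auto using Rabs_pos; apply A1; lra).
      assert (0 <= a * b * s) by (apply Rmult_le_pos; nra). nra.
Qed.

Lemma alg_time_lipschitz T g : 0 <= T -> Alg g -> exists c, 0 <= c /\
  forall t t' x y, 0 <= t <= T -> 0 <= t' <= T ->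
  Rabs (g t' x y - g t x y) <= c * Rabs (t' - t).
Proof.
  intros HT Hg. destruct (alg_bounded_lipschitz T g HT Hg) as (c & Hc & _ & H).
  exists c. split; [assumption|]. intros t t' x y Ht Ht'.
  destruct (Rle_dec t t').
  - rewrite (Rabs_pos_eq (t' - t)) by lra.
    pose proof (H t (t' - t) x y ltac:(lra) ltac:(lra) ltac:(lra)) as H'.
    now replace (t + (t' - t)) with t' in H' by ring.
  - rewrite (Rabs_minus_sym t' t), (Rabs_pos_eq (t - t')) by lra.
    pose proof (H t' (t - t') x y ltac:(lra) ltac:(lra) ltac:(lra)) as H'.
    replace (t' + (t - t')) with t in H' by ring. now rewrite Rabs_minus_sym.
Qed.

Lemma alg_space_lipschitz T g b : 0 <= T -> Alg g -> exists c, 0 <= c /\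
  forall t h x y, 0 <= t <= T -> Rabs (sh b h (g t) x y - g t x y) <= c * Rabs h.
Proof.
  intros HT Hg. destruct (alg_pd b g Hg) as (g' & Hg' & E).
  destruct (alg_bounded_lipschitz T g' HT Hg') as (c & Hc & H & _).
  exists c. split; [assumption|]. intros t h x y Ht.
  rewrite <- (sh_0 b (g t) x y) at 1. replace h with (h - 0) at 2 by ring.
  apply (increment_le (fun s => sh b s (g t) x y) (fun s => sh b s (g' t) x y)).
  - intros s. rewrite <- (pd_unique _ _ _ (E t)). apply is_derive_sh.
    intros; eexists; apply E.
  - intros s. unfold sh; destruct b; now apply H.
Qed.

Lemma alg_continuous t x y g eps : Alg g -> 0 <= t -> 0 < eps -> exists delta, 0 < delta /\
  forall t' x' y', 0 <= t' -> Rabs (t' - t) < delta -> Rabs (x' - x) < delta ->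
    Rabs (y' - y) < delta -> Rabs (g t' x' y' - g t x y) < eps.
Proof.
  intros Hg Ht He.
  assert (HT : 0 <= t + 1) by lra.
  destruct (alg_time_lipschitz (t + 1) g HT Hg) as (c0 & Hc0 & L0).
  destruct (alg_space_lipschitz (t + 1) g true HT Hg) as (c1 & Hc1 & L1).
  destruct (alg_space_lipschitz (t + 1) g false HT Hg) as (c2 & Hc2 & L2).
  set (c := c0 + c1 + c2 + 1). assert (Hc : 0 < c) by (unfold c; lra).
  assert (Hq : 0 < eps / c) by (apply Rdiv_lt_0_compat; lra).
  exists (Rmin 1 (eps / c)). split; [apply Rmin_pos; lra|].
  intros t' x' y' Ht' Dt Dx Dy.
  assert (Dt1 : Rabs (t' - t) < 1) by (eapply Rlt_le_trans; [exact Dt | apply Rmin_l]).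
  assert (Q : forall r, r < Rmin 1 (eps / c) -> r <= eps / c)
    by (intros r Hr; left; eapply Rlt_le_trans; [exact Hr | apply Rmin_r]).
  apply Rabs_def2 in Dt1.
  specialize (L0 t t' x' y' ltac:(lra) ltac:(lra)).
  specialize (L1 t (x' - x) x y' ltac:(lra)). specialize (L2 t (y' - y) x y ltac:(lra)).
  unfold sh in L1, L2. replace (x + (x' - x)) with x' in L1 by ring.
  replace (y + (y' - y)) with y' in L2 by ring.
  replace (g t' x' y' - g t x y) with ((g t' x' y' - g t x' y') +
    ((g t x' y' - g t x y') + (g t x y' - g t x y))) by ring.
  eapply Rle_lt_trans; [apply Rabs_triang|].
  eapply Rle_lt_trans; [apply Rplus_le_compat_l, Rabs_triang|].
  pose proof (Rmult_le_compat_l c0 _ _ Hc0 (Q _ Dt)). pose proof (Rmult_le_compat_l c1 _ _ Hc1 (Q _ Dx)).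
  pose proof (Rmult_le_compat_l c2 _ _ Hc2 (Q _ Dy)).
  assert (c * (eps / c) = eps) by (field; lra).
  set (q := eps / c) in *. unfold c in H2. nra.
Qed.

Lemma theta_time_derive w t x y : 0 < t ->
  is_derive (fun s => D w (theta s) x y) t (D w (gen (fun b => u b t) (theta t)) x y).
Proof.
  intros Ht. destruct (alg_D w _ alg_gen) as (G & HG & EG). simpl in EG. rewrite EG.
  destruct (theta_taylor (2 * t) w) as [c Hc].
  destruct (alg_time_lipschitz (2 * t) G ltac:(lra) HG) as (c' & Hc' & L).
  apply (is_derive_quadratic _ _ _ (Rabs c + c') t Ht). intros s Hs. apply Rabs_def2 in Hs.
  destruct (Rle_dec 0 s) as [H|H].
  - specialize (Hc t s x y ltac:(lra) H ltac:(lra)). rewrite EG in Hc.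
    eapply Rle_trans; [exact Hc|]. apply Rmult_le_compat_r; [nra|].
    pose proof (Rle_abs c). lra.
  (* The expansion only runs forward in time, so for negative [s] it is based at [t + s]. Moving the
     coefficient [G] back to time [t] costs [c' s^2] by its Lipschitz bound. *)
  - specialize (Hc (t + s) (- s) x y ltac:(lra) ltac:(lra) ltac:(lra)). rewrite EG in Hc.
    replace (t + s + - s) with t in Hc by ring.
    specialize (L t (t + s) x y ltac:(lra) ltac:(lra)).
    replace (t + s - t) with s in L by ring.
    replace (D w (theta (t + s)) x y - D w (theta t) x y - s * G t x y) with
      (- (D w (theta t) x y - D w (theta (t + s)) x y - - s * G (t + s) x y)
       + s * (G (t + s) x y - G t x y)) by ring.
    eapply Rle_trans; [apply Rabs_triang|]. rewrite Rabs_Ropp, Rabs_mult.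
    pose proof (Rmult_le_compat_l _ _ _ (Rabs_pos s) L).
    replace (Rabs s * (c' * Rabs s)) with (c' * s ^ 2) in H0
      by (rewrite Rabs_left by lra; ring).
    assert (c * (- s) ^ 2 <= Rabs c * s ^ 2).
    { replace ((- s) ^ 2) with (s ^ 2) by ring. apply Rmult_le_compat_r; [nra | apply Rle_abs]. }
    lra.
Qed.

Lemma alg_time_derive g : Alg g -> exists g', Alg g' /\
  forall t x y, 0 < t -> is_derive (fun s => g s x y) t (g' t x y).
Proof.
  induction 1 as [g Hg|w|c d f g Hf (f' & Hf' & Ef) Hg (g' & Hg' & Eg)|f g Hf (f' & Hf' & Ef) Hg (g' & Hg' & Eg)].
  - destruct (HF g Hg) as (_ & _ & (g' & Hg' & E) & _).
    exists g'. split; [now apply sa_drift|]. intros t x y _. apply is_derive_Reals, E.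
  - destruct (alg_D w _ alg_gen) as (G & HG & EG). exists G. split; [assumption|].
    intros t x y Ht. rewrite <- EG. now apply theta_time_derive.
  - exists (fun t x y => c * f' t x y + d * g' t x y). split; [now apply sa_lin|].
    intros t x y Ht.
    apply (is_derive_plus (fun s => c * f s x y) (fun s => d * g s x y));
      apply is_derive_scal; auto.
  - exists (fun t x y => 1 * (f' t x y * g t x y) + 1 * (f t x y * g' t x y)). split.
    + apply (sa_lin F theta 1 1 (fun t x y => f' t x y * g t x y) (fun t x y => f t x y * g' t x y));
        now apply sa_mult.
    + intros t x y Ht. rewrite !Rmult_1_l.
      apply (is_derive_mult (fun s => f s x y) (fun s => g s x y)); auto.
      intros; apply Rmult_comm.
Qed.

Lemma alg_smooth g : Alg g -> smooth3_on (fun t _ _ => 0 < t) g.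
Proof.
  intros H0. exists Alg. split; [assumption|]. clear g H0. intros g Hg. repeat split.
  - intros t x y Ht eps He. destruct (alg_continuous t x y g eps Hg ltac:(lra) He) as (d & Hd & H).
    exists (Rmin d t). split; [now apply Rmin_pos|]. intros t' x' y' H1 H2 H3.
    assert (Q : forall r, r < Rmin d t -> r < d) by (intros; eapply Rlt_le_trans; [eassumption | apply Rmin_l]).
    apply H; auto. assert (Rabs (t' - t) < t) by (eapply Rlt_le_trans; [eassumption | apply Rmin_r]).
    apply Rabs_def2 in H0. lra.
  - destruct (alg_time_derive g Hg) as (g' & Hg' & E). exists g'. split; [assumption|].
    intros t x y Ht. apply is_derive_Reals, E, Ht.
  - destruct (alg_pd true g Hg) as (g' & Hg' & E). exists g'. split; [assumption|].
    intros t x y Ht. apply is_derive_Reals, (proj1 (is_derive_sh_true _ _ _ _)), E.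
  - destruct (alg_pd false g Hg) as (g' & Hg' & E). exists g'. split; [assumption|].
    intros t x y Ht. apply is_derive_Reals, (proj1 (is_derive_sh_false _ _ _ _)), E.
Qed.
End Regularity.

Lemma solution_exists F u1 u2 f0 : bounded_family F -> F u1 -> F u2 ->
  (forall k, exists M, Bd k M f0) -> exists theta, is_solution u1 u2 f0 theta.
Proof.
  intros HF H1 H2 H0.
  set (u := fun b : bool => if b then u1 else u2).
  assert (Hu : forall b, F (u b)) by (intros [|]; assumption).
  assert (HV : forall k, exists V, forall b t, 0 <= t -> Bd k V (u b t))
    by (exact (drift_Bd F HF u Hu)).
  assert (HW : forall k, exists W, forall b t t', 0 <= t -> 0 <= t' ->
    Bd k (W * Rabs (t - t')) (fun x y => 1 * u b t x y + -1 * u b t' x y)).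
  { intros k. destruct (family_Bd_time F HF k _ (Hu true)) as [W1 E1].
    destruct (family_Bd_time F HF k _ (Hu false)) as [W2 E2].
    exists (Rmax W1 W2). intros [|] t t' Ht Ht'; (eapply Bd_weaken; [|auto]);
      (apply Rmult_le_compat_r; [apply Rabs_pos|]); [apply Rmax_l | apply Rmax_r]. }
  destruct (choice _ HV) as [V EV]. destruct (choice _ HW) as [W EW].
  destruct (choice _ H0) as [M0 EM]. destruct free_ultrafilter_exists as [U HU].
  assert (Hb : drift_bounds u V W) by (split; assumption).
  set (theta := limit_solution u V f0 U).
  assert (TB : forall T k, 0 <= T -> exists M, forall t, t <= T -> Bd k M (theta t)).
  { intros T k HT. eexists. intros t Ht.
    exact (limit_solution_Bd u V W f0 M0 Hb EM U HU T t k HT Ht). }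
  pose proof (limit_solution_taylor u V W f0 M0 Hb EM U HU) as TT.
  assert (Ath : solution_algebra F theta theta) by exact (sa_deriv F theta nil).
  exists theta. split; [|split; [|split; [|split]]].
  - exact (alg_smooth F HF u Hu theta TB TT _ Ath).
  - exists (M0 O). intros t x y _. exact (limit_solution_bounded u V W f0 M0 Hb EM U HU t x y).
  - intros x y. unfold theta. now rewrite (limit_solution_initial u V f0 U HU).
  - intros x y eps He.
    destruct (alg_continuous F HF u Hu theta TB TT 0 x y theta eps Ath (Rle_refl 0) He) as (d & Hd & H).
    exists d. split; [assumption|]. intros t x' y' Ht Hx Hy.
    replace (f0 x y) with (theta 0 x y)
      by (unfold theta; now rewrite (limit_solution_initial u V f0 U HU)).
    apply H; auto; [lra|]. rewrite Rabs_pos_eq; lra.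
  - exists (fun t => gen (fun b => u b t) (theta t)), (fun t => pd true (theta t)),
      (fun t => pd false (theta t)), (fun t => pd true (pd true (theta t))),
      (fun t => pd false (pd false (theta t))).
    intros t x y Ht.
    destruct (TB (Rmax 0 t) 2%nat (Rmax_l _ _)) as [M HM]. specialize (HM t (Rmax_r _ _)).
    assert (X : forall b, is_derive (fun s => sh b s (theta t) x y) 0 (pd b (theta t) x y))
      by (intros b; apply Derive_correct; exact (Bd_ex _ _ _ b x y HM)).
    assert (X2 : forall b, is_derive (fun s => sh b s (pd b (theta t)) x y) 0
      (pd b (pd b (theta t)) x y))
      by (intros b; apply Derive_correct; exact (Bd_ex _ _ _ b x y (Bd_pd _ _ _ b HM))).
    repeat split.
    + apply is_derive_Reals. exact (theta_time_derive F HF u Hu theta TB TT nil t x y Ht).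
    + apply is_derive_Reals, (proj1 (is_derive_sh_true _ _ _ _)), X.
    + apply is_derive_Reals, (proj1 (is_derive_sh_false _ _ _ _)), X.
    + apply is_derive_Reals, (proj1 (is_derive_sh_true _ _ _ _)), X2.
    + apply is_derive_Reals, (proj1 (is_derive_sh_false _ _ _ _)), X2.
    + unfold gen, gen1, u. ring.
Qed.

(** * Maximum principle *)

Lemma ulim_between U u a b : free_ultrafilter U -> (forall n, a <= u n <= b) ->
  is_ulim U u (ulim U u) /\ a <= ulim U u <= b.
Proof.
  intros HU H.
  assert (L : is_ulim U u (ulim U u)).
  { apply ulim_spec with (Rmax (Rabs a) (Rabs b)); [assumption|].
    intros n. specialize (H n). apply RmaxAbs; apply H. }
  split; [assumption|]. split; apply Rnot_lt_le; intros Hlt.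
  - destruct (fu_ex U HU _ (L (a - ulim U u) ltac:(lra))) as [n Hn].
    specialize (H n). apply Rabs_def2 in Hn. lra.
  - destruct (fu_ex U HU _ (L (ulim U u - b) ltac:(lra))) as [n Hn].
    specialize (H n). apply Rabs_def2 in Hn. lra.
Qed.

(** The minimiser is the ultrafilter limit of a minimising sequence. Continuity is relative to the
    box, because the functions concerned are controlled only on its side [t >= 0]. *)
Lemma box_min (v : R -> R -> R -> R) (Q : R -> R -> R -> Prop) a0 b0 a1 b1 a2 b2 m :
  (forall t x y, Q t x y <-> a0 <= t <= b0 /\ a1 <= x <= b1 /\ a2 <= y <= b2) ->
  (exists t x y, Q t x y) ->
  (forall t x y, Q t x y -> m <= v t x y) ->
  (forall t x y eps, Q t x y -> 0 < eps -> exists delta, 0 < delta /\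
    forall t' x' y', Q t' x' y' -> Rabs (t' - t) < delta -> Rabs (x' - x) < delta ->
      Rabs (y' - y) < delta -> Rabs (v t' x' y' - v t x y) < eps) ->
  exists t x y, Q t x y /\ forall t' x' y', Q t' x' y' -> v t x y <= v t' x' y'.
Proof.
  intros HQ (t0 & x0 & y0 & H0) Hm Hc.
  destruct free_ultrafilter_exists as [U HU].
  destruct (completeness (fun r => forall t x y, Q t x y -> r <= v t x y)) as [i [Hi1 Hi2]].
  { exists (v t0 x0 y0). intros r Hr. now apply Hr. }
  { exists m. exact Hm. }
  assert (Hi : forall t x y, Q t x y -> i <= v t x y).
  { intros t x y H. apply Hi2. intros r Hr. now apply Hr. }
  assert (Hs : forall n : nat, exists p : R * R * R,
    Q (fst (fst p)) (snd (fst p)) (snd p) /\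
    v (fst (fst p)) (snd (fst p)) (snd p) < i + / INR (S n)).
  { intros n. apply NNPP. intros HN.
    assert (Hp : 0 < / INR (S n)) by (apply Rinv_0_lt_compat, lt_0_INR; lia).
    assert (i + / INR (S n) <= i); [|lra]. apply Hi1. intros t x y H.
    apply Rnot_lt_le. intros Hlt. apply HN. now exists (t, x, y). }
  destruct (choice _ Hs) as [p Hp].
  assert (B : forall n, _) by (intros n; exact (proj1 (HQ _ _ _) (proj1 (Hp n)))).
  simpl in B.
  destruct (ulim_between U (fun n => fst (fst (p n))) a0 b0 HU ltac:(apply B)) as [Lt It].
  destruct (ulim_between U (fun n => snd (fst (p n))) a1 b1 HU ltac:(apply B)) as [Lx Ix].
  destruct (ulim_between U (fun n => snd (p n)) a2 b2 HU ltac:(apply B)) as [Ly Iy].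
  set (t := ulim U (fun n => fst (fst (p n)))) in *.
  set (x := ulim U (fun n => snd (fst (p n)))) in *.
  set (y := ulim U (fun n => snd (p n))) in *.
  assert (Hq : Q t x y) by (apply HQ; auto).
  exists t, x, y. split; [assumption|]. intros t' x' y' H'.
  apply Rle_trans with i; [|now apply Hi].
  apply Rnot_lt_le. intros Hlt.
  assert (He : 0 < (v t x y - i) / 2) by lra.
  destruct (Hc t x y _ Hq He) as (d & Hd & Hd').
  destruct (archimed_cor1 _ He) as (N & HN & HN0).
  destruct (fu_ex U HU _ (fu_and U HU _ _ (fu_and U HU _ _ (Lt d Hd) (Lx d Hd))
    (fu_and U HU _ _ (Ly d Hd) (fu_tail U HU N)))) as [n [[Nt Nx] [Ny Nn]]].
  specialize (Hd' _ _ _ (proj1 (Hp n)) Nt Nx Ny). apply Rabs_def2 in Hd'.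
  pose proof (proj2 (Hp n)).
  assert (/ INR (S n) <= / INR N).
  { apply Rinv_le_contravar; [now apply lt_0_INR | apply le_INR; lia]. }
  lra.
Qed.

(** Only earlier times are compared, because the minimum over the box may sit at the final time. *)
Lemma left_min_derivative phi t l : 0 < t -> is_derive phi t l ->
  (forall s, 0 <= s <= t -> phi t <= phi s) -> l <= 0.
Proof.
  intros Ht H Hmin. apply Rnot_lt_le. intros Hl.
  apply is_derive_Reals in H. destruct (H l Hl) as [d Hd].
  set (h := - Rmin (d / 2) t).
  assert (Hp : 0 < Rmin (d / 2) t) by (apply Rmin_pos; [|assumption]; pose proof (cond_pos d); lra).
  assert (H1 : Rabs h < d).
  { unfold h. rewrite Rabs_Ropp, Rabs_pos_eq by lra. eapply Rle_lt_trans; [apply Rmin_l|].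
    pose proof (cond_pos d). lra. }
  assert (h < 0) by (unfold h; lra).
  specialize (Hd h ltac:(lra) H1). apply Rabs_def2 in Hd.
  assert (Hs : 0 <= t + h <= t) by (split; [|lra]; unfold h; pose proof (Rmin_r (d / 2) t); lra).
  specialize (Hmin _ Hs).
  assert ((phi (t + h) - phi t) / h <= 0).
  { unfold Rdiv. assert (/ h < 0) by now apply Rinv_lt_0_compat. nra. }
  lra.
Qed.

Lemma interior_min_derivatives phi dphi x a b l : a < x < b ->
  (forall s, is_derive phi s (dphi s)) -> is_derive dphi x l ->
  (forall s, a <= s <= b -> phi x <= phi s) -> dphi x = 0 /\ 0 <= l.
Proof.
  intros Hx H1 H2 Hmin.
  assert (E : dphi x = 0).
  { assert (pr : derivable_pt phi x) by (exists (dphi x); apply is_derive_Reals, H1).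
    rewrite <- (deriv_minimum phi a b x pr); try lra.
    - symmetry. apply derive_pt_eq_0, is_derive_Reals, H1.
    - intros s Ha Hb. apply Hmin. lra. }
  split; [assumption|]. apply Rnot_lt_le. intros Hl.
  apply is_derive_Reals in H2. destruct (H2 (- l) ltac:(lra)) as [d Hd].
  set (h := Rmin (d / 2) ((b - x) / 2)).
  assert (Hp : 0 < h) by (apply Rmin_pos; [|lra]; pose proof (cond_pos d); lra).
  assert (Hhd : h < d) by (eapply Rle_lt_trans; [apply Rmin_l|]; pose proof (cond_pos d); lra).
  assert (Hhb : h < b - x) by (eapply Rle_lt_trans; [apply Rmin_r|]; lra).
  destruct (MVT_cor2 phi dphi x (x + h) ltac:(lra)) as (c & Hc1 & Hc2).
  { intros s _. apply is_derive_Reals, H1. }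
  specialize (Hmin (x + h) ltac:(lra)).
  assert (Hk : 0 < c - x < d) by lra.
  specialize (Hd (c - x) ltac:(lra) ltac:(rewrite Rabs_pos_eq; lra)).
  replace (x + (c - x)) with c in Hd by ring. rewrite E, Rminus_0_r in Hd.
  apply Rabs_def2 in Hd. destruct Hd as [Hd _].
  assert (Hneg : dphi c / (c - x) < 0) by lra.
  assert (dphi c < 0).
  { replace (dphi c) with (dphi c / (c - x) * (c - x)) by (field; lra). nra. }
  nra.
Qed.

(* If v were negative somewhere, v + eta e^(L t) (1 + x^2 + y^2) would have a
   negative minimum in a large box; at that point the equation fails. *)
Lemma half_plane_positivity (v u1 u2 : R -> R -> R -> R) T M B :
  (forall t x y, 0 <= t <= T -> 0 <= x -> - M <= v t x y) ->
  (forall t x y eps, 0 <= t <= T -> 0 <= x -> 0 < eps -> exists delta, 0 < delta /\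
    forall t' x' y', 0 <= t' <= T -> 0 <= x' -> Rabs (t' - t) < delta ->
      Rabs (x' - x) < delta -> Rabs (y' - y) < delta -> Rabs (v t' x' y' - v t x y) < eps) ->
  (forall x y, 0 <= x -> 0 <= v 0 x y) ->
  (forall t y, 0 <= t <= T -> 0 <= v t 0 y) ->
  (forall t x y, 0 <= t <= T -> Rabs (u1 t x y) <= B /\ Rabs (u2 t x y) <= B) ->
  (forall t x y, 0 < t <= T -> 0 < x -> v t x y < 0 ->
    exists vt (dx dy : R -> R) vxx vyy,
      is_derive (fun s => v s x y) t vt /\
      (forall s, is_derive (fun z => v t z y) s (dx s)) /\
      (forall s, is_derive (fun z => v t x z) s (dy s)) /\
      is_derive dx x vxx /\ is_derive dy y vyy /\
      0 <= vt + u1 t x y * dx x + u2 t x y * dy y - (vxx + vyy)) ->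
  forall t x y, 0 <= t <= T -> 0 <= x -> 0 <= v t x y.
Proof.
  intros HM Hc H0 Hx0 HB HP t1 x1 y1 Ht1 Hx1.
  apply Rnot_lt_le. intros Hneg.
  assert (HB0 : 0 <= B).
  { eapply Rle_trans; [apply Rabs_pos | apply (HB t1 x1 y1 Ht1)]. }
  (* At the minimum the penalty contributes at most [B (2 + x^2 + y^2)] through the drift and 4
     through the Laplacian, in units of [e = eta exp(L t)]. This [L] makes the time derivative,
     [- L (1 + x^2 + y^2)], beat both. *)
  set (L := 2 * B + 5).
  set (q := exp (L * t1) * (1 + x1 ^ 2 + y1 ^ 2)).
  assert (Hq : 0 < q) by (apply Rmult_lt_0_compat; [apply exp_pos | nra]).
  (* The penalty at the bad point is then half of [- v], so the penalised function is still negative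
     there. *)
  set (eta := - v t1 x1 y1 / (2 * q)).
  assert (Heta : 0 < eta) by (apply Rdiv_lt_0_compat; lra).
  set (b := fun t x y : R => eta * exp (L * t) * (1 + x ^ 2 + y ^ 2)).
  assert (Hb : forall t x y, 0 <= t -> eta * (1 + x ^ 2 + y ^ 2) <= b t x y).
  { intros t x y Ht. unfold b. rewrite Rmult_assoc. apply Rmult_le_compat_l; [lra|].
    assert (1 <= exp (L * t)).
    { rewrite <- exp_0. destruct (Req_dec (L * t) 0) as [->|Hne]; [lra|].
      left. apply exp_increasing. assert (0 <= L * t) by (apply Rmult_le_pos; unfold L; lra). lra. }
    nra. }
  assert (Hb0 : forall t x y, 0 <= t -> 0 < b t x y).
  { intros t x y Ht. eapply Rlt_le_trans; [|now apply Hb]. apply Rmult_lt_0_compat; nra. }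
  (* The box contains the bad point, and where [x^2 + y^2 >= r^2] the penalty exceeds [M], so the
     negative minimum avoids the outer sides. *)
  set (r := Rabs x1 + Rabs y1 + Rabs M / eta + 1).
  assert (HMe : 0 <= Rabs M / eta) by (apply Rdiv_le_0_compat; [apply Rabs_pos | lra]).
  pose proof (Rabs_pos x1) as Px. pose proof (Rabs_pos y1) as Py.
  assert (Hr1 : 1 <= r) by (unfold r; lra).
  assert (HrM : M < eta * (1 + r ^ 2)).
  { assert (Rabs M / eta <= r) by (unfold r; lra).
    assert (Rabs M / eta * eta = Rabs M) by (field; lra).
    assert (Rabs M <= r * eta) by nra.
    pose proof (Rle_abs M). assert (r <= r ^ 2) by nra.
    assert (eta * r <= eta * r ^ 2) by (apply Rmult_le_compat_l; lra). lra. }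
  set (Q := fun t x y : R => 0 <= t <= T /\ 0 <= x <= r /\ - r <= y <= r).
  assert (Q1 : Q t1 x1 y1).
  { unfold Q. pose proof (Rle_abs x1) as Ax. pose proof (Rle_abs y1) as Ay.
    pose proof (Rle_abs (- y1)) as Az. rewrite Rabs_Ropp in Az.
    unfold r. repeat split; try apply Ht1; lra. }
  destruct (box_min (fun t x y => v t x y + b t x y) Q 0 T 0 r (- r) r (- M))
    as (t & x & y & Hp & Hmin).
  { intros; reflexivity. }
  { now exists t1, x1, y1. }
  { intros t x y ((Ha & Hb') & (Hc' & _) & _). specialize (HM t x y (conj Ha Hb') Hc').
    specialize (Hb0 t x y Ha). lra. }
  { intros t x y eps (Ht & (Hx & _) & _) He.
    destruct (Hc t x y (eps / 2) Ht Hx ltac:(lra)) as (d & Hd & Hd').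
    assert (Cb : exists d', 0 < d' /\ forall t' x' y', Rabs (t' - t) < d' -> Rabs (x' - x) < d' ->
      Rabs (y' - y) < d' -> Rabs (b t' x' y' - b t x y) < eps / 2).
    { assert (C1 : continuity_2d_pt (fun x y => 1 + x ^ 2 + y ^ 2) x y).
      { repeat first [apply continuity_2d_pt_plus | apply continuity_2d_pt_const
          | apply continuity_2d_pt_mult | apply continuity_2d_pt_id1 | apply continuity_2d_pt_id2]. }
      assert (C2 : continuous (fun t => eta * exp (L * t)) t).
      { apply (ex_derive_continuous (fun t => eta * exp (L * t))). auto_derive. auto. }
      set (A := eta * exp (L * t)) in *. set (P := 1 + x ^ 2 + y ^ 2) in *.
      assert (HP0 : 0 < P) by (unfold P; nra).
      assert (HA0 : 0 < A) by (apply Rmult_lt_0_compat; [lra | apply exp_pos]).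
      assert (He1 : 0 < eps / (4 * (A + P + 1))) by (apply Rdiv_lt_0_compat; lra).
      set (e := Rmin 1 (eps / (4 * (A + P + 1)))).
      assert (He' : 0 < e) by (apply Rmin_pos; lra).
      destruct (C1 (mkposreal e He')) as [d1 Hd1].
      apply continuity_pt_filterlim in C2.
      destruct (C2 e He') as (d2 & Hd2 & C2').
      exists (Rmin d1 d2). split; [apply Rmin_pos; [apply cond_pos | lra]|].
      intros t' x' y' It Ix Iy.
      assert (Jx : Rabs (x' - x) < d1) by (eapply Rlt_le_trans; [exact Ix | apply Rmin_l]).
      assert (Jy : Rabs (y' - y) < d1) by (eapply Rlt_le_trans; [exact Iy | apply Rmin_l]).
      assert (Jt : Rabs (t' - t) < d2) by (eapply Rlt_le_trans; [exact It | apply Rmin_r]).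
      specialize (Hd1 x' y' Jx Jy). simpl in Hd1.
      assert (HA : Rabs (eta * exp (L * t') - A) < e).
      { destruct (Req_dec t' t) as [->|Hne].
        - unfold A. rewrite Rminus_diag, Rabs_R0. assumption.
        - apply (C2' t'). split; [|exact Jt]. split; [exact I | auto]. }
      unfold b. fold A. change (1 + x ^ 2 + y ^ 2) with P. set (A' := eta * exp (L * t')) in *.
      change (Rabs (1 + x' ^ 2 + y' ^ 2 - P) < e) in Hd1.
      set (P' := 1 + x' ^ 2 + y' ^ 2) in *.
      replace (A' * P' - A * P) with ((A' - A) * (P' - P) + ((A' - A) * P + A * (P' - P))) by ring.
      eapply Rle_lt_trans; [apply Rabs_triang|].
      eapply Rle_lt_trans; [apply Rplus_le_compat_l, Rabs_triang|].
      rewrite !Rabs_mult, (Rabs_pos_eq A), (Rabs_pos_eq P) by lra.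
      assert (e <= 1) by apply Rmin_l.
      assert (Hee : e * (4 * (A + P + 1)) <= eps).
      { assert (Hle : e <= eps / (4 * (A + P + 1))) by apply Rmin_r.
        apply (Rmult_le_compat_r (4 * (A + P + 1))) in Hle; [|lra].
        replace (eps / (4 * (A + P + 1)) * (4 * (A + P + 1))) with eps in Hle by (field; lra).
        exact Hle. }
      pose proof (Rabs_pos (A' - A)). pose proof (Rabs_pos (P' - P)).
      set (a1 := Rabs (A' - A)) in *. set (p1 := Rabs (P' - P)) in *.
      nra. }
    destruct Cb as (d' & Hd0 & Cb). exists (Rmin d d'). split; [now apply Rmin_pos|].
    intros t' x' y' (Ht' & (Hx' & _) & _) It Ix Iy.
    assert (J : forall z, z < Rmin d d' -> z < d /\ z < d').
    { intros z Hz. split; (eapply Rlt_le_trans; [exact Hz|]); [apply Rmin_l | apply Rmin_r]. }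
    destruct (J _ It), (J _ Ix), (J _ Iy).
    specialize (Hd' t' x' y' Ht' Hx' ltac:(auto) ltac:(auto) ltac:(auto)).
    specialize (Cb t' x' y' ltac:(auto) ltac:(auto) ltac:(auto)).
    replace (v t' x' y' + b t' x' y' - (v t x y + b t x y)) with
      ((v t' x' y' - v t x y) + (b t' x' y' - b t x y)) by ring.
    eapply Rle_lt_trans; [apply Rabs_triang|]. lra. }
  pose proof (Hmin _ _ _ Q1) as Hm1.
  assert (Hb1 : b t1 x1 y1 = - v t1 x1 y1 / 2).
  { unfold b. rewrite Rmult_assoc. fold q. unfold eta. field. lra. }
  assert (Hv : v t x y + b t x y < 0) by lra.
  destruct Hp as ((Ht & HtT) & (Hx & Hxr) & (Hyl & Hyr)).
  pose proof (Hb0 t x y Ht) as Hbp.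
  assert (Ht' : 0 < t).
  { destruct Ht as [Ht|Ht]; [assumption|]. subst t. specialize (H0 x y Hx). lra. }
  assert (Hx' : 0 < x).
  { destruct Hx as [Hx|Hx]; [assumption|]. subst x. specialize (Hx0 t y ltac:(lra)). lra. }
  assert (Hfar : x ^ 2 + y ^ 2 < r ^ 2).
  { apply Rnot_le_lt. intros Hle. specialize (HM t x y ltac:(lra) Hx). specialize (Hb t x y Ht).
    assert (eta * (1 + r ^ 2) <= eta * (1 + x ^ 2 + y ^ 2)) by (apply Rmult_le_compat_l; lra).
    lra. }
  assert (Hxr' : x < r) by nra. assert (Hyr' : - r < y < r) by (split; nra).
  destruct (HP t x y ltac:(lra) Hx' ltac:(lra)) as (vt & dx & dy & vxx & vyy & Et & Ex & Ey & Exx & Eyy & Hpde).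
  set (e := eta * exp (L * t)).
  assert (He : 0 < e) by (apply Rmult_lt_0_compat; [lra | apply exp_pos]).
  assert (D1 : vt + L * (e * (1 + x ^ 2 + y ^ 2)) <= 0).
  { apply (left_min_derivative (fun s => v s x y + b s x y) t); [assumption| |].
    - apply (is_derive_plus (fun s => v s x y) (fun s => b s x y)); [assumption|].
      unfold b. auto_derive; auto. unfold e. ring.
    - intros s Hs. apply Hmin. repeat split; lra. }
  assert (D2 : dx x + e * (2 * x) = 0 /\ 0 <= vxx + e * 2).
  { apply (interior_min_derivatives (fun z => v t z y + b t z y) (fun z => dx z + e * (2 * z)) x 0 r).
    - lra.
    - intros s. apply (is_derive_plus (fun z => v t z y) (fun z => b t z y)); [apply Ex|].
      unfold b. auto_derive; auto. unfold e. ring.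
    - apply (is_derive_plus dx (fun z => e * (2 * z))); [assumption|]. auto_derive; auto. ring.
    - intros s Hs. apply Hmin. repeat split; lra. }
  assert (D3 : dy y + e * (2 * y) = 0 /\ 0 <= vyy + e * 2).
  { apply (interior_min_derivatives (fun z => v t x z + b t x z) (fun z => dy z + e * (2 * z)) y (- r) r).
    - lra.
    - intros s. apply (is_derive_plus (fun z => v t x z) (fun z => b t x z)); [apply Ey|].
      unfold b. auto_derive; auto. unfold e. ring.
    - apply (is_derive_plus dy (fun z => e * (2 * z))); [assumption|]. auto_derive; auto. ring.
    - intros s Hs. apply Hmin. repeat split; lra. }
  destruct D2 as [D2 D2'], D3 as [D3 D3'].
  assert (Ex' : dx x = - (e * (2 * x))) by lra. assert (Ey' : dy y = - (e * (2 * y))) by lra.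
  rewrite Ex', Ey' in Hpde.
  destruct (HB t x y ltac:(lra)) as [B1 B2].
  (* Young's inequality absorbs the linear growth of the penalty's gradient into its quadratic
     growth. *)
  assert (G : forall w z, Rabs w <= B -> - (B * (1 + z ^ 2)) <= 2 * (w * z)).
  { intros w z Hw. apply Rabs_le_between in Hw.
    assert (0 <= B * (1 - z) ^ 2) by (apply Rmult_le_pos; [lra | apply pow2_ge_0]).
    assert (0 <= B * (1 + z) ^ 2) by (apply Rmult_le_pos; [lra | apply pow2_ge_0]).
    destruct (Rle_dec 0 z).
    - assert (0 <= (w + B) * z) by (apply Rmult_le_pos; lra). lra.
    - assert (0 <= (B - w) * - z) by (apply Rmult_le_pos; lra). lra. }
  pose proof (G _ x B1) as G1. pose proof (G _ y B2) as G2.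
  apply (Rmult_le_compat_l e) in G1; [|lra]. apply (Rmult_le_compat_l e) in G2; [|lra].
  unfold L in D1.
  assert (0 <= e * (x ^ 2 + y ^ 2)) by (apply Rmult_le_pos; nra).
  assert (0 <= B * (e * (x ^ 2 + y ^ 2))) by (apply Rmult_le_pos; lra).
  nra.
Qed.

(** * Time-supremum norms dominated by product densities *)

Definition lsum {A : Type} (f : A -> R) (l : list A) : R :=
  fold_right (fun s acc => f s + acc) 0 l.

Definition ind (a b x : R) : R :=
  if Rle_dec a x then if Rlt_dec x b then 1 else 0 else 0.

Definition clip (p q x : R) : R := Rmax p (Rmin q x).

Lemma lsum_ext {A : Type} (f g : A -> R) l : (forall s, In s l -> f s = g s) -> lsum f l = lsum g l.
Proof.
  intros H. induction l as [|s l IH]; simpl; [reflexivity|].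
  rewrite IH, H; auto using in_eq, in_cons.
Qed.

Lemma lsum_le {A : Type} (f g : A -> R) l : (forall s, In s l -> f s <= g s) -> lsum f l <= lsum g l.
Proof.
  intros H. induction l as [|s l IH]; simpl; [lra|].
  apply Rplus_le_compat; auto using in_eq, in_cons.
Qed.

Lemma lsum_plus {A : Type} (f g : A -> R) l : lsum (fun s => f s + g s) l = lsum f l + lsum g l.
Proof. induction l as [|s l IH]; simpl; [|rewrite IH]; ring. Qed.

Lemma lsum_scal {A : Type} c (f : A -> R) l : lsum (fun s => c * f s) l = c * lsum f l.
Proof. induction l as [|s l IH]; simpl; [|rewrite IH]; ring. Qed.

Lemma clip_split F p c q x : p <= c <= q ->
  F (clip p q x) + F c = F (clip p c x) + F (clip c q x).
Proof.
  intros [H1 H2]. unfold clip. destruct (Rle_dec x c).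
  - rewrite (Rmin_right q x), (Rmin_right c x), (Rmax_left c x) by lra. reflexivity.
  - rewrite (Rmin_left c x), (Rmax_right p c) by lra.
    rewrite (Rmax_right c), (Rmax_right p); [ring| |]; apply Rmin_glb; lra.
Qed.

Section Intervals.
Context {A : Type} (l : list A) (a b w : A -> R) (F : R -> R) (V : R).
Context (Hl : forall s, In s l -> a s <= b s /\ 0 <= w s).
Context (HF : forall x y, x <= y -> F x <= F y).
Context (HV : forall x, lsum (fun s => w s * ind (a s) (b s) x) l <= V).

(* Induction on the endpoints inside (p, q): each one splits the interval, and
   when none is left every indicator is constant on [p, q). *)
Lemma clipped_increment_sum L : forall p q, p <= q ->
  (forall s, In s l -> (p < a s < q -> In (a s) L) /\ (p < b s < q -> In (b s) L)) ->
  lsum (fun s => w s * (F (clip p q (b s)) - F (clip p q (a s)))) l <= V * (F q - F p).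
Proof.
  induction L as [|c L IH]; intros p q Hpq HL.
  - pose proof (HF p q Hpq) as HFpq.
    apply Rle_trans with ((F q - F p) * lsum (fun s => w s * ind (a s) (b s) p) l).
    + rewrite <- lsum_scal. apply Req_le, lsum_ext. intros s Hs.
      destruct (HL s Hs) as [Ha Hb]. destruct (Hl s Hs) as [Hab _].
      assert (Ha' : a s <= p \/ q <= a s) by (destruct (Rle_dec (a s) p), (Rle_dec q (a s)); auto;
        exfalso; apply Ha; lra).
      assert (Hb' : b s <= p \/ q <= b s) by (destruct (Rle_dec (b s) p), (Rle_dec q (b s)); auto;
        exfalso; apply Hb; lra).
      destruct (Req_dec p q) as [->|Hne].
      { assert (E : forall x, clip q q x = q).
        { intros x. unfold clip. apply Rmax_left. apply Rmin_l. }
        rewrite !E. ring. }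
      assert (Elo : forall x, x <= p -> clip p q x = p).
      { intros x Hx. unfold clip. rewrite Rmin_right, Rmax_left; lra. }
      assert (Ehi : forall x, q <= x -> clip p q x = q).
      { intros x Hx. unfold clip. rewrite Rmin_left, Rmax_right; lra. }
      unfold ind. destruct Ha' as [Ha'|Ha'], Hb' as [Hb'|Hb'].
      * rewrite (Elo (a s)), (Elo (b s)) by assumption.
        destruct (Rle_dec (a s) p), (Rlt_dec p (b s)); try lra; ring.
      * rewrite (Elo (a s)), (Ehi (b s)) by assumption.
        destruct (Rle_dec (a s) p), (Rlt_dec p (b s)); try lra; ring.
      * lra.
      * rewrite (Ehi (a s)), (Ehi (b s)) by assumption.
        destruct (Rle_dec (a s) p), (Rlt_dec p (b s)); try lra; ring.
    + rewrite Rmult_comm. apply Rmult_le_compat_r; [lra | apply HV].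
  - assert (HL' : forall p q, (p < q -> ~ p < c < q) ->
      (forall s, In s l -> (p < a s < q -> In (a s) (c :: L)) /\ (p < b s < q -> In (b s) (c :: L))) ->
      (forall s, In s l -> (p < a s < q -> In (a s) L) /\ (p < b s < q -> In (b s) L))).
    { intros p' q' Hn H s Hs. destruct (H s Hs) as [Ha Hb].
      split; intros Hi; [destruct (Ha Hi) as [E|E] | destruct (Hb Hi) as [E|E]]; auto;
        exfalso; apply Hn; lra. }
    destruct (classic (p < c < q)) as [Hc|Hc].
    + assert (S1 := IH p c ltac:(lra)). assert (S2 := IH c q ltac:(lra)).
      apply Rle_trans with (V * (F c - F p) + V * (F q - F c)); [|apply Req_le; ring].
      rewrite (lsum_ext _ (fun s => w s * (F (clip p c (b s)) - F (clip p c (a s)))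
        + w s * (F (clip c q (b s)) - F (clip c q (a s))))).
      * rewrite lsum_plus. apply Rplus_le_compat; [apply S1 | apply S2]; apply HL'; try lra;
          intros s Hs; destruct (HL s Hs) as [Ha Hb]; split; intros; [apply Ha| apply Hb| apply Ha | apply Hb]; lra.
      * intros s _.
        pose proof (clip_split F p c q (a s) ltac:(lra)). pose proof (clip_split F p c q (b s) ltac:(lra)).
        rewrite <- Rmult_plus_distr_l. f_equal. lra.
    + apply IH; [assumption|]. apply HL'; auto.
Qed.

(** The Stieltjes integral against [F] of a step function bounded by [V]. Taking [[p, q]] around all
    endpoints makes the clipping invisible. *)
Lemma increment_sum lo hi : (forall x, lo <= F x <= hi) -> 0 <= V ->
  lsum (fun s => w s * (F (b s) - F (a s))) l <= V * (hi - lo).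
Proof.
  intros Hr HV0.
  assert (HE : exists p q, p <= q /\ forall s, In s l -> p <= a s <= q /\ p <= b s <= q).
  { clear Hl HV. induction l as [|s l' (p & q & Hpq & IH)].
    - exists 0, 0. split; [lra|]. intros s [].
    - exists (Rmin p (Rmin (a s) (b s))), (Rmax q (Rmax (a s) (b s))).
      assert (E1 := Rmin_l p (Rmin (a s) (b s))). assert (E2 := Rmin_r p (Rmin (a s) (b s))).
      assert (E3 := Rmin_l (a s) (b s)). assert (E4 := Rmin_r (a s) (b s)).
      assert (E5 := Rmax_l q (Rmax (a s) (b s))). assert (E6 := Rmax_r q (Rmax (a s) (b s))).
      assert (E7 := Rmax_l (a s) (b s)). assert (E8 := Rmax_r (a s) (b s)).
      split; [lra|]. intros s' [<-|Hs']; [lra|]. specialize (IH s' Hs'). lra. }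
  destruct HE as (p & q & Hpq & HE).
  apply Rle_trans with (V * (F q - F p)).
  - rewrite (lsum_ext _ (fun s => w s * (F (clip p q (b s)) - F (clip p q (a s))))).
    + apply (clipped_increment_sum (map a l ++ map b l)); [assumption|].
      intros s Hs. split; intros _; apply in_or_app; [left | right]; now apply in_map.
    + intros s Hs. specialize (HE s Hs). unfold clip.
      rewrite !Rmin_right, !Rmax_right by lra. reflexivity.
  - apply Rmult_le_compat_l; [assumption|]. pose proof (Hr p). pose proof (Hr q). lra.
Qed.
End Intervals.

Lemma pairwise_disjoint_cons s l : pairwise_disjoint (s :: l) ->
  pairwise_disjoint l /\ forall s', In s' l -> forall x y, ~ (in_step s x y /\ in_step s' x y).
Proof.
  intros H. split.
  - intros i j d Hi Hj Hij. apply (H (S i) (S j) d); simpl; lia.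
  - intros s' Hs' x y. destruct (In_nth l s' s Hs') as (n & Hn & En).
    rewrite <- En. apply (H O (S n) s); simpl; lia.
Qed.

Lemma ind_01 a b x : ind a b x = 0 \/ ind a b x = 1 /\ a <= x < b.
Proof. unfold ind. destruct (Rle_dec a x), (Rlt_dec x b); auto. Qed.

Lemma disjoint_indicator_sum l x y : pairwise_disjoint l ->
  lsum (fun s => ind (ra s) (rb s) x * ind (rc s) (rd s) y) l <= 1.
Proof.
  induction l as [|s l IH]; intros H; simpl; [lra|].
  apply pairwise_disjoint_cons in H. destruct H as [H1 H2]. specialize (IH H1).
  destruct (ind_01 (ra s) (rb s) x) as [->|[-> Hx]]; [lra|].
  destruct (ind_01 (rc s) (rd s) y) as [->|[-> Hy]]; [lra|].
  rewrite (lsum_ext _ (fun _ => 0 * 1)).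
  - rewrite lsum_scal. lra.
  - intros s' Hs'.
    destruct (ind_01 (ra s') (rb s') x) as [->|[-> Hx']]; [ring|].
    destruct (ind_01 (rc s') (rd s') y) as [->|[-> Hy']]; [ring|].
    exfalso. apply (H2 s' Hs' x y). split; split; assumption.
Qed.

(** A discrete Fubini argument. For fixed [x], the rectangles over [x] have disjoint [y]-sides, so
    their [y]-increments sum to at most [hi - lo]; these increments are then the weights of the
    [x]-intervals. *)
Lemma disjoint_rectangle_sum l (F : R -> R) lo hi : pairwise_disjoint l ->
  (forall s, In s l -> ra s <= rb s /\ rc s <= rd s) ->
  (forall x y, x <= y -> F x <= F y) -> (forall x, lo <= F x <= hi) ->
  lsum (fun s => (F (rb s) - F (ra s)) * (F (rd s) - F (rc s))) l <= (hi - lo) ^ 2.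
Proof.
  intros Hd Hl HF Hr.
  assert (0 <= hi - lo) by (pose proof (Hr 0); lra).
  rewrite (lsum_ext _ (fun s => (F (rd s) - F (rc s)) * (F (rb s) - F (ra s))))
    by (intros; ring).
  replace ((hi - lo) ^ 2) with ((hi - lo) * (hi - lo)) by ring.
  apply increment_sum; auto.
  - intros s Hs. destruct (Hl s Hs). split; [assumption|].
    pose proof (HF (rc s) (rd s)). lra.
  - intros x.
    rewrite (lsum_ext _ (fun s => ind (ra s) (rb s) x * (F (rd s) - F (rc s)))) by (intros; ring).
    rewrite <- (Rmult_1_l (hi - lo)).
    apply increment_sum; auto; [| | lra].
    + intros s Hs. split; [apply Hl, Hs|].
      destruct (ind_01 (ra s) (rb s) x) as [->|[-> _]]; lra.
    + intros y. now apply disjoint_indicator_sum.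
Qed.

Lemma slope_le (F dF : R -> R) a b m : a < b -> (forall x, is_derive F x (dF x)) ->
  (forall x, a <= x < b -> m <= dF x) -> m * (b - a) <= F b - F a.
Proof.
  intros Hab HF Hm. destruct (MVT_cor2 F dF a b Hab) as (c & Hc1 & Hc2).
  - intros x _. apply is_derive_Reals, HF.
  - rewrite Hc1. apply Rmult_le_compat_r; [lra | apply Hm; lra].
Qed.

(** The majorant is independent of [t], so it also bounds the height [rh] of each step, whichever
    time realises that height at a given point. The integral of the step is then compared with
    increments of [F], one variable at a time. *)
Lemma sup_time_Lp_le_product u1 u2 p (F dF : R -> R) c lo hi : 0 < c ->
  (forall x, is_derive F x (dF x)) -> (forall x, 0 < dF x) -> (forall x, lo <= F x <= hi) ->
  c * (hi - lo) ^ 2 <= 1 ->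
  (forall t x y, 0 <= t -> 0 < norm2 (u1 t x y) (u2 t x y) ->
    Rpower (norm2 (u1 t x y) (u2 t x y)) p <= c * (dF x * dF y)) ->
  sup_time_Lp_le u1 u2 p 1.
Proof.
  intros Hc HF HdF Hr Hle Hu l Hd Hl.
  replace (Rpower 1 p) with 1 by (unfold Rpower; rewrite ln_1, Rmult_0_r, exp_0; reflexivity).
  assert (Hmon : forall x y, x <= y -> F x <= F y).
  { intros x y [H| ->]; [|lra].
    pose proof (slope_le F dF x y 0 H HF ltac:(intros; left; apply HdF)). lra. }
  assert (E : steps_sum l = lsum step_value l)
    by (clear; induction l as [|s l IH]; simpl; [|rewrite IH]; reflexivity).
  rewrite E.
  apply Rle_trans with (c * lsum (fun s => (F (rb s) - F (ra s)) * (F (rd s) - F (rc s))) l).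
  - rewrite <- lsum_scal. apply lsum_le. intros s Hs.
    destruct (Hl s Hs) as (Hab & Hcd & Hh & Hval).
    assert (Hpt : forall x y, ra s <= x < rb s -> rc s <= y < rd s -> rh s <= c * (dF x * dF y)).
    { intros x y Hx Hy. destruct (Hval x y (conj Hx Hy)) as (t & Ht & Hn & Hlt).
      specialize (Hu t x y Ht Hn). lra. }
    destruct (MVT_cor2 F dF (ra s) (rb s) Hab) as (xi & Hxi & _);
      [intros; apply is_derive_Reals, HF|].
    assert (HDF : 0 < F (rb s) - F (ra s))
      by (rewrite Hxi; apply Rmult_lt_0_compat; [apply HdF | lra]).
    set (DF := F (rb s) - F (ra s)) in *.
    (* Integrating in [x] at fixed [y] gives a lower bound for [dF y], ready to be integrated in
       [y]. *)
    assert (Hy : forall y, rc s <= y < rd s -> rh s * (rb s - ra s) / (c * DF) <= dF y).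
    { intros y Hy. specialize (HdF y).
      assert (Hx : rh s / (c * dF y) * (rb s - ra s) <= DF).
      { apply (slope_le F dF); auto. intros x Hx. specialize (Hpt x y Hx Hy).
        apply (Rmult_le_reg_r (c * dF y)); [nra|].
        replace (rh s / (c * dF y) * (c * dF y)) with (rh s) by (field; split; lra). nra. }
      apply (Rmult_le_compat_r (c * dF y)) in Hx; [|nra].
      replace (rh s / (c * dF y) * (rb s - ra s) * (c * dF y)) with (rh s * (rb s - ra s)) in Hx
        by (field; split; lra).
      apply (Rmult_le_reg_r (c * DF)); [nra|].
      replace (rh s * (rb s - ra s) / (c * DF) * (c * DF)) with (rh s * (rb s - ra s))
        by (field; split; lra). nra. }
    pose proof (slope_le F dF _ _ _ Hcd HF Hy) as Hfin.
    apply (Rmult_le_compat_r (c * DF)) in Hfin; [|nra].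
    replace (rh s * (rb s - ra s) / (c * DF) * (rd s - rc s) * (c * DF))
      with (step_value s) in Hfin by (unfold step_value; field; split; lra).
    lra.
  - eapply Rle_trans; [|exact Hle]. apply Rmult_le_compat_l; [lra|].
    apply disjoint_rectangle_sum; auto. intros s Hs. destruct (Hl s Hs) as (? & ? & _). lra.
Qed.

(** * The drift *)

Definition bounded_time_family (Tm : (R -> R) -> Prop) : Prop :=
  forall f, Tm f ->
    (exists M, forall t, 0 <= t -> Rabs (f t) <= M) /\
    (exists f', Tm f' /\ forall t : R, is_derive f t (f' t)).

Lemma cont3_of_continuous (g : R -> R -> R -> R) :
  (forall p : R * R * R, continuous (fun p : R * R * R => g (fst (fst p)) (snd (fst p)) (snd p)) p) ->
  cont3_on (fun _ _ _ => True) g.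
Proof.
  intros H t x y _ eps He.
  assert (L : locally (g t x y) (fun z => Rabs (z - g t x y) < eps))
    by (exists (mkposreal eps He); intros z Hz; exact Hz).
  destruct (H (t, x, y) _ L) as [d Hd].
  exists d. split; [apply cond_pos|]. intros t' x' y' Ht Hx Hy.
  apply (Hd (t', x', y')). repeat split; assumption.
Qed.

(** Bounded generators whose derivatives are again polynomials in them and in time functions; with
    [d] the denominator, the [x]-derivative of [x / d] is [1 / d - 2 (x / d)^2]. The unbounded
    coordinates occur only divided by [d]. *)
Inductive vortex_algebra (Tm : (R -> R) -> Prop) (c : R -> R) : (R -> R -> R -> R) -> Prop :=
| va_time f : Tm f -> vortex_algebra Tm c (fun t _ _ => f t)
| va_inv : vortex_algebra Tm c (fun t x y => / (c t + x ^ 2 + y ^ 2))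
| va_x : vortex_algebra Tm c (fun t x y => x / (c t + x ^ 2 + y ^ 2))
| va_y : vortex_algebra Tm c (fun t x y => y / (c t + x ^ 2 + y ^ 2))
| va_plus f g : vortex_algebra Tm c f -> vortex_algebra Tm c g ->
    vortex_algebra Tm c (fun t x y => f t x y + g t x y)
| va_mult f g : vortex_algebra Tm c f -> vortex_algebra Tm c g ->
    vortex_algebra Tm c (fun t x y => f t x y * g t x y).

Section VortexAlgebra.
Context (Tm : (R -> R) -> Prop) (HTm : bounded_time_family Tm) (Hconst : forall k, Tm (fun _ => k)).
Context (c dc : R -> R) (c0 : R) (Hc : forall t, 0 < c t) (Hc0 : 0 < c0)
  (Hcc0 : forall t, 0 <= t -> c0 <= c t) (Hdc : Tm dc) (Hcd : forall t : R, is_derive c t (dc t)).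

Let VA := vortex_algebra Tm c.

Lemma va_ext f g : VA f -> (forall t x y, f t x y = g t x y) -> VA g.
Proof.
  intros Hf H. replace g with f; [assumption|].
  extensionality t; extensionality x; extensionality y. apply H.
Qed.

Lemma va_const k : VA (fun _ _ _ => k).
Proof. exact (va_time Tm c _ (Hconst k)). Qed.

Lemma denominator_pos t x y : 0 < c t + x ^ 2 + y ^ 2.
Proof. pose proof (Hc t). nra. Qed.

Lemma continuous_time (f : R -> R) (p : R * R * R) : (forall t : R, ex_derive f t) ->
  continuous (fun p : R * R * R => f (fst (fst p))) p.
Proof.
  intros H. apply (continuous_comp (fun p : R * R * R => fst (fst p)) f).
  - apply (continuous_comp (fun p : R * R * R => fst p) fst); apply continuous_fst.
  - apply (ex_derive_continuous f), H.
Qed.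

Lemma continuous_coords (p : R * R * R) :
  continuous (fun p : R * R * R => snd (fst p)) p /\ continuous (fun p : R * R * R => snd p) p.
Proof.
  split.
  - apply (continuous_comp (fun p : R * R * R => fst p) snd);
      [apply continuous_fst | apply continuous_snd].
  - apply continuous_snd.
Qed.

Lemma continuous_inv_denominator (p : R * R * R) :
  continuous (fun p : R * R * R => / (c (fst (fst p)) + snd (fst p) ^ 2 + snd p ^ 2)) p.
Proof.
  destruct (continuous_coords p) as [Hx Hy].
  apply (continuous_comp (fun p : R * R * R => c (fst (fst p)) + snd (fst p) ^ 2 + snd p ^ 2) Rinv).
  - apply (continuous_plus (fun p : R * R * R => c (fst (fst p)) + snd (fst p) ^ 2));
      [apply (continuous_plus (fun p : R * R * R => c (fst (fst p))))|].
    + apply continuous_time. intros t. eexists. apply Hcd.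
    + apply (continuous_mult (fun p : R * R * R => snd (fst p))); [assumption|].
      apply (continuous_mult (fun p : R * R * R => snd (fst p))); [assumption|]. apply continuous_const.
    + apply (continuous_mult (fun p : R * R * R => snd p)); [assumption|].
      apply (continuous_mult (fun p : R * R * R => snd p)); [assumption|]. apply continuous_const.
  - apply continuous_Rinv. apply Rgt_not_eq, denominator_pos.
Qed.

Lemma va_continuous g : VA g ->
  forall p, continuous (fun p : R * R * R => g (fst (fst p)) (snd (fst p)) (snd p)) p.
Proof.
  induction 1 as [f Hf| | | |f g Hf IHf Hg IHg|f g Hf IHf Hg IHg]; intros p.
  - apply continuous_time. intros t. destruct (HTm f Hf) as (_ & f' & _ & E). eexists; apply E.
  - apply continuous_inv_denominator.
  - apply (continuous_mult (fun p : R * R * R => snd (fst p)));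
      [apply continuous_coords | apply continuous_inv_denominator].
  - apply (continuous_mult (fun p : R * R * R => snd p));
      [apply continuous_coords | apply continuous_inv_denominator].
  - now apply (continuous_plus (fun p : R * R * R => f (fst (fst p)) (snd (fst p)) (snd p))).
  - now apply (continuous_mult (fun p : R * R * R => f (fst (fst p)) (snd (fst p)) (snd p))).
Qed.

Lemma va_bounded g : VA g -> exists M, forall t x y, 0 <= t -> Rabs (g t x y) <= M.
Proof.
  assert (Hi : forall t x y, 0 <= t -> / (c t + x ^ 2 + y ^ 2) <= / c0).
  { intros t x y Ht. apply Rinv_le_contravar; [assumption|]. pose proof (Hcc0 t Ht). nra. }
  assert (Hz : forall t x y z, 0 <= t -> z ^ 2 <= x ^ 2 + y ^ 2 ->
    Rabs (z / (c t + x ^ 2 + y ^ 2)) <= / c0 + 1).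
  { intros t x y z Ht Hz. pose proof (denominator_pos t x y) as Hd. pose proof (Hcc0 t Ht) as Hct.
    set (d := c t + x ^ 2 + y ^ 2) in *.
    unfold Rdiv. rewrite Rabs_mult, (Rabs_pos_eq (/ d)) by (left; now apply Rinv_0_lt_compat).
    apply (Rmult_le_reg_r d); [assumption|]. rewrite Rmult_assoc, Rinv_l, Rmult_1_r by lra.
    assert (Rabs z <= 1 + z ^ 2) by (unfold Rabs; destruct Rcase_abs; nra).
    assert (1 <= / c0 * d).
    { rewrite <- (Rinv_l c0) by lra. apply Rmult_le_compat_l; [left; now apply Rinv_0_lt_compat|].
      unfold d. nra. }
    unfold d in *. lra. }
  induction 1 as [f Hf| | | |f g Hf [M IHf] Hg [N IHg]|f g Hf [M IHf] Hg [N IHg]].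
  - destruct (HTm f Hf) as ((M & HM) & _). exists M. auto.
  - exists (/ c0). intros t x y Ht. rewrite Rabs_pos_eq; auto.
    left. apply Rinv_0_lt_compat, denominator_pos.
  - exists (/ c0 + 1). intros t x y Ht. apply Hz; [assumption | nra].
  - exists (/ c0 + 1). intros t x y Ht. apply Hz; [assumption | nra].
  - exists (M + N). intros t x y Ht. eapply Rle_trans; [apply Rabs_triang|].
    apply Rplus_le_compat; auto.
  - exists (M * N). intros t x y Ht. rewrite Rabs_mult.
    apply Rmult_le_compat; auto using Rabs_pos.
Qed.

Lemma va_derive_t g : VA g -> exists g', VA g' /\ forall t x y, is_derive (fun s => g s x y) t (g' t x y).
Proof.
  assert (Hp : forall (z : R -> R -> R) f, VA f ->
    (forall t x y, f t x y = z x y / (c t + x ^ 2 + y ^ 2)) ->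
    exists g', VA g' /\ forall t x y, is_derive (fun s => z x y / (c s + x ^ 2 + y ^ 2)) t (g' t x y)).
  { intros z f Hf Ef.
    exists (fun t x y => -1 * dc t * (f t x y * / (c t + x ^ 2 + y ^ 2))). split.
    - apply (va_mult Tm c (fun t x y => -1 * dc t) (fun t x y => f t x y * / (c t + x ^ 2 + y ^ 2))).
      + apply (va_mult Tm c (fun _ _ _ => -1) (fun t x y => dc t)); [apply va_const | now apply va_time].
      + apply (va_mult Tm c f); [assumption | apply va_inv].
    - intros t x y. rewrite Ef. pose proof (denominator_pos t x y) as Hd.
      evar_last.
      + apply (is_derive_scal (fun s => / (c s + x ^ 2 + y ^ 2))).
        apply (is_derive_inv (fun s => c s + x ^ 2 + y ^ 2)); [|lra].
        apply (is_derive_plus (fun s => c s + x ^ 2) (fun _ => y ^ 2)); [|apply is_derive_const].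
        apply (is_derive_plus c (fun _ => x ^ 2)); [apply Hcd | apply is_derive_const].
      + unfold plus, zero; simpl. field. lra. }
  induction 1 as [f Hf| | | |f g Hf (f' & Hf' & Ef) Hg (g' & Hg' & Eg)|f g Hf (f' & Hf' & Ef) Hg (g' & Hg' & Eg)].
  - destruct (HTm f Hf) as (_ & f' & Hf' & E). exists (fun t _ _ => f' t).
    split; [now apply va_time | auto].
  - destruct (Hp (fun _ _ => 1) _ (va_inv Tm c)) as (g' & Hg' & E).
    { intros; unfold Rdiv; ring. }
    exists g'. split; [assumption|]. intros t x y.
    eapply is_derive_ext; [|apply E]. intros s. simpl. field.
    pose proof (denominator_pos s x y) as Hd. simpl in Hd. lra.
  - apply (Hp (fun x _ => x) _ (va_x Tm c)). reflexivity.
  - apply (Hp (fun _ y => y) _ (va_y Tm c)). reflexivity.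
  - exists (fun t x y => f' t x y + g' t x y). split; [now apply va_plus|].
    intros t x y. now apply (is_derive_plus (fun s => f s x y) (fun s => g s x y)).
  - exists (fun t x y => f' t x y * g t x y + f t x y * g' t x y). split.
    + apply (va_plus Tm c (fun t x y => f' t x y * g t x y)); now apply va_mult.
    + intros t x y. apply (is_derive_mult (fun s => f s x y) (fun s => g s x y)); auto.
      intros; apply Rmult_comm.
Qed.

Lemma va_derive_x g : VA g -> exists g', VA g' /\ forall t x y, is_derive (fun s => g t s y) x (g' t x y).
Proof.
  induction 1 as [f Hf| | | |f g Hf (f' & Hf' & Ef) Hg (g' & Hg' & Eg)|f g Hf (f' & Hf' & Ef) Hg (g' & Hg' & Eg)].
  - exists (fun _ _ _ => 0). split; [apply va_const|]. intros; apply (is_derive_const (f t)).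
  - exists (fun t x y => -2 * (x / (c t + x ^ 2 + y ^ 2) * / (c t + x ^ 2 + y ^ 2))). split.
    + apply (va_mult Tm c (fun _ _ _ => -2)); [apply va_const|].
      apply (va_mult Tm c); [apply va_x | apply va_inv].
    + intros t x y. pose proof (denominator_pos t x y).
      auto_derive; [simpl in *; lra | field; simpl in *; lra].
  - exists (fun t x y => / (c t + x ^ 2 + y ^ 2) +
      -2 * (x / (c t + x ^ 2 + y ^ 2) * (x / (c t + x ^ 2 + y ^ 2)))). split.
    + apply (va_plus Tm c); [apply va_inv|].
      apply (va_mult Tm c (fun _ _ _ => -2)); [apply va_const|].
      apply (va_mult Tm c); apply va_x.
    + intros t x y. pose proof (denominator_pos t x y).
      auto_derive; [simpl in *; lra | field; simpl in *; lra].
  - exists (fun t x y => -2 * (x / (c t + x ^ 2 + y ^ 2) * (y / (c t + x ^ 2 + y ^ 2)))). split.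
    + apply (va_mult Tm c (fun _ _ _ => -2)); [apply va_const|].
      apply (va_mult Tm c); [apply va_x | apply va_y].
    + intros t x y. pose proof (denominator_pos t x y).
      auto_derive; [simpl in *; lra | field; simpl in *; lra].
  - exists (fun t x y => f' t x y + g' t x y). split; [now apply va_plus|].
    intros t x y. now apply (is_derive_plus (fun s => f t s y) (fun s => g t s y)).
  - exists (fun t x y => f' t x y * g t x y + f t x y * g' t x y). split.
    + apply (va_plus Tm c (fun t x y => f' t x y * g t x y)); now apply va_mult.
    + intros t x y. apply (is_derive_mult (fun s => f t s y) (fun s => g t s y)); auto.
      intros; apply Rmult_comm.
Qed.

Lemma va_derive_y g : VA g -> exists g', VA g' /\ forall t x y, is_derive (fun s => g t x s) y (g' t x y).
Proof.
  induction 1 as [f Hf| | | |f g Hf (f' & Hf' & Ef) Hg (g' & Hg' & Eg)|f g Hf (f' & Hf' & Ef) Hg (g' & Hg' & Eg)].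
  - exists (fun _ _ _ => 0). split; [apply va_const|]. intros; apply (is_derive_const (f t)).
  - exists (fun t x y => -2 * (y / (c t + x ^ 2 + y ^ 2) * / (c t + x ^ 2 + y ^ 2))). split.
    + apply (va_mult Tm c (fun _ _ _ => -2)); [apply va_const|].
      apply (va_mult Tm c); [apply va_y | apply va_inv].
    + intros t x y. pose proof (denominator_pos t x y).
      auto_derive; [simpl in *; lra | field; simpl in *; lra].
  - exists (fun t x y => -2 * (x / (c t + x ^ 2 + y ^ 2) * (y / (c t + x ^ 2 + y ^ 2)))). split.
    + apply (va_mult Tm c (fun _ _ _ => -2)); [apply va_const|].
      apply (va_mult Tm c); [apply va_x | apply va_y].
    + intros t x y. pose proof (denominator_pos t x y).
      auto_derive; [simpl in *; lra | field; simpl in *; lra].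
  - exists (fun t x y => / (c t + x ^ 2 + y ^ 2) +
      -2 * (y / (c t + x ^ 2 + y ^ 2) * (y / (c t + x ^ 2 + y ^ 2)))). split.
    + apply (va_plus Tm c); [apply va_inv|].
      apply (va_mult Tm c (fun _ _ _ => -2)); [apply va_const|].
      apply (va_mult Tm c); apply va_y.
    + intros t x y. pose proof (denominator_pos t x y).
      auto_derive; [simpl in *; lra | field; simpl in *; lra].
  - exists (fun t x y => f' t x y + g' t x y). split; [now apply va_plus|].
    intros t x y. now apply (is_derive_plus (fun s => f t x s) (fun s => g t x s)).
  - exists (fun t x y => f' t x y * g t x y + f t x y * g' t x y). split.
    + apply (va_plus Tm c (fun t x y => f' t x y * g t x y)); now apply va_mult.
    + intros t x y. apply (is_derive_mult (fun s => f t x s) (fun s => g t x s)); auto.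
      intros; apply Rmult_comm.
Qed.

Lemma vortex_algebra_bounded_family : bounded_family VA.
Proof.
  intros g Hg. split; [|split; [|split; [|split]]].
  - apply cont3_of_continuous. now apply va_continuous.
  - now apply va_bounded.
  - destruct (va_derive_t g Hg) as (g' & H & E). exists g'. split; [assumption|].
    intros; apply is_derive_Reals, E.
  - destruct (va_derive_x g Hg) as (g' & H & E). exists g'. split; [assumption|].
    intros; apply is_derive_Reals, E.
  - destruct (va_derive_y g Hg) as (g' & H & E). exists g'. split; [assumption|].
    intros; apply is_derive_Reals, E.
Qed.
End VortexAlgebra.

Lemma bounded_family_smooth3 F g : bounded_family F -> F g -> smooth3 g.
Proof.
  intros HF Hg. exists F. split; [assumption|]. clear g Hg. intros g Hg.
  destruct (HF g Hg) as (Hc & _ & (g1 & H1 & E1) & (g2 & H2 & E2) & (g3 & H3 & E3)).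
  repeat split; [exact Hc | exists g1 | exists g2 | exists g3]; auto.
Qed.

(** * The smoothed time profile of the motion *)

Definition rad (e t0 t : R) : R := sqrt ((t0 - t) ^ 2 + e ^ 2).
Definition slope (e t0 t : R) : R := (t0 - t) / rad e t0 t.
(** A smooth version of twice the positive part of [t0 - t], lifted by [e]. It decreases for all
    time, equals [2 e] at [t0] and never drops below [e], so its powers are smooth on the whole line
    and the drift needs no switching off after [t0]. *)
Definition ramp (e t0 t : R) : R := e + (t0 - t) + rad e t0 t.
Definition scale2 (e t0 b t : R) : R := Rpower (ramp e t0 t) b.
Definition dscale2 (e t0 b t : R) : R :=
  - b * (scale2 e t0 b t * ((1 + slope e t0 t) * / ramp e t0 t)).

(** Closed under differentiation, since [rad' = - slope] and [ramp' = - (1 + slope)]. The unbounded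
    [rad] and [ramp] enter only through inverses and the quotient [slope]. *)
Inductive time_algebra (e t0 b : R) : (R -> R) -> Prop :=
| ta_const k : time_algebra e t0 b (fun _ => k)
| ta_irad : time_algebra e t0 b (fun t => / rad e t0 t)
| ta_slope : time_algebra e t0 b (slope e t0)
| ta_iramp : time_algebra e t0 b (fun t => / ramp e t0 t)
| ta_scale2 : time_algebra e t0 b (scale2 e t0 b)
| ta_plus f g : time_algebra e t0 b f -> time_algebra e t0 b g ->
    time_algebra e t0 b (fun t => f t + g t)
| ta_mult f g : time_algebra e t0 b f -> time_algebra e t0 b g ->
    time_algebra e t0 b (fun t => f t * g t).

Section Profile.
Context (e t0 b : R) (He : 0 < e) (Hb : 0 < b).

Lemma rad_spec t : 0 < rad e t0 t /\ rad e t0 t ^ 2 = (t0 - t) ^ 2 + e ^ 2.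
Proof.
  assert (H : 0 < (t0 - t) ^ 2 + e ^ 2) by (pose proof (pow2_ge_0 (t0 - t)); nra).
  split; [now apply sqrt_lt_R0 | apply pow2_sqrt; lra].
Qed.

Lemma rad_ge t : e <= rad e t0 t /\ Rabs (t0 - t) <= rad e t0 t.
Proof.
  destruct (rad_spec t) as [H1 H2]. pose proof (pow2_ge_0 (t0 - t)).
  split; apply Rsqr_incr_0; try lra; try apply Rabs_pos; [|rewrite <- Rsqr_abs]; unfold Rsqr; nra.
Qed.

Lemma slope_bounds t : -1 <= slope e t0 t <= 1.
Proof.
  destruct (rad_spec t) as [H1 _]. destruct (rad_ge t) as [_ H2].
  apply Rabs_le_between in H2. unfold slope, Rdiv.
  split; apply (Rmult_le_reg_r (rad e t0 t)); try assumption;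
    rewrite Rmult_assoc, Rinv_l by lra; lra.
Qed.

Lemma slope_nonneg t : t <= t0 -> 0 <= slope e t0 t.
Proof. intros H. apply Rdiv_le_0_compat; [lra | apply rad_spec]. Qed.

Lemma ramp_ge t : e <= ramp e t0 t.
Proof.
  destruct (rad_ge t) as [_ H]. apply Rabs_le_between in H. unfold ramp. lra.
Qed.

Lemma ramp_le_initial t : 0 <= t -> ramp e t0 t <= ramp e t0 0.
Proof.
  intros Ht. unfold ramp.
  destruct (rad_spec t) as [H1 H2]. destruct (rad_spec 0) as [H3 H4]. destruct (rad_ge 0) as [_ H5].
  apply Rabs_le_between in H5.
  assert (rad e t0 t <= rad e t0 0 + t); [|lra].
  apply Rsqr_incr_0; [|lra..]. unfold Rsqr. nra.
Qed.

Lemma ramp_initial : e <= t0 -> 2 * t0 <= ramp e t0 0 <= 4 * t0.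
Proof.
  intros H. destruct (rad_spec 0) as [H1 H2]. destruct (rad_ge 0) as [_ H5].
  apply Rabs_le_between in H5. unfold ramp.
  assert (rad e t0 0 <= 2 * t0) by (apply Rsqr_incr_0; [|lra..]; unfold Rsqr; nra).
  lra.
Qed.

Lemma ramp_final : ramp e t0 t0 = 2 * e.
Proof.
  unfold ramp, rad. rewrite Rminus_diag. replace (0 ^ 2 + e ^ 2) with (e ^ 2) by ring.
  rewrite sqrt_pow2 by lra. ring.
Qed.

Lemma is_derive_rad t : is_derive (rad e t0) t (- slope e t0 t).
Proof.
  destruct (rad_spec t) as [H1 H2]. unfold rad. auto_derive.
  - simpl in *. nra.
  - unfold slope, rad. replace ((t0 + - t) * ((t0 + - t) * 1) + e * (e * 1)) with ((t0 - t) ^ 2 + e ^ 2) by ring.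
    fold (rad e t0 t). field. lra.
Qed.

Lemma is_derive_ramp t : is_derive (ramp e t0) t (- (1 + slope e t0 t)).
Proof.
  unfold ramp.
  replace (- (1 + slope e t0 t)) with (plus (-1) (- slope e t0 t)) by (unfold plus; simpl; ring).
  apply (is_derive_plus (fun t => e + (t0 - t)) (rad e t0)); [|apply is_derive_rad].
  auto_derive; auto.
Qed.

Lemma is_derive_scale2 t : is_derive (scale2 e t0 b) t (dscale2 e t0 b t).
Proof.
  pose proof (ramp_ge t) as Hr. unfold scale2, Rpower.
  apply (is_derive_ext (fun t => exp (b * ln (ramp e t0 t)))); [reflexivity|].
  evar_last.
  - apply (is_derive_comp exp (fun t => b * ln (ramp e t0 t))); [apply is_derive_exp|].
    apply is_derive_scal. apply (is_derive_comp ln (ramp e t0)); [apply is_derive_ln; lra | apply is_derive_ramp].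
  - unfold dscale2, scale2, Rpower, scal; simpl; unfold mult; simpl. field. lra.
Qed.

Lemma scale2_pos t : 0 < scale2 e t0 b t.
Proof. apply exp_pos. Qed.

Lemma Rpower_le_base x y : 0 < x -> x <= y -> Rpower x b <= Rpower y b.
Proof. intros H1 H2. apply Rle_Rpower_l; lra. Qed.

Lemma scale2_ge t : Rpower e b <= scale2 e t0 b t.
Proof. apply Rpower_le_base; [assumption | apply ramp_ge]. Qed.

Lemma scale2_le_initial t : 0 <= t -> scale2 e t0 b t <= scale2 e t0 b 0.
Proof.
  intros Ht. apply Rpower_le_base; [|now apply ramp_le_initial].
  pose proof (ramp_ge t). lra.
Qed.

Lemma dscale2_in_algebra : time_algebra e t0 b (dscale2 e t0 b).
Proof.
  apply (ta_mult e t0 b (fun _ => - b)); [apply ta_const|].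
  apply (ta_mult e t0 b (scale2 e t0 b)); [apply ta_scale2|].
  apply (ta_mult e t0 b (fun t => 1 + slope e t0 t)); [|apply ta_iramp].
  apply (ta_plus e t0 b (fun _ => 1)); [apply ta_const | apply ta_slope].
Qed.

Lemma time_algebra_bounded : bounded_time_family (time_algebra e t0 b).
Proof.
  intros f Hf. induction Hf as [k| | | | |f g Hf [[M IHf] (f' & Hf' & Ef)] Hg [[N IHg] (g' & Hg' & Eg)]
    |f g Hf [[M IHf] (f' & Hf' & Ef)] Hg [[N IHg] (g' & Hg' & Eg)]]; split.
  - exists (Rabs k). intros; apply Rle_refl.
  - exists (fun _ => 0). split; [apply ta_const | intros; apply (is_derive_const k)].
  - exists (/ e). intros t _. destruct (rad_spec t). destruct (rad_ge t).
    rewrite Rabs_pos_eq by (left; now apply Rinv_0_lt_compat). now apply Rinv_le_contravar.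
  - exists (fun t => slope e t0 t * (/ rad e t0 t * / rad e t0 t)). split.
    + apply ta_mult; [apply ta_slope | apply ta_mult; apply ta_irad].
    + intros t. destruct (rad_spec t). evar_last.
      * apply (is_derive_inv (rad e t0)); [apply is_derive_rad | lra].
      * field. lra.
  - exists 1. intros t _. apply Rabs_le. apply slope_bounds.
  - exists (fun t => -1 * / rad e t0 t + slope e t0 t * (slope e t0 t * / rad e t0 t)). split.
    + apply ta_plus; [apply ta_mult; [apply ta_const | apply ta_irad]|].
      apply ta_mult; [apply ta_slope|]. apply ta_mult; [apply ta_slope | apply ta_irad].
    + intros t. destruct (rad_spec t). unfold slope at 1. evar_last.
      * apply (is_derive_div (fun t => t0 - t) (rad e t0)); [auto_derive; auto | apply is_derive_rad | lra].
      * unfold slope. field. lra.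
  - exists (/ e). intros t _. pose proof (ramp_ge t).
    rewrite Rabs_pos_eq by (left; apply Rinv_0_lt_compat; lra). now apply Rinv_le_contravar.
  - exists (fun t => (1 + slope e t0 t) * (/ ramp e t0 t * / ramp e t0 t)). split.
    + apply ta_mult; [apply ta_plus; [apply ta_const | apply ta_slope]|].
      apply ta_mult; apply ta_iramp.
    + intros t. pose proof (ramp_ge t). evar_last.
      * apply (is_derive_inv (ramp e t0)); [apply is_derive_ramp | lra].
      * field. lra.
  - exists (scale2 e t0 b 0). intros t Ht. rewrite Rabs_pos_eq by (left; apply scale2_pos).
    now apply scale2_le_initial.
  - exists (dscale2 e t0 b). split; [apply dscale2_in_algebra | apply is_derive_scale2].
  - exists (M + N). intros t Ht. eapply Rle_trans; [apply Rabs_triang|].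
    apply Rplus_le_compat; auto.
  - exists (fun t => f' t + g' t). split; [now apply ta_plus|].
    intros t. now apply (is_derive_plus f g).
  - exists (M * N). intros t Ht. rewrite Rabs_mult. apply Rmult_le_compat; auto using Rabs_pos.
  - exists (fun t => f' t * g t + f t * g' t). split.
    + apply ta_plus; now apply ta_mult.
    + intros t. apply (is_derive_mult f g); auto. intros; apply Rmult_comm.
Qed.
End Profile.

(** With [drift_y], the rotated gradient of the stream function [2048 P' P^3 x y / d^4], where
    [d = 7 P + x^2 + y^2]. At [(z, 0)] with [z^2 = P] one has [d = 8 P]: then [2048 = 8^4 / 2] makes
    the velocity [P' / (2 z) = z'], and the 7 makes the gradient vanish, because
    [1 / d^4 - 8 x^2 / d^5] is zero where [d = 8 x^2]. *)
Definition drift_x (P dP : R -> R) (t x y : R) : R :=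
  2048 * dP t * P t ^ 3 * (x / (7 * P t + x ^ 2 + y ^ 2) ^ 4
    - 8 * x * y ^ 2 / (7 * P t + x ^ 2 + y ^ 2) ^ 5).

Definition drift_y (P dP : R -> R) (t x y : R) : R :=
  - (2048 * dP t * P t ^ 3 * (y / (7 * P t + x ^ 2 + y ^ 2) ^ 4
    - 8 * x ^ 2 * y / (7 * P t + x ^ 2 + y ^ 2) ^ 5)).

Lemma drift_in_algebra Tm P dP : (forall k, Tm (fun _ : R => k)) -> (forall t, 0 < P t) ->
  Tm P -> Tm dP ->
  vortex_algebra Tm (fun t => 7 * P t) (drift_x P dP) /\
  vortex_algebra Tm (fun t => 7 * P t) (drift_y P dP).
Proof.
  intros Hk HP HTP HTd.
  set (VA := vortex_algebra Tm (fun t => 7 * P t)).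
  set (d := fun t x y : R => 7 * P t + x ^ 2 + y ^ 2).
  assert (Hd : forall t x y, 0 < d t x y) by (intros t x y; unfold d; pose proof (HP t); nra).
  assert (Hi : VA (fun t x y => / d t x y)) by apply va_inv.
  assert (Ha : VA (fun t x y => x / d t x y)) by apply va_x.
  assert (Hb : VA (fun t x y => y / d t x y)) by apply va_y.
  assert (Hc : forall k, VA (fun _ _ _ => k)) by (intros k; exact (va_time _ _ _ (Hk k))).
  assert (Ht : VA (fun t _ _ => P t)) by exact (va_time _ _ _ HTP).
  assert (Ht' : VA (fun t _ _ => dP t)) by exact (va_time _ _ _ HTd).
  pose proof (va_plus Tm (fun t => 7 * P t)) as Pl. pose proof (va_mult Tm (fun t => 7 * P t)) as Mu.
  fold VA in Pl, Mu.
  pose proof (Mu _ _ (Hc 2048) (Mu _ _ Ht' (Mu _ _ Ht (Mu _ _ Ht Ht)))) as Pre.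
  pose proof (Mu _ _ Hi Hi) as Hi2.
  split.
  - apply (va_ext Tm (fun t => 7 * P t) _ _ (Mu _ _ Pre (Pl _ _ (Mu _ _ Ha (Mu _ _ Hi Hi2))
      (Mu _ _ (Hc (-8)) (Mu _ _ Ha (Mu _ _ Hb (Mu _ _ Hb Hi2))))))).
    intros t x y. specialize (Hd t x y). unfold drift_x. unfold d in *. field. lra.
  - apply (va_ext Tm (fun t => 7 * P t) _ _ (Mu _ _ Pre (Pl _ _ (Mu _ _ (Hc (-1)) (Mu _ _ Hb (Mu _ _ Hi Hi2)))
      (Mu _ _ (Hc 8) (Mu _ _ Ha (Mu _ _ Ha (Mu _ _ Hb Hi2))))))).
    intros t x y. specialize (Hd t x y). unfold drift_y. unfold d in *. field. lra.
Qed.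

Lemma drift_div_free P dP : (forall t, 0 < P t) -> div_free (drift_x P dP) (drift_y P dP).
Proof.
  intros HP t x y _.
  assert (Hd : 0 < 7 * P t + x ^ 2 + y ^ 2) by (pose proof (HP t); nra).
  set (d := 7 * P t + x ^ 2 + y ^ 2) in *.
  set (a := 2048 * dP t * P t ^ 3 *
    (/ d ^ 4 - 8 * x ^ 2 / d ^ 5 - 8 * y ^ 2 / d ^ 5 + 80 * x ^ 2 * y ^ 2 / d ^ 6)).
  exists a, (- a).
  assert (Hp : forall n, d ^ n <> 0) by (intros n; apply pow_nonzero; lra).
  split; [|split; [|ring]]; apply is_derive_Reals.
  - unfold drift_x. auto_derive.
    + change (x * (x * 1)) with (x ^ 2). change (y * (y * 1)) with (y ^ 2).
      fold d. split; [apply (Hp 4%nat) | split; [apply (Hp 5%nat) | exact I]].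
    + change (x * (x * 1)) with (x ^ 2). change (y * (y * 1)) with (y ^ 2). fold d.
      unfold a. field. lra.
  - unfold drift_y. auto_derive.
    + change (x * (x * 1)) with (x ^ 2). change (y * (y * 1)) with (y ^ 2).
      fold d. split; [apply (Hp 4%nat) | split; [apply (Hp 5%nat) | exact I]].
    + change (x * (x * 1)) with (x ^ 2). change (y * (y * 1)) with (y ^ 2). fold d.
      unfold a. field. lra.
Qed.

(** * Estimates for the vortex dipole *)

(** Writing [d = 8 + e] with [e = 2 X + r], the constant terms cancel by [4096 * 8 = 8^5], and the
    linear ones leave [32768 X - 16384 e = - 16384 r]. The remainder is quadratic:
    [160000 r / 20 + 4000 r] stays below half of [28000 r], and [d^5 >= 28000]. *)
Lemma vortex_core_polynomial X Y d : X ^ 2 + Y ^ 2 <= / 400 -> d = 7 + (1 + X) ^ 2 + Y ^ 2 ->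
  Rabs (X * (4096 * (1 + X) * (d - 8 * Y ^ 2) - d ^ 5) - Y ^ 2 * (4096 * (d - 8 * (1 + X) ^ 2)))
    <= d ^ 5 * (X ^ 2 + Y ^ 2) / 2.
Proof.
  intros Hr Hd. set (r := X ^ 2 + Y ^ 2) in *.
  assert (HX : - / 20 <= X <= / 20) by (unfold r in Hr; split; nra).
  assert (HX2 : 0 <= X ^ 2 <= r) by (unfold r; split; nra).
  assert (HY2 : 0 <= Y ^ 2 <= r) by (unfold r; split; nra).
  set (e := 2 * X + r).
  assert (He : - / 8 <= e <= / 8) by (unfold e; lra).
  assert (Hde : d = 8 + e) by (unfold e, r; rewrite Hd; ring).
  assert (E2 : 0 <= e ^ 2 <= 9 * r).
  { split; [nra|]. assert (e ^ 2 <= 8 * X ^ 2 + 2 * r ^ 2) by (unfold e; pose proof (pow2_ge_0 (2 * X - r)); nra).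
    assert (r ^ 2 <= / 400 * r) by nra. lra. }
  assert (E3 : - (9 * r) <= e ^ 3 <= 9 * r).
  { replace (e ^ 3) with (e * e ^ 2) by ring. split; nra. }
  assert (E4 : 0 <= e ^ 4 <= 9 * r).
  { replace (e ^ 4) with (e ^ 2 * e ^ 2) by ring. split; nra. }
  assert (E5 : - (9 * r) <= e ^ 5 <= 9 * r).
  { replace (e ^ 5) with (e * e ^ 4) by ring. split; nra. }
  assert (EX : - (3 * r) <= X * e <= 3 * r).
  { unfold e. replace (X * (2 * X + r)) with (2 * X ^ 2 + X * r) by ring. split; nra. }
  set (n1 := 4096 * (1 + X) * (d - 8 * Y ^ 2) - d ^ 5).
  assert (HN1 : n1 = - 16384 * r - 32768 * (Y ^ 2 * (1 + X)) + 4096 * (X * e) - 5120 * e ^ 2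
    - 640 * e ^ 3 - 40 * e ^ 4 - e ^ 5).
  { unfold n1. rewrite Hde. unfold e, r. ring. }
  assert (HY : 0 <= Y ^ 2 * (1 + X) <= 2 * r) by (split; nra).
  assert (B1 : Rabs n1 <= 160000 * r) by (apply Rabs_le; rewrite HN1; split; lra).
  assert (B2 : Rabs (4096 * (d - 8 * (1 + X) ^ 2)) <= 4000).
  { replace (d - 8 * (1 + X) ^ 2) with (- 14 * X - 8 * X ^ 2 + r) by (rewrite Hd; unfold r; ring).
    apply Rabs_le. split; lra. }
  assert (Hd5 : 28000 <= d ^ 5).
  { assert (78 / 10 <= d) by (rewrite Hde; unfold e; lra).
    apply Rle_trans with ((78 / 10) ^ 5); [lra|]. apply pow_incr. lra. }
  eapply Rle_trans; [apply Rabs_triang|]. rewrite Rabs_Ropp, (Rabs_mult X), (Rabs_mult (Y ^ 2)).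
  rewrite (Rabs_pos_eq (Y ^ 2)) by apply HY2.
  assert (Rabs X <= / 20) by (apply Rabs_le; lra).
  assert (Rabs X * Rabs n1 <= / 20 * (160000 * r))
    by (apply Rmult_le_compat; auto using Rabs_pos).
  assert (Y ^ 2 * Rabs (4096 * (d - 8 * (1 + X) ^ 2)) <= r * 4000)
    by (apply Rmult_le_compat; auto using Rabs_pos; apply HY2).
  assert (28000 * r <= d ^ 5 * r) by (apply Rmult_le_compat_r; lra).
  lra.
Qed.

(** [dP / (2 z)] is the speed of the centre, so the left side is the rate at which the flow changes
    half the squared distance to the moving centre. Scaling lengths by [z] reduces the bound to the
    polynomial one. *)
Lemma vortex_core P dP t x y z : 0 < z -> z ^ 2 = P t ->
  400 * ((x - z) ^ 2 + y ^ 2) <= P t ->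
  Rabs ((x - z) * (drift_x P dP t x y - dP t / (2 * z)) + y * drift_y P dP t x y)
    <= Rabs (dP t) * ((x - z) ^ 2 + y ^ 2) / (4 * P t).
Proof.
  intros Hz HP Hr. set (X := (x - z) / z). set (Y := y / z).
  assert (Ex : x = z * (1 + X)) by (unfold X; field; lra).
  assert (Ey : y = z * Y) by (unfold Y; field; lra).
  assert (Hr' : X ^ 2 + Y ^ 2 <= / 400).
  { apply (Rmult_le_reg_l (z ^ 2)); [nra|].
    replace (z ^ 2 * (X ^ 2 + Y ^ 2)) with ((x - z) ^ 2 + y ^ 2) by (unfold X, Y; field; lra).
    lra. }
  pose proof (vortex_core_polynomial X Y _ Hr' eq_refl) as H.
  set (d := 7 + (1 + X) ^ 2 + Y ^ 2) in *.
  assert (Hd : 0 < d) by (unfold d; nra).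
  assert (ED : 7 * P t + x ^ 2 + y ^ 2 = z ^ 2 * d) by (rewrite <- HP, Ex, Ey; unfold d; ring).
  set (N := X * (4096 * (1 + X) * (d - 8 * Y ^ 2) - d ^ 5) - Y ^ 2 * (4096 * (d - 8 * (1 + X) ^ 2))) in *.
  replace ((x - z) * (drift_x P dP t x y - dP t / (2 * z)) + y * drift_y P dP t x y)
    with (dP t / 2 * (N / d ^ 5)).
  - rewrite Rabs_mult. unfold Rdiv at 1 2. rewrite !Rabs_mult, (Rabs_pos_eq (/ 2)) by lra.
    assert (Hd5 : 0 < d ^ 5) by now apply pow_lt.
    rewrite (Rabs_pos_eq (/ d ^ 5)) by (left; now apply Rinv_0_lt_compat).
    replace (Rabs (dP t) * ((x - z) ^ 2 + y ^ 2) / (4 * P t)) with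
      (Rabs (dP t) * / 2 * ((X ^ 2 + Y ^ 2) / 2)) by (rewrite <- HP; unfold X, Y; field; lra).
    apply Rmult_le_compat_l; [pose proof (Rabs_pos (dP t)); lra|].
    apply (Rmult_le_reg_r (d ^ 5)); [assumption|].
    rewrite Rmult_assoc, Rinv_l, Rmult_1_r by lra. lra.
  - unfold drift_x, drift_y. rewrite ED. unfold N. rewrite <- HP, Ex, Ey. field. lra.
Qed.

(** Here [14336 = 7 * 2048]: the factors [1 - 8 w / d] with [0 <= w <= d] lie between -7 and 1.
    Replacing [d] by the smaller [P + x^2 + y^2] leaves a single quantity to compare with the
    density. *)
Lemma drift_norm_le P dP t x y : 0 < P t ->
  norm2 (drift_x P dP t x y) (drift_y P dP t x y) <=
    14336 * Rabs (dP t) * P t ^ 3 * (sqrt (P t + x ^ 2 + y ^ 2) / (P t + x ^ 2 + y ^ 2) ^ 4).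
Proof.
  intros HP. set (Q := P t + x ^ 2 + y ^ 2). set (d := 7 * P t + x ^ 2 + y ^ 2).
  assert (HQ : 0 < Q) by (unfold Q; nra). assert (HQd : Q <= d) by (unfold Q, d; lra).
  assert (Hd : 0 < d) by lra.
  set (k := 2048 * dP t * P t ^ 3 / d ^ 4).
  assert (Hn : forall n, 0 < d ^ n) by (intros; now apply pow_lt).
  assert (B : forall w, 0 <= w <= d -> (1 - 8 * w / d) ^ 2 <= 49).
  { intros w Hw. assert (0 <= w / d <= 1).
    { split; [apply Rdiv_le_0_compat; lra|]. apply (Rmult_le_reg_r d); [assumption|].
      unfold Rdiv. rewrite Rmult_assoc, Rinv_l; lra. }
    replace (8 * w / d) with (8 * (w / d)) by (field; lra). nra. }
  assert (E1 : drift_x P dP t x y = k * (x * (1 - 8 * y ^ 2 / d))).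
  { unfold drift_x. fold d. unfold k. field. lra. }
  assert (E2 : drift_y P dP t x y = k * - (y * (1 - 8 * x ^ 2 / d))).
  { unfold drift_y. fold d. unfold k. field. lra. }
  assert (Hk : Rabs k = 2048 * Rabs (dP t) * P t ^ 3 / d ^ 4).
  { unfold k, Rdiv. rewrite !Rabs_mult, (Rabs_pos_eq 2048), (Rabs_pos_eq (P t ^ 3)), (Rabs_pos_eq (/ d ^ 4));
      [ring | left; apply Rinv_0_lt_compat, Hn | left; now apply pow_lt | lra]. }
  apply Rle_trans with (7 * Rabs k * sqrt Q).
  - unfold norm2. apply Rsqr_incr_0.
    + rewrite Rsqr_sqrt by nra.
      replace (Rsqr (7 * Rabs k * sqrt Q)) with (49 * (Rabs k * Rabs k) * (sqrt Q * sqrt Q))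
        by (unfold Rsqr; ring).
      rewrite sqrt_sqrt by lra. rewrite <- Rabs_mult, (Rabs_pos_eq (k * k)) by nra.
      rewrite E1, E2.
      replace (k * (x * (1 - 8 * y ^ 2 / d)) * (k * (x * (1 - 8 * y ^ 2 / d))) +
        k * - (y * (1 - 8 * x ^ 2 / d)) * (k * - (y * (1 - 8 * x ^ 2 / d)))) with
        (k * k * (x ^ 2 * (1 - 8 * y ^ 2 / d) ^ 2 + y ^ 2 * (1 - 8 * x ^ 2 / d) ^ 2)) by ring.
      replace (49 * (k * k) * Q) with (k * k * (49 * Q)) by ring.
      apply Rmult_le_compat_l; [nra|].
      assert (Bx := B (x ^ 2) ltac:(unfold d; nra)). assert (By := B (y ^ 2) ltac:(unfold d; nra)).
      apply (Rmult_le_compat_l (y ^ 2)) in Bx; [|nra]. apply (Rmult_le_compat_l (x ^ 2)) in By; [|nra].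
      unfold Q. lra.
    + apply sqrt_pos.
    + apply Rmult_le_pos; [pose proof (Rabs_pos k); lra | apply sqrt_pos].
  - rewrite Hk.
    assert (Hi : / d ^ 4 <= / Q ^ 4) by (apply Rinv_le_contravar; [now apply pow_lt | apply pow_incr; lra]).
    assert (0 <= Rabs (dP t) * P t ^ 3 * sqrt Q).
    { apply Rmult_le_pos; [apply Rmult_le_pos; [apply Rabs_pos | left; now apply pow_lt] | apply sqrt_pos]. }
    replace (7 * (2048 * Rabs (dP t) * P t ^ 3 / d ^ 4) * sqrt Q) with
      (14336 * (Rabs (dP t) * P t ^ 3 * sqrt Q) * / d ^ 4) by (unfold Rdiv; ring).
    replace (14336 * Rabs (dP t) * P t ^ 3 * (sqrt Q / Q ^ 4)) with
      (14336 * (Rabs (dP t) * P t ^ 3 * sqrt Q) * / Q ^ 4) by (unfold Rdiv; ring).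
    apply Rmult_le_compat_l; lra.
Qed.

(** The weighted geometric mean of the bounded profiles [x / sqrt(x^2 + m)] and [x / sqrt(x^2 + d)],
    with weights [a] and [1 - a]. Its derivative behaves like [|x|^(- a)] between the scales
    [sqrt m] and [sqrt d], and like [|x|^(-3)] far away. *)
Definition tensor_primitive (a m d x : R) : R :=
  x * exp (- (a / 2) * ln (x ^ 2 + m) - (1 - a) / 2 * ln (x ^ 2 + d)).

Definition tensor_density (a m d x : R) : R :=
  exp (- (a / 2) * ln (x ^ 2 + m) - (1 - a) / 2 * ln (x ^ 2 + d)) *
  (a * m / (x ^ 2 + m) + (1 - a) * d / (x ^ 2 + d)).

Lemma is_derive_tensor_primitive a m d x : 0 < m -> 0 < d ->
  is_derive (tensor_primitive a m d) x (tensor_density a m d x).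
Proof.
  intros Hm Hd. assert (0 < x ^ 2 + m) by nra. assert (0 < x ^ 2 + d) by nra.
  unfold tensor_primitive. auto_derive.
  - simpl in *. repeat split; lra.
  - unfold tensor_density. unfold Rminus.
    change (x * (x * 1)) with (x ^ 2). rewrite !Rmult_1_l.
    match goal with |- context [exp ?u] => set (E := exp u) end.
    field. lra.
Qed.

Lemma ln_le_ln x y : 0 < x -> x <= y -> ln x <= ln y.
Proof. intros Hx [H| ->]; [left; now apply ln_increasing | apply Rle_refl]. Qed.

Lemma tensor_primitive_bounds a m d x : 0 < a < 1 -> 0 < m <= d ->
  -1 <= tensor_primitive a m d x <= 1.
Proof.
  intros Ha Hm. unfold tensor_primitive.
  assert (H1 : 0 < x ^ 2 + m) by nra.
  assert (H2 : ln (x ^ 2 + m) <= ln (x ^ 2 + d)) by (apply ln_le_ln; lra).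
  set (E := exp (- (a / 2) * ln (x ^ 2 + m) - (1 - a) / 2 * ln (x ^ 2 + d))).
  assert (HE0 : 0 < E) by apply exp_pos.
  assert (HE : E * E <= / (x ^ 2 + m)).
  { unfold E. rewrite <- exp_plus, <- (exp_ln (/ (x ^ 2 + m))) by now apply Rinv_0_lt_compat.
    rewrite ln_Rinv by assumption. apply exp_le_exp. nra. }
  assert (HxE : (x * E) ^ 2 <= 1).
  { replace ((x * E) ^ 2) with (x ^ 2 * (E * E)) by ring.
    apply Rle_trans with (x ^ 2 * / (x ^ 2 + m)); [apply Rmult_le_compat_l; [nra | assumption]|].
    apply (Rmult_le_reg_r (x ^ 2 + m)); [assumption|]. rewrite Rmult_assoc, Rinv_l by lra. lra. }
  split; nra.
Qed.

(** One fixed density dominates the vortex profile at every scale [P] between [m] and [d], which is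
    how the supremum in time is absorbed. Only the term with [d] is kept; then [x^2 + m <= Q] and
    [x^2 + d <= (d / P) Q] give the power of [Q]. *)
Lemma tensor_density_ge a m d P Q x : 0 < a < 1 -> 0 < m -> m <= P -> P <= d -> P + x ^ 2 <= Q ->
  (1 - a) * exp (- ((1 - a) / 2) * ln d + (3 - a) / 2 * ln P - 3 / 2 * ln Q) <= tensor_density a m d x.
Proof.
  intros Ha Hm HmP HPd HQ. unfold tensor_density.
  assert (H1 : 0 < x ^ 2 + m) by nra. assert (H2 : 0 < x ^ 2 + d) by nra.
  assert (HQ0 : 0 < Q) by nra.
  assert (L1 : ln (x ^ 2 + m) <= ln Q) by (apply ln_le_ln; lra).
  assert (L2 : ln (x ^ 2 + d) <= ln d - ln P + ln Q).
  { replace (ln d - ln P + ln Q) with (ln (d * / P * Q)).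
    - apply ln_le_ln; [assumption|]. apply (Rmult_le_reg_l P); [lra|].
      replace (P * (d * / P * Q)) with (d * Q) by (field; lra). nra.
    - assert (0 < / P) by (apply Rinv_0_lt_compat; lra).
      rewrite !ln_mult, ln_Rinv; try lra. apply Rmult_lt_0_compat; lra. }
  set (E := exp (- (a / 2) * ln (x ^ 2 + m) - (1 - a) / 2 * ln (x ^ 2 + d))).
  assert (HE0 : 0 < E) by apply exp_pos.
  apply Rle_trans with (E * ((1 - a) * (d / (x ^ 2 + d)))).
  - rewrite (Rmult_comm E), Rmult_assoc. apply Rmult_le_compat_l; [lra|].
    replace (d / (x ^ 2 + d)) with (exp (ln d - ln (x ^ 2 + d))).
    + unfold E. rewrite <- exp_plus. apply exp_le_exp. nra.
    + unfold Rminus. rewrite exp_plus, exp_Ropp, !exp_ln by lra. reflexivity.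
  - apply Rmult_le_compat_l; [lra|].
    assert (0 <= a * m / (x ^ 2 + m)) by (apply Rdiv_le_0_compat; nra).
    unfold Rdiv in *. lra.
Qed.

(* In logarithms the choice a = (1/2 + gam) p makes the powers of P on both
   sides agree. *)
Lemma drift_power_le P dP t x y p gam a m d : 1 <= p < 2 -> a = (1 / 2 + gam) * p -> 0 < a < 1 ->
  0 < m -> m <= P t -> P t <= d -> Rabs (dP t) <= 2 * exp (- gam * ln (P t)) ->
  0 < norm2 (drift_x P dP t x y) (drift_y P dP t x y) ->
  Rpower (norm2 (drift_x P dP t x y) (drift_y P dP t x y)) p <=
    exp (p * ln 28672 + (1 - a) * ln d) / (1 - a) ^ 2 * (tensor_density a m d x * tensor_density a m d y).
Proof.
  intros Hp Ha Ha01 Hm HmP HPd HdP Hn.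
  assert (HP : 0 < P t) by lra.
  pose proof (drift_norm_le P dP t x y HP) as HN.
  set (N := norm2 (drift_x P dP t x y) (drift_y P dP t x y)) in *.
  set (Q := P t + x ^ 2 + y ^ 2) in *.
  assert (HQ : 0 < Q) by (unfold Q; nra). assert (HPQ : P t <= Q) by (unfold Q; nra).
  assert (LPQ : ln (P t) <= ln Q) by now apply ln_le_ln.
  assert (HN2 : N <= exp (ln 28672 + (3 - gam) * ln (P t) - 7 / 2 * ln Q)).
  { eapply Rle_trans; [exact HN|].
    assert (HP3 : 0 < P t ^ 3) by now apply pow_lt.
    assert (HQ4 : 0 < Q ^ 4) by now apply pow_lt.
    assert (HsQ : 0 <= sqrt Q / Q ^ 4) by (apply Rdiv_le_0_compat; [apply sqrt_pos | assumption]).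
    apply Rle_trans with (14336 * (2 * exp (- gam * ln (P t))) * P t ^ 3 * (sqrt Q / Q ^ 4)).
    - apply Rmult_le_compat_r; [assumption|]. apply Rmult_le_compat_r; lra.
    - apply Req_le.
      replace (ln 28672 + (3 - gam) * ln (P t) - 7 / 2 * ln Q) with
        (ln 28672 + (- gam * ln (P t)) + 3 * ln (P t) + (/ 2 * ln Q + - (4 * ln Q))) by lra.
      rewrite !exp_plus, exp_Ropp, exp_ln by lra.
      replace (exp (3 * ln (P t))) with (P t ^ 3).
      2: { rewrite <- (Rpower_pow 3) by assumption. unfold Rpower. simpl INR. f_equal. ring. }
      replace (exp (4 * ln Q)) with (Q ^ 4).
      2: { rewrite <- (Rpower_pow 4) by assumption. unfold Rpower. simpl INR. f_equal. ring. }
      replace (exp (/ 2 * ln Q)) with (sqrt Q) by (rewrite <- Rpower_sqrt by assumption; reflexivity).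
      unfold Rdiv. ring. }
  assert (LN : ln N <= ln 28672 + (3 - gam) * ln (P t) - 7 / 2 * ln Q).
  { rewrite <- (ln_exp (ln 28672 + (3 - gam) * ln (P t) - 7 / 2 * ln Q)). now apply ln_le_ln. }
  pose proof (tensor_density_ge a m d (P t) Q x Ha01 Hm HmP HPd ltac:(unfold Q; nra)) as Tx.
  pose proof (tensor_density_ge a m d (P t) Q y Ha01 Hm HmP HPd ltac:(unfold Q; nra)) as Ty.
  set (G := exp (- ((1 - a) / 2) * ln d + (3 - a) / 2 * ln (P t) - 3 / 2 * ln Q)) in *.
  assert (HG : 0 < G) by apply exp_pos.
  assert (HC : 0 < exp (p * ln 28672 + (1 - a) * ln d) / (1 - a) ^ 2).
  { apply Rdiv_lt_0_compat; [apply exp_pos|]. apply pow_lt. lra. }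
  apply Rle_trans with (exp (p * ln 28672 + (1 - a) * ln d) / (1 - a) ^ 2 * ((1 - a) * G * ((1 - a) * G))).
  - replace (exp (p * ln 28672 + (1 - a) * ln d) / (1 - a) ^ 2 * ((1 - a) * G * ((1 - a) * G))) with
      (exp (p * ln 28672 + (1 - a) * ln d) * (G * G)) by (field; lra).
    unfold G. rewrite <- !exp_plus. unfold Rpower. apply exp_le_exp.
    apply (Rmult_le_compat_l p) in LN; [|lra].
    (* After the powers of [d] cancel, the claim is [P^(7p/2 - 3) <= Q^(7p/2 - 3)]; the exponent is
       positive because [p >= 1]. *)
    apply (Rmult_le_compat_l (7 / 2 * p - 3)) in LPQ; [|lra].
    rewrite Ha. lra.
  - apply Rmult_le_compat_l; [lra|]. apply Rmult_le_compat; auto; nra.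
Qed.

(** * Initial datum and barrier *)

Definition dipole (k x y : R) : R := k * (x / (1 + x ^ 2 + y ^ 2)).

Definition constant_fun (f : R -> R) : Prop := exists k, f = (fun _ => k).

Lemma constant_fun_bounded : bounded_time_family constant_fun.
Proof.
  intros f [k ->]. split.
  - exists (Rabs k). intros; apply Rle_refl.
  - exists (fun _ => 0). split; [now exists 0 | intros; apply (is_derive_const k)].
Qed.

(** The datum is a vortex function of constant scale 1, so the machinery built for the drift also
    bounds all its derivatives. *)
Lemma dipole_family k : exists F, bounded_family F /\ F (fun _ => dipole k).
Proof.
  assert (Hk : forall k, constant_fun (fun _ => k)) by (intros c; now exists c).
  exists (vortex_algebra constant_fun (fun _ => 1)). split.
  - apply (vortex_algebra_bounded_family constant_fun constant_fun_bounded Hk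
      (fun _ => 1) (fun _ => 0) 1); try (intros; lra).
    + apply Hk.
    + intros t. apply (is_derive_const 1).
  - apply (va_mult constant_fun (fun _ => 1) (fun _ _ _ => k) (fun _ x y => x / (1 + x ^ 2 + y ^ 2))).
    + exact (va_time _ _ _ (Hk k)).
    + exact (va_x constant_fun (fun _ => 1)).
Qed.

Lemma dipole_Bd k n : exists M, Bd n M (dipole k).
Proof.
  destruct (dipole_family k) as (F & HF & H).
  destruct (family_Bd F HF n _ H) as [M HM]. exists M. exact (HM 0 (Rle_refl 0)).
Qed.

Lemma dipole_smooth2 k : smooth2 (dipole k).
Proof.
  destruct (dipole_family k) as (F & HF & H).
  exists (fun h => exists g, F g /\ h = g 0). split; [now exists (fun _ => dipole k)|].
  intros h (g & Hg & ->).
  destruct (HF g Hg) as (Hc & _ & _ & (g2 & H2 & E2) & (g3 & H3 & E3)). repeat split.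
  - intros x y eps He. destruct (Hc 0 x y I eps He) as (d & Hd & Hd'). exists d.
    split; [assumption|]. intros x' y' Hx Hy. apply Hd'; auto.
    now rewrite Rminus_diag, Rabs_R0.
  - exists (g2 0). split; [now exists g2 | intros; apply E2].
  - exists (g3 0). split; [now exists g3 | intros; apply E3].
Qed.

Lemma dipole_C2_norm : C2_norm_le (dipole (/ 20)) 1.
Proof.
  set (i := fun x y : R => / (1 + x ^ 2 + y ^ 2)).
  set (a := fun x y : R => x / (1 + x ^ 2 + y ^ 2)).
  set (b := fun x y : R => y / (1 + x ^ 2 + y ^ 2)).
  assert (Hd : forall x y : R, 0 < 1 + x ^ 2 + y ^ 2) by (intros; nra).
  assert (Hi : forall x y, Rabs (i x y) <= 1).
  { intros x y. unfold i. rewrite Rabs_pos_eq by (left; apply Rinv_0_lt_compat, Hd).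
    specialize (Hd x y). apply (Rmult_le_reg_r (1 + x ^ 2 + y ^ 2)); [assumption|].
    rewrite Rinv_l by lra. nra. }
  assert (Hz : forall x y z, z ^ 2 <= x ^ 2 + y ^ 2 -> Rabs (z / (1 + x ^ 2 + y ^ 2)) <= / 2).
  { intros x y z Hz. specialize (Hd x y). unfold Rdiv.
    rewrite Rabs_mult, (Rabs_pos_eq (/ _)) by (left; now apply Rinv_0_lt_compat).
    apply (Rmult_le_reg_r (1 + x ^ 2 + y ^ 2)); [assumption|]. rewrite Rmult_assoc, Rinv_l by lra.
    pose proof (pow2_ge_0 (1 - z)). pose proof (pow2_ge_0 (1 + z)).
    unfold Rabs. destruct Rcase_abs; lra. }
  assert (Ha : forall x y, Rabs (a x y) <= / 2) by (intros; apply Hz; nra).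
  assert (Hb : forall x y, Rabs (b x y) <= / 2) by (intros; apply Hz; nra).
  exists (fun x y => / 20 * (i x y - 2 * a x y ^ 2)), (fun x y => / 20 * (- 2 * a x y * b x y)),
    (fun x y => / 20 * (- 6 * a x y * i x y + 8 * a x y ^ 3)),
    (fun x y => / 20 * (- 2 * b x y * i x y + 8 * a x y ^ 2 * b x y)),
    (fun x y => / 20 * (- 2 * a x y * i x y + 8 * a x y * b x y ^ 2)).
  repeat split.
  1-5: intros x y; pose proof (Hd x y); apply is_derive_Reals; unfold dipole, i, a, b;
    auto_derive; [simpl in *; repeat split; try lra; auto | field; simpl in *; lra].
  (* Every derivative is a polynomial in [i], [a], [b], with [|i| <= 1] and [|a|, |b| <= 1/2]; these
     bounds sum to 21/40. *)
  exists (/ 40), (3 / 40), (/ 40), (8 / 40), (4 / 40), (4 / 40). split; [lra|].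
  intros x y. specialize (Hi x y). specialize (Ha x y). specialize (Hb x y).
  unfold dipole. fold (a x y).
  apply Rabs_le_between in Hi. apply Rabs_le_between in Ha. apply Rabs_le_between in Hb.
  set (u := a x y) in *. set (v := b x y) in *. set (w := i x y) in *.
  assert (U2 : 0 <= u ^ 2 <= / 4) by (split; nra). assert (V2 : 0 <= v ^ 2 <= / 4) by (split; nra).
  assert (UV : - / 4 <= u * v <= / 4) by (split; nra).
  assert (UW : - / 2 <= u * w <= / 2) by (split; nra).
  assert (VW : - / 2 <= v * w <= / 2) by (split; nra).
  assert (U3 : - / 8 <= u ^ 3 <= / 8) by (replace (u ^ 3) with (u * u ^ 2) by ring; split; nra).
  assert (UUV : - / 8 <= u ^ 2 * v <= / 8) by (split; nra).
  assert (UVV : - / 8 <= u * v ^ 2 <= / 8) by (split; nra).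
  repeat split; apply Rabs_le; split; nra.
Qed.

(** * Residuals and the odd part of a solution *)

Definition has_residual (v u1 u2 : R -> R -> R -> R) (t x y r : R) : Prop :=
  exists vt (dx dy : R -> R) vxx vyy,
    is_derive (fun s => v s x y) t vt /\
    (forall s, is_derive (fun z => v t z y) s (dx s)) /\
    (forall s, is_derive (fun z => v t x z) s (dy s)) /\
    is_derive dx x vxx /\ is_derive dy y vyy /\
    r = vt + u1 t x y * dx x + u2 t x y * dy y - (vxx + vyy).

Lemma has_residual_minus v w u1 u2 t x y r r' : has_residual v u1 u2 t x y r ->
  has_residual w u1 u2 t x y r' -> has_residual (fun t x y => v t x y - w t x y) u1 u2 t x y (r - r').
Proof.
  intros (vt & dx & dy & vxx & vyy & E1 & E2 & E3 & E4 & E5 & ->)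
    (wt & ex & ey & wxx & wyy & F1 & F2 & F3 & F4 & F5 & ->).
  exists (vt - wt), (fun s => dx s - ex s), (fun s => dy s - ey s), (vxx - wxx), (vyy - wyy).
  refine (conj _ (conj _ (conj _ (conj _ (conj _ _))))).
  - now apply (is_derive_minus (fun s => v s x y) (fun s => w s x y)).
  - intros s. now apply (is_derive_minus (fun z => v t z y) (fun z => w t z y)).
  - intros s. now apply (is_derive_minus (fun z => v t x z) (fun z => w t x z)).
  - now apply (is_derive_minus dx ex).
  - now apply (is_derive_minus dy ey).
  - ring.
Qed.

Section OddPart.
Context (u1 u2 : R -> R -> R -> R) (f0 : R -> R -> R) (theta : R -> R -> R -> R).
Context (Hodd1 : forall t x y, u1 t (- x) y = - u1 t x y).
Context (Heven2 : forall t x y, u2 t (- x) y = u2 t x y).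
Context (Hf0 : cont2 f0).
Context (Hth : is_solution u1 u2 f0 theta).

Definition odd_part (v : R -> R -> R -> R) (t x y : R) : R := v t x y - v t (- x) y.

Lemma is_derive_reflect (phi : R -> R) (x l : R) : is_derive phi (- x) l ->
  is_derive (fun z => phi (- z)) x (- l).
Proof.
  intros H. replace (- l) with (scal (-1) l) by (unfold scal; simpl; unfold mult; simpl; ring).
  apply (is_derive_comp phi (fun z => - z)); [exact H | auto_derive; auto].
Qed.

(** With [u1] odd and [u2] even in [x], the reflected solution satisfies the same equation. The
    difference then also vanishes on [x = 0], which provides a boundary value for comparison on the
    half plane, for any solution. *)
Lemma odd_part_residual t x y : 0 < t -> has_residual (odd_part theta) u1 u2 t x y 0.
Proof.
  intros Ht. destruct Hth as (_ & _ & _ & _ & Dt & Dx & Dy & Dxx & Dyy & H).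
  assert (G : forall x y, _) by (intros x' y'; exact (H t x' y' Ht)). clear H.
  exists (Dt t x y - Dt t (- x) y), (fun z => Dx t z y - - Dx t (- z) y),
    (fun z => Dy t x z - Dy t (- x) z), (Dxx t x y - Dxx t (- x) y), (Dyy t x y - Dyy t (- x) y).
  unfold odd_part. refine (conj _ (conj _ (conj _ (conj _ (conj _ _))))).
  - apply (is_derive_minus (fun s => theta s x y) (fun s => theta s (- x) y));
      apply is_derive_Reals, G.
  - intros s. apply (is_derive_minus (fun z => theta t z y) (fun z => theta t (- z) y)).
    + apply is_derive_Reals, G.
    + apply (is_derive_reflect (fun z => theta t z y)), is_derive_Reals, G.
  - intros s. apply (is_derive_minus (fun z => theta t x z) (fun z => theta t (- x) z));
      apply is_derive_Reals, G.
  - replace (Dxx t x y - Dxx t (- x) y) with (minus (Dxx t x y) (opp (- Dxx t (- x) y)))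
      by (unfold minus, plus, opp; simpl; ring).
    apply (is_derive_minus (fun z => Dx t z y) (fun z => - Dx t (- z) y)).
    + apply is_derive_Reals, G.
    + apply (is_derive_opp (fun z => Dx t (- z) y)).
      apply (is_derive_reflect (fun z => Dx t z y)), is_derive_Reals, G.
  - apply (is_derive_minus (fun z => Dy t x z) (fun z => Dy t (- x) z));
      apply is_derive_Reals, G.
  - destruct (G x y) as (_ & _ & _ & _ & _ & E). destruct (G (- x) y) as (_ & _ & _ & _ & _ & E').
    rewrite Hodd1, Heven2 in E'. lra.
Qed.

Lemma theta_continuous t x y eps : 0 <= t -> 0 < eps -> exists delta, 0 < delta /\
  forall t' x' y', 0 <= t' -> Rabs (t' - t) < delta -> Rabs (x' - x) < delta ->
    Rabs (y' - y) < delta -> Rabs (theta t' x' y' - theta t x y) < eps.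
Proof.
  intros Ht He. destruct Hth as ((S & HS & Hall) & _ & H0 & Hin & _).
  destruct (Req_dec t 0) as [->|Hne].
  - destruct (Hin x y eps He) as (d1 & Hd1 & H1). destruct (Hf0 x y eps He) as (d2 & Hd2 & H2).
    exists (Rmin d1 d2). split; [now apply Rmin_pos|]. intros t' x' y' Ht' It Ix Iy.
    rewrite Rminus_0_r in It. rewrite (Rabs_pos_eq t') in It by assumption.
    assert (J : forall z, z < Rmin d1 d2 -> z < d1 /\ z < d2).
    { intros z Hz. split; (eapply Rlt_le_trans; [exact Hz|]); [apply Rmin_l | apply Rmin_r]. }
    rewrite H0. destruct (Req_dec t' 0) as [->|Hne'].
    + rewrite H0. apply H2; now apply J.
    + apply H1; [split; [lra|]| |]; now apply J.
  - destruct (Hall theta HS) as [Hc _].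
    destruct (Hc t x y ltac:(lra) eps He) as (d & Hd & H1). exists d. split; auto.
Qed.

Lemma odd_part_continuous t x y eps : 0 <= t -> 0 < eps -> exists delta, 0 < delta /\
  forall t' x' y', 0 <= t' -> Rabs (t' - t) < delta -> Rabs (x' - x) < delta ->
    Rabs (y' - y) < delta -> Rabs (odd_part theta t' x' y' - odd_part theta t x y) < eps.
Proof.
  intros Ht He. destruct (theta_continuous t x y (eps / 2) Ht ltac:(lra)) as (d1 & Hd1 & H1).
  destruct (theta_continuous t (- x) y (eps / 2) Ht ltac:(lra)) as (d2 & Hd2 & H2).
  exists (Rmin d1 d2). split; [now apply Rmin_pos|]. intros t' x' y' Ht' It Ix Iy.
  assert (J : forall z, z < Rmin d1 d2 -> z < d1 /\ z < d2).
  { intros z Hz. split; (eapply Rlt_le_trans; [exact Hz|]); [apply Rmin_l | apply Rmin_r]. }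
  destruct (J _ It), (J _ Ix), (J _ Iy).
  specialize (H1 t' x' y' Ht' ltac:(auto) ltac:(auto) ltac:(auto)).
  specialize (H2 t' (- x') y' Ht' ltac:(auto)).
  replace (- x' - - x) with (- (x' - x)) in H2 by ring. rewrite Rabs_Ropp in H2.
  specialize (H2 ltac:(auto) ltac:(auto)). unfold odd_part.
  replace (theta t' x' y' - theta t' (- x') y' - (theta t x y - theta t (- x) y)) with
    ((theta t' x' y' - theta t x y) - (theta t' (- x') y' - theta t (- x) y)) by ring.
  eapply Rle_lt_trans; [apply Rabs_triang|]. rewrite Rabs_Ropp. lra.
Qed.

Lemma odd_part_bounded : exists M, forall t x y, 0 <= t -> Rabs (odd_part theta t x y) <= M.
Proof.
  destruct Hth as (_ & (M & HM) & _). exists (M + M). intros t x y Ht. unfold odd_part.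
  eapply Rle_trans; [apply Rabs_triang|]. rewrite Rabs_Ropp.
  apply Rplus_le_compat; now apply HM.
Qed.

Lemma odd_part_initial x y : odd_part theta 0 x y = f0 x y - f0 (- x) y.
Proof. destruct Hth as (_ & _ & H0 & _). unfold odd_part. now rewrite !H0. Qed.

Lemma odd_part_axis t y : odd_part theta t 0 y = 0.
Proof. unfold odd_part. rewrite Ropp_0. ring. Qed.
End OddPart.

(** * The travelling bump as a subsolution *)

Definition bump (A P : R -> R) (t x y : R) : R :=
  A t * (1 - 400 * ((x - sqrt (P t)) ^ 2 + y ^ 2) / P t).

Section Barrier.
Context (P dP A dA : R -> R) (T : R).
Context (HP : forall t, 0 < P t) (EP : forall t, is_derive P t (dP t)).
Context (HA : forall t, 0 < A t) (EA : forall t, is_derive A t (dA t)).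
Context (HdP : forall t, 0 <= t <= T -> dP t <= - 3200).
Context (HdA : forall t, 0 <= t <= T -> dA t <= - 1600 * A t / P t).

(** With [q] the quadratic part of the bump, diffusion costs [1600 A / P], shrinking gains
    [q A P' / P], and the core estimate lets the non-rigid flow spoil at most half of this gain. The
    decay of [A] pays for [1600 (1 - q)], and the rest, [q (1600 + P' / 2)], is nonpositive exactly
    when [P' <= - 3200] or [q = 0]. *)
Lemma bump_residual t x y : 0 <= t <= T -> 0 < bump A P t x y ->
  exists r, r <= 0 /\ has_residual (bump A P) (drift_x P dP) (drift_y P dP) t x y r.
Proof.
  intros Ht Hpos. set (z := sqrt (P t)).
  assert (Hz : 0 < z) by apply sqrt_lt_R0, HP.
  assert (Hz2 : z ^ 2 = P t) by (apply pow2_sqrt; left; apply HP).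
  pose proof (HP t) as HPt. pose proof (HA t) as HAt.
  set (q := 400 * ((x - z) ^ 2 + y ^ 2) / P t).
  assert (Hq0 : 0 <= q).
  { apply Rdiv_le_0_compat; [|assumption].
    pose proof (pow2_ge_0 (x - z)). pose proof (pow2_ge_0 y). lra. }
  assert (Hq1 : q < 1).
  { unfold bump in Hpos. fold z in Hpos. fold q in Hpos.
    apply Rnot_le_lt. intros Hle. assert (A t * (1 - q) <= 0) by nra. lra. }
  assert (Hr : 400 * ((x - z) ^ 2 + y ^ 2) = q * P t) by (unfold q; field; lra).
  pose proof (vortex_core P dP t x y z Hz Hz2 ltac:(nra)) as HV.
  specialize (HdP t Ht). specialize (HdA t Ht).
  set (dz := dP t / (2 * z)) in *.
  set (core := (x - z) * (drift_x P dP t x y - dz) + y * drift_y P dP t x y) in *.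
  exists (dA t * (1 - q) + A t / P t * (1600 + q * dP t - 800 * core)). split; cycle 1.
  - exists (dA t * (1 - q) + A t * (800 * (x - z) * dz / P t + q * dP t / P t)),
      (fun s => A t * (- 800 * (s - z) / P t)), (fun s => A t * (- 800 * s / P t)),
      (A t * (- 800 / P t)), (A t * (- 800 / P t)).
    refine (conj _ (conj _ (conj _ (conj _ (conj _ _))))).
    + unfold bump. auto_derive.
      * assert (XP : ex_derive P t) by (eexists; apply EP).
        assert (XA : ex_derive A t) by (eexists; apply EA).
        refine (conj XA (conj XP (conj HPt (conj XP (conj _ I))))). lra.
      * replace (Derive (fun s => P s) t) with (dP t) by (symmetry; apply is_derive_unique, EP).
        replace (Derive (fun s => A s) t) with (dA t) by (symmetry; apply is_derive_unique, EA).
        fold z. unfold q, dz.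
        replace (x + - z) with (x - z) by ring. field. split; lra.
    + intros s. unfold bump. fold z. auto_derive; [lra | field; lra].
    + intros s. unfold bump. fold z. auto_derive; [lra | field; lra].
    + auto_derive; [auto | field; lra].
    + auto_derive; [auto | field; lra].
    + unfold core. field. lra.
  - assert (HV' : - core <= - dP t * q / 1600).
    { replace (Rabs (dP t) * ((x - z) ^ 2 + y ^ 2) / (4 * P t)) with (- dP t * q / 1600) in HV
        by (rewrite Rabs_left by lra; unfold q; field; lra).
      apply Rabs_le_between in HV. lra. }
    assert (HAP : 0 < A t / P t) by now apply Rdiv_lt_0_compat.
    assert (I1 : dA t * (1 - q) <= - 1600 * A t / P t * (1 - q)) by (apply Rmult_le_compat_r; lra).
    assert (I2 : A t / P t * (1600 + q * dP t - 800 * core) <=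
      A t / P t * (1600 + q * dP t / 2)) by (apply Rmult_le_compat_l; lra).
    replace (- 1600 * A t / P t * (1 - q)) with (A t / P t * (- 1600 * (1 - q))) in I1 by (field; lra).
    assert (A t / P t * (q * (1600 + dP t / 2)) <= 0).
    { assert (q * (1600 + dP t / 2) <= 0) by nra. nra. }
    lra.
Qed.

Lemma bump_continuous t x y eps : 0 < eps -> exists delta, 0 < delta /\
  forall t' x' y', Rabs (t' - t) < delta -> Rabs (x' - x) < delta ->
    Rabs (y' - y) < delta -> Rabs (bump A P t' x' y' - bump A P t x y) < eps.
Proof.
  intros He. refine (cont3_of_continuous (bump A P) _ t x y I eps He). intros p.
  destruct (continuous_coords p) as [Cx Cy].
  assert (CP : forall f : R -> R, (forall t, ex_derive f t) ->
    continuous (fun p : R * R * R => f (fst (fst p))) p) by (intros; now apply continuous_time).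
  unfold bump.
  apply (continuous_mult (fun p : R * R * R => A (fst (fst p)))).
  { apply CP. intros s; eexists; apply EA. }
  apply (continuous_minus (fun _ : R * R * R => 1)); [apply continuous_const|].
  apply (continuous_mult (fun p : R * R * R => 400 * ((snd (fst p) - sqrt (P (fst (fst p)))) ^ 2 + snd p ^ 2))
    (fun p : R * R * R => / P (fst (fst p)))).
  - apply (continuous_mult (fun _ : R * R * R => 400)); [apply continuous_const|].
    assert (Cs : continuous (fun p : R * R * R => snd (fst p) - sqrt (P (fst (fst p)))) p).
    { apply (continuous_minus (fun p : R * R * R => snd (fst p))); [assumption|].
      apply (CP (fun t => sqrt (P t))). intros s. auto_derive. split; [eexists; apply EP|].
      split; [apply HP | exact I]. }
    apply (continuous_plus (fun p : R * R * R => (snd (fst p) - sqrt (P (fst (fst p)))) ^ 2)).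
    + apply (continuous_mult (fun p : R * R * R => snd (fst p) - sqrt (P (fst (fst p))))); [assumption|].
      apply (continuous_mult (fun p : R * R * R => snd (fst p) - sqrt (P (fst (fst p))))); [assumption|].
      apply continuous_const.
    + apply (continuous_mult (fun p : R * R * R => snd p)); [assumption|].
      apply (continuous_mult (fun p : R * R * R => snd p)); [assumption | apply continuous_const].
  - apply (CP (fun t => / P t)). intros s. auto_derive. split; [eexists; apply EP|].
    split; [apply Rgt_not_eq, HP | exact I].
Qed.

Lemma odd_part_above_bump f0 theta B : cont2 f0 ->
  is_solution (drift_x P dP) (drift_y P dP) f0 theta ->
  (forall t x y, 0 <= t <= T -> Rabs (drift_x P dP t x y) <= B /\ Rabs (drift_y P dP t x y) <= B) ->
  (forall x y, 0 <= x -> 0 <= f0 x y - f0 (- x) y) ->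
  (forall x y, 0 <= x -> bump A P 0 x y <= f0 x y - f0 (- x) y) ->
  (forall t, 0 <= t <= T -> A t <= A 0) ->
  forall t x y, 0 <= t <= T -> 0 <= x -> bump A P t x y <= odd_part theta t x y.
Proof.
  intros Hf0 Hth HB H0 Hbump HAmax.
  assert (Hodd : forall t x y, drift_x P dP t (- x) y = - drift_x P dP t x y).
  { intros t x y. unfold drift_x. replace ((- x) ^ 2) with (x ^ 2) by ring.
    field. pose proof (HP t). nra. }
  assert (Heven : forall t x y, drift_y P dP t (- x) y = drift_y P dP t x y).
  { intros t x y. unfold drift_y. replace ((- x) ^ 2) with (x ^ 2) by ring. reflexivity. }
  destruct (odd_part_bounded _ _ _ _ Hth) as [M HM].
  pose proof (odd_part_continuous _ _ _ _ Hf0 Hth) as HC.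
  (* The bump is a subsolution only where it is positive. Once the odd part is known to be
     nonnegative, any point where the bump exceeds it is such a point. *)
  assert (Pos : forall t x y, 0 <= t <= T -> 0 <= x -> 0 <= odd_part theta t x y).
  { apply (half_plane_positivity _ (drift_x P dP) (drift_y P dP) T M B).
    - intros t x y [Ht _] _. specialize (HM t x y Ht). apply Rabs_le_between in HM. lra.
    - intros t x y eps [Ht _] _ He. destruct (HC t x y eps Ht He) as (d & Hd & H).
      exists d. split; [assumption|]. intros t' x' y' [Ht' _] _. now apply H.
    - intros x y Hx. rewrite (odd_part_initial _ _ _ _ Hth). now apply H0.
    - intros t y _. rewrite odd_part_axis. lra.
    - exact HB.
    - intros t x y [Ht _] _ _.
      destruct (odd_part_residual _ _ _ _ Hodd Heven Hth t x y Ht)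
        as (vt & dx & dy & vxx & vyy & E1 & E2 & E3 & E4 & E5 & E6).
      exists vt, dx, dy, vxx, vyy.
      refine (conj E1 (conj E2 (conj E3 (conj E4 (conj E5 _))))). lra. }
  assert (HbA : forall t x y, bump A P t x y <= A t).
  { intros t x y. unfold bump. pose proof (HP t). pose proof (HA t).
    assert (0 <= 400 * ((x - sqrt (P t)) ^ 2 + y ^ 2) / P t).
    { apply Rdiv_le_0_compat; [|assumption].
      pose proof (pow2_ge_0 (x - sqrt (P t))). pose proof (pow2_ge_0 y). lra. }
    nra. }
  enough (G : forall t x y, 0 <= t <= T -> 0 <= x -> 0 <= odd_part theta t x y - bump A P t x y)
    by (intros t x y Ht Hx; specialize (G t x y Ht Hx); lra).
  apply (half_plane_positivity _ (drift_x P dP) (drift_y P dP) T (A 0) B).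
  - intros t x y Ht Hx. specialize (Pos t x y Ht Hx). specialize (HbA t x y).
    specialize (HAmax t Ht). lra.
  - intros t x y eps [Ht _] _ He.
    destruct (HC t x y (eps / 2) Ht ltac:(lra)) as (d1 & Hd1 & H1).
    destruct (bump_continuous t x y (eps / 2) ltac:(lra)) as (d2 & Hd2 & H2).
    exists (Rmin d1 d2). split; [now apply Rmin_pos|]. intros t' x' y' [Ht' _] _ It Ix Iy.
    assert (J : forall z, z < Rmin d1 d2 -> z < d1 /\ z < d2).
    { intros z Hz. split; (eapply Rlt_le_trans; [exact Hz|]); [apply Rmin_l | apply Rmin_r]. }
    destruct (J _ It), (J _ Ix), (J _ Iy).
    specialize (H1 t' x' y' Ht' ltac:(auto) ltac:(auto) ltac:(auto)).
    specialize (H2 t' x' y' ltac:(auto) ltac:(auto) ltac:(auto)).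
    replace (odd_part theta t' x' y' - bump A P t' x' y' - (odd_part theta t x y - bump A P t x y))
      with ((odd_part theta t' x' y' - odd_part theta t x y) - (bump A P t' x' y' - bump A P t x y)) by ring.
    eapply Rle_lt_trans; [apply Rabs_triang|]. rewrite Rabs_Ropp. lra.
  - intros x y Hx. rewrite (odd_part_initial _ _ _ _ Hth). specialize (Hbump x y Hx). lra.
  - intros t y Ht. rewrite odd_part_axis.
    (* Axis points lie at distance at least [z] from the centre, far outside the radius [z / 20]
       where the bump is positive. *)
    assert (bump A P t 0 y <= 0); [|lra]. unfold bump.
    pose proof (HP t) as HPt. pose proof (HA t).
    replace ((0 - sqrt (P t)) ^ 2) with (P t) by (rewrite <- (pow2_sqrt (P t)) at 1 by lra; ring).
    assert (1 <= 400 * (P t + y ^ 2) / P t).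
    { apply (Rmult_le_reg_r (P t)); [assumption|]. unfold Rdiv. rewrite Rmult_assoc, Rinv_l by lra.
      pose proof (pow2_ge_0 y). lra. }
    nra.
  - exact HB.
  - intros t x y [Ht HtT] Hx Hneg. specialize (Pos t x y ltac:(lra) ltac:(lra)).
    destruct (bump_residual t x y ltac:(lra) ltac:(lra)) as (r & Hr & Hres).
    destruct (has_residual_minus _ _ _ _ _ _ _ _ _
      (odd_part_residual _ _ _ _ Hodd Heven Hth t x y Ht) Hres)
      as (vt & dx & dy & vxx & vyy & E1 & E2 & E3 & E4 & E5 & E6).
    exists vt, dx, dy, vxx, vyy.
      refine (conj E1 (conj E2 (conj E3 (conj E4 (conj E5 _))))). lra.
Qed.
End Barrier.

(** * Choice of the parameters *)

(** Since [ramp = P^(1/b)], the derivative [- b (1 + slope) ramp^(b - 1)] is of order [P^(1 - 1/b)].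
    The factor [1 + slope] is at most 2 always and at least 1 before [t0]. *)
Lemma dscale2_bounds e t0 b t : 0 < e -> 0 < b <= 1 ->
  Rabs (dscale2 e t0 b t) <= 2 * exp (- (/ b - 1) * ln (scale2 e t0 b t)) /\
  (t <= t0 -> dscale2 e t0 b t <= - (b * exp (- (1 - b) * ln (ramp e t0 t)))).
Proof.
  intros He Hb. pose proof (ramp_ge e t0 He t) as Hr. set (r := ramp e t0 t) in *.
  destruct (slope_bounds e t0 He t) as [S1 S2].
  assert (E : scale2 e t0 b t * / r = exp (- (1 - b) * ln r)).
  { unfold scale2. fold r. unfold Rpower.
    rewrite <- (exp_ln r) at 2 by lra. rewrite <- exp_Ropp, <- exp_plus. f_equal. ring. }
  assert (E' : dscale2 e t0 b t = - (b * (1 + slope e t0 t) * exp (- (1 - b) * ln r))).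
  { unfold dscale2. fold r. rewrite <- E. ring. }
  set (s := slope e t0 t) in *. set (G := exp (- (1 - b) * ln r)) in *.
  assert (HG : 0 < G) by apply exp_pos.
  split.
  - replace (- (/ b - 1) * ln (scale2 e t0 b t)) with (- (1 - b) * ln r).
    + fold G. rewrite E', Rabs_Ropp, Rabs_pos_eq by (apply Rmult_le_pos; nra).
      apply Rmult_le_compat_r; nra.
    + unfold scale2. fold r. unfold Rpower. rewrite ln_exp. field. lra.
  - intros Ht. pose proof (slope_nonneg e t0 He t Ht) as S0. fold s in S0. rewrite E'.
    apply Ropp_le_contravar. apply Rmult_le_compat_r; nra.
Qed.

(** The explicit solution of [A' = - 1600 (1 + slope) A / P]: with [R = ramp], the function
    [R^(1 - b) / (1 - b)] is a primitive of [R' R^(- b) = R' / P]. For positive [A0] it stays above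
    [A0]. *)
Definition amplitude (e t0 b A0 t : R) : R := A0 * exp (1600 / (1 - b) * scale2 e t0 (1 - b) t).

Definition damplitude (e t0 b A0 t : R) : R :=
  - 1600 * (1 + slope e t0 t) * amplitude e t0 b A0 t / scale2 e t0 b t.

Lemma is_derive_amplitude e t0 b A0 t : 0 < e -> 0 < b < 1 ->
  is_derive (amplitude e t0 b A0) t (damplitude e t0 b A0 t).
Proof.
  intros He Hb. pose proof (ramp_ge e t0 He t) as Hr.
  assert (ED : is_derive (scale2 e t0 (1 - b)) t (dscale2 e t0 (1 - b) t))
    by (apply is_derive_scale2; lra).
  assert (E : scale2 e t0 (1 - b) t * / ramp e t0 t = / scale2 e t0 b t).
  { unfold scale2, Rpower. rewrite <- (exp_ln (ramp e t0 t)) at 2 by lra.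
    rewrite <- !exp_Ropp, <- exp_plus. f_equal. ring. }
  unfold amplitude.
  replace (damplitude e t0 b A0 t) with
    (A0 * (1600 / (1 - b) * dscale2 e t0 (1 - b) t * exp (1600 / (1 - b) * scale2 e t0 (1 - b) t))).
  - apply is_derive_scal.
    apply (is_derive_comp exp (fun t => 1600 / (1 - b) * scale2 e t0 (1 - b) t)); [apply is_derive_exp|].
    now apply is_derive_scal.
  - unfold damplitude, amplitude, dscale2. unfold Rdiv at 3. rewrite <- E.
    pose proof (ramp_ge e t0 He t). field. lra.
Qed.

(** [L] will be [- ln (4 t0)]: a short time makes the motion fast enough, [P' <= - 3200], and starts
    it close enough to the origin for the norm bound. The 4 is the squared length of the range
    [[-1, 1]] of the primitive. *)
Lemma small_time_exists b a K : 0 < b < 1 -> 0 < a < 1 ->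
  exists L, 0 <= L /\ 3200 <= b * exp ((1 - b) * L) /\
    exp (K - (1 - a) * (b * L)) / (1 - a) ^ 2 * 4 <= 1.
Proof.
  intros Hb Ha. set (L1 := ln (3200 / b) / (1 - b)).
  set (L2 := (K - ln ((1 - a) ^ 2 / 4)) / ((1 - a) * b)).
  assert (Hab : 0 < (1 - a) * b) by nra.
  assert (H2 : 0 < (1 - a) ^ 2 / 4) by (assert (0 < (1 - a) ^ 2) by (apply pow_lt; lra); lra).
  exists (Rabs L1 + Rabs L2).
  pose proof (Rabs_pos L1). pose proof (Rabs_pos L2). pose proof (Rle_abs L1). pose proof (Rle_abs L2).
  split; [lra|]. split.
  - apply (Rmult_le_reg_l (/ b)); [apply Rinv_0_lt_compat; lra|].
    rewrite <- Rmult_assoc, Rinv_l, Rmult_1_l by lra.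
    replace (/ b * 3200) with (3200 / b) by (field; lra).
    rewrite <- (exp_ln (3200 / b)) by (apply Rdiv_lt_0_compat; lra). apply exp_le_exp.
    replace (ln (3200 / b)) with ((1 - b) * L1) by (unfold L1; field; lra).
    apply Rmult_le_compat_l; lra.
  - assert (HE : exp (K - (1 - a) * (b * (Rabs L1 + Rabs L2))) <= (1 - a) ^ 2 / 4).
    { rewrite <- (exp_ln ((1 - a) ^ 2 / 4)) by assumption. apply exp_le_exp.
      assert (E : (1 - a) * b * L2 = K - ln ((1 - a) ^ 2 / 4)) by (unfold L2; field; lra).
      assert ((1 - a) * b * L2 <= (1 - a) * b * (Rabs L1 + Rabs L2))
        by (apply Rmult_le_compat_l; lra).
      lra. }
    apply (Rmult_le_reg_r ((1 - a) ^ 2 / 4)); [assumption|].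
    replace (exp (K - (1 - a) * (b * (Rabs L1 + Rabs L2))) / (1 - a) ^ 2 * 4 * ((1 - a) ^ 2 / 4))
      with (exp (K - (1 - a) * (b * (Rabs L1 + Rabs L2)))) by (field; lra). lra.
Qed.

(** Where the bump is positive the point is within [z / 20] of [(z, 0)], so the right side is at
    least [2 k (19/20) z / 3], which exceeds [k z / 2]. Elsewhere the right side is nonnegative. *)
Lemma bump_initial_le k A P0 x y : 0 < P0 <= 1 -> 0 < A -> A <= k * sqrt P0 / 2 -> 0 <= x ->
  A * (1 - 400 * ((x - sqrt P0) ^ 2 + y ^ 2) / P0) <= dipole k x y - dipole k (- x) y.
Proof.
  intros HP HA Hk Hx. set (z := sqrt P0) in *.
  assert (Hz : 0 < z) by (apply sqrt_lt_R0; lra).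
  assert (Hz2 : z ^ 2 = P0) by (apply pow2_sqrt; lra).
  assert (Hz1 : z <= 1) by nra.
  assert (Hk0 : 0 < k) by nra.
  assert (Hd : 0 < 1 + x ^ 2 + y ^ 2) by nra.
  unfold dipole. replace ((- x) ^ 2) with (x ^ 2) by ring.
  replace (k * (x / (1 + x ^ 2 + y ^ 2)) - k * (- x / (1 + x ^ 2 + y ^ 2)))
    with (2 * k * x / (1 + x ^ 2 + y ^ 2)) by (field; lra).
  set (q := 400 * ((x - z) ^ 2 + y ^ 2) / P0).
  assert (Hq : 0 <= q).
  { apply Rdiv_le_0_compat; [|lra]. pose proof (pow2_ge_0 (x - z)). pose proof (pow2_ge_0 y). lra. }
  assert (Hpos : 0 <= 2 * k * x / (1 + x ^ 2 + y ^ 2)) by (apply Rdiv_le_0_compat; nra).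
  destruct (Rle_dec 1 q) as [H|H]; [nra|].
  assert (Hqz : 400 * ((x - z) ^ 2 + y ^ 2) < z ^ 2).
  { rewrite Hz2. replace (400 * ((x - z) ^ 2 + y ^ 2)) with (q * P0) by (unfold q; field; lra). nra. }
  pose proof (pow2_ge_0 y) as Hy2. pose proof (pow2_ge_0 (x - z)) as Hxz.
  assert (Hxl : 19 / 20 * z <= x) by nra. assert (Hxu : x <= 21 / 20 * z) by nra.
  assert (Hden : 1 + x ^ 2 + y ^ 2 <= 3) by nra.
  apply Rle_trans with A; [nra|].
  apply Rle_trans with (2 * k * x / 3).
  - nra.
  - unfold Rdiv. apply Rmult_le_compat_l; [nra|]. apply Rinv_le_contravar; lra.
Qed.

Theorem theorem1p3 (p : R) (hp : 1 <= p < 2) :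
  exists T : R, 0 < T /\
  exists theta0 : R -> R -> R,
    smooth2 theta0 /\ C2_norm_le theta0 1 /\
    forall rho : R -> R, modulus rho ->
      exists u1 u2 : R -> R -> R -> R,
        smooth3 u1 /\ smooth3 u2 /\ div_free u1 u2 /\
        sup_time_Lp_le u1 u2 p 1 /\
        (exists theta, is_solution u1 u2 theta0 theta) /\
        forall theta, is_solution u1 u2 theta0 theta ->
          exists t, 0 <= t <= T /\ breaks_at theta rho t.
Proof.
  (* This choice puts [a] at the midpoint of [p / 2] and 1, hence below 1 because [p < 2]. *)
  set (gam := (2 - p) / (4 * p)).
  assert (Hgam : 0 < gam) by (apply Rdiv_lt_0_compat; lra).
  set (b := / (1 + gam)).
  assert (Hb : 0 < b < 1).
  { split; [apply Rinv_0_lt_compat; lra|]. rewrite <- Rinv_1. apply Rinv_lt_contravar; lra. }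
  assert (Hbg : / b - 1 = gam) by (unfold b; rewrite Rinv_inv; ring).
  set (a := (1 / 2 + gam) * p).
  assert (Ea : a = (p + 2) / 4) by (unfold a, gam; field; lra).
  assert (Ha : 0 < a < 1) by lra.
  destruct (small_time_exists b a (p * ln 28672) Hb Ha) as (L & HL0 & HL1 & HL2).
  set (t0 := exp (- L) / 4).
  assert (Ht0 : 0 < t0) by (pose proof (exp_pos (- L)); unfold t0; lra).
  assert (E4 : 4 * t0 = exp (- L)) by (unfold t0; field).
  assert (L4 : ln (4 * t0) = - L) by (rewrite E4; apply ln_exp).
  set (d := Rpower (4 * t0) b).
  assert (Ld : ln d = - (b * L)) by (unfold d, Rpower; rewrite ln_exp, L4; ring).
  assert (Hd : 0 < d) by apply exp_pos.
  assert (Hd1 : d <= 1).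
  { rewrite <- exp_0. unfold d, Rpower. apply exp_le_exp. rewrite L4. nra. }
  set (zl := sqrt (Rpower (2 * t0) b)).
  assert (Hzl : 0 < zl) by (apply sqrt_lt_R0, exp_pos).
  set (k := / 20). set (c := 1600 / (1 - b)).
  assert (Hc : 0 < c) by (apply Rdiv_lt_0_compat; lra).
  (* [zl] bounds the initial [z] from below for every [e <= t0], and the exponential discounts the
     largest possible initial excess of the amplitude, as [ramp <= 4 t0]. Thus [A0] depends on [p]
     alone. *)
  set (A0 := k * zl / 2 * exp (- (c * Rpower (4 * t0) (1 - b)))).
  assert (HA0 : 0 < A0) by (apply Rmult_lt_0_compat; [unfold k; lra | apply exp_pos]).
  exists t0. split; [assumption|]. exists (dipole k).
  split; [apply dipole_smooth2|]. split; [apply dipole_C2_norm|].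
  intros rho (Hcont & Hmono & _ & Hrho0).
  destruct (Hcont 0 (Rle_refl 0) A0 HA0) as (del & Hdel & Hcd).
  (* The only choice made after [rho]: [e] is so small that [P t0 = (2 e)^b <= w]. The mirror points
     are then [2 z <= del / 2] apart, where [rho] is below [A0]. *)
  set (w := (del / 4) ^ 2). assert (Hw : 0 < w) by (apply pow_lt; lra).
  set (e := Rmin t0 (Rpower w (/ b) / 2)).
  assert (He : 0 < e) by (apply Rmin_pos; [assumption|]; pose proof (exp_pos (/ b * ln w)); unfold Rpower; lra).
  assert (Het : e <= t0) by apply Rmin_l.
  set (P := scale2 e t0 b). set (dP := dscale2 e t0 b).
  assert (HP : forall t, 0 < P t) by (intros; apply exp_pos).
  assert (EP : forall t : R, is_derive P t (dP t)) by (intros t; apply is_derive_scale2; lra).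
  destruct (ramp_initial e t0 He Het) as [R1 R2].
  assert (HPd0 : P 0 <= d) by (apply Rle_Rpower_l; [lra|]; split; [|assumption]; lra).
  assert (HPd : forall t, 0 <= t -> P t <= d).
  { intros t Ht. eapply Rle_trans; [|exact HPd0]. apply scale2_le_initial; lra. }
  assert (HPm : forall t, Rpower e b <= P t) by (intros t; apply scale2_ge; lra).
  assert (HTm : bounded_time_family (time_algebra e t0 b)) by (apply time_algebra_bounded; lra).
  assert (Hconst : forall c, time_algebra e t0 b (fun _ => c)) by (intros; apply ta_const).
  set (F := vortex_algebra (time_algebra e t0 b) (fun t => 7 * P t)).
  assert (HF : bounded_family F).
  { apply (vortex_algebra_bounded_family _ HTm Hconst _ (fun t => 7 * dP t) (7 * Rpower e b)).
    - intros t. specialize (HP t). lra.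
    - pose proof (exp_pos (b * ln e)). unfold Rpower. lra.
    - intros t _. specialize (HPm t). lra.
    - apply (ta_mult e t0 b (fun _ => 7)); [apply ta_const | apply dscale2_in_algebra; lra].
    - intros t. now apply is_derive_scal. }
  destruct (drift_in_algebra _ P dP Hconst HP (ta_scale2 e t0 b)
    (dscale2_in_algebra e t0 b)) as [F1 F2].
  fold F in F1, F2.
  exists (drift_x P dP), (drift_y P dP).
  split; [now apply (bounded_family_smooth3 F)|]. split; [now apply (bounded_family_smooth3 F)|].
  split; [now apply drift_div_free|].
  assert (Hm : 0 < Rpower e b) by apply exp_pos.
  assert (Hmd : Rpower e b <= d) by (eapply Rle_trans; [apply (HPm 0) | assumption]).
  split; [|split].
  - apply (sup_time_Lp_le_product _ _ p (tensor_primitive a (Rpower e b) d)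
      (tensor_density a (Rpower e b) d)
      (exp (p * ln 28672 + (1 - a) * ln d) / (1 - a) ^ 2) (-1) 1).
    + apply Rdiv_lt_0_compat; [apply exp_pos | apply pow_lt; lra].
    + intros x. now apply is_derive_tensor_primitive.
    + intros x. eapply Rlt_le_trans; [|apply (tensor_density_ge a _ d (P 0) (P 0 + x ^ 2)); auto; lra].
      apply Rmult_lt_0_compat; [lra | apply exp_pos].
    + intros x. apply tensor_primitive_bounds; lra.
    + rewrite Ld. replace (p * ln 28672 + (1 - a) * - (b * L)) with (p * ln 28672 - (1 - a) * (b * L)) by ring.
      replace ((1 - -1) ^ 2) with 4 by ring. exact HL2.
    + intros t x y Ht Hn. apply (drift_power_le P dP t x y p gam); auto.
      rewrite <- Hbg. apply dscale2_bounds; lra.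
  - apply (solution_exists F); auto. apply dipole_Bd.
  - intros theta Hth. exists t0. split; [lra|].
    set (A := amplitude e t0 b A0). set (dA := damplitude e t0 b A0).
    assert (HA : forall t, 0 < A t) by (intros t; apply Rmult_lt_0_compat; [assumption | apply exp_pos]).
    assert (EA : forall t : R, is_derive A t (dA t)) by (intros t; now apply is_derive_amplitude).
    assert (Hramp : forall t, 0 <= t -> ramp e t0 t <= 4 * t0).
    { intros t Ht. eapply Rle_trans; [apply ramp_le_initial; lra | exact R2]. }
    assert (HdP : forall t, 0 <= t <= t0 -> dP t <= - 3200).
    { intros t Ht. destruct (dscale2_bounds e t0 b t He ltac:(lra)) as [_ H].
      eapply Rle_trans; [apply H; lra|]. apply Ropp_le_contravar.
      eapply Rle_trans; [exact HL1|]. apply Rmult_le_compat_l; [lra|]. apply exp_le_exp.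
      assert (ln (ramp e t0 t) <= - L).
      { rewrite <- L4. apply ln_le_ln; [pose proof (ramp_ge e t0 He t); lra | apply Hramp; lra]. }
      nra. }
    assert (HdA : forall t, 0 <= t <= t0 -> dA t <= - 1600 * A t / P t).
    { intros t Ht. pose proof (slope_nonneg e t0 He t ltac:(lra)) as Hs.
      unfold dA, damplitude. fold A. fold P. specialize (HA t). specialize (HP t).
      unfold Rdiv. apply Rmult_le_compat_r; [left; now apply Rinv_0_lt_compat|]. nra. }
    assert (HAmax : forall t, 0 <= t <= t0 -> A t <= A 0).
    { intros t Ht. apply Rmult_le_compat_l; [lra|]. apply exp_le_exp.
      apply Rmult_le_compat_l; [fold c; lra|]. apply scale2_le_initial; lra. }
    destruct (family_Bd F HF 0 _ F1) as [B1 HB1]. destruct (family_Bd F HF 0 _ F2) as [B2 HB2].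
    assert (Hzl0 : zl <= sqrt (P 0)).
    { apply sqrt_le_1_alt. apply Rle_Rpower_l; lra. }
    assert (HA00 : A 0 <= k * sqrt (P 0) / 2).
    { apply Rle_trans with (k * zl / 2); [|unfold k; lra].
      apply Rle_trans with (A0 * exp (c * Rpower (4 * t0) (1 - b))).
      - apply Rmult_le_compat_l; [lra|]. apply exp_le_exp. apply Rmult_le_compat_l; [lra|].
        apply Rle_Rpower_l; lra.
      - unfold A0. rewrite Rmult_assoc, <- exp_plus, Rplus_opp_l, exp_0. lra. }
    assert (Hbump : bump A P t0 (sqrt (P t0)) 0 <= odd_part theta t0 (sqrt (P t0)) 0).
    { apply (odd_part_above_bump P dP A dA t0 HP EP HA EA HdP HdA (dipole k) theta (Rmax B1 B2));
        auto; try lra; try apply sqrt_pos.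
      - intros x y eps Heps. destruct (dipole_smooth2 k) as (S & HS & Hall).
        destruct (Hall _ HS) as [Hc2 _]. now apply Hc2.
      - intros t x y [Ht _]. split; (eapply Rle_trans; [apply (Bd_abs 0)|]);
          [apply HB1; lra | apply Rmax_l | apply HB2; lra | apply Rmax_r].
      - intros x y Hx. unfold dipole, k. replace ((- x) ^ 2) with (x ^ 2) by ring.
        assert (0 <= x / (1 + x ^ 2 + y ^ 2)) by (apply Rdiv_le_0_compat; nra).
        unfold Rdiv in *. lra.
      - intros x y Hx. apply bump_initial_le; auto; [split; [apply HP | lra]]. }
    (* At its centre the bump equals its amplitude, which never falls below [A0]. *)
    assert (HAt : A0 <= bump A P t0 (sqrt (P t0)) 0).
    { unfold bump. replace (400 * ((sqrt (P t0) - sqrt (P t0)) ^ 2 + 0 ^ 2)) with 0 by ring.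
      unfold A, amplitude. unfold Rdiv at 2. rewrite Rmult_0_l, Rminus_0_r, Rmult_1_r.
      assert (0 <= 1600 / (1 - b) * scale2 e t0 (1 - b) t0).
      { apply Rmult_le_pos; [fold c; lra | left; apply exp_pos]. }
      pose proof (exp_ineq1_le (1600 / (1 - b) * scale2 e t0 (1 - b) t0)). nra. }
    assert (Hz : sqrt (P t0) <= del / 4).
    { replace (del / 4) with (sqrt w) by (unfold w; apply sqrt_pow2; lra).
      apply sqrt_le_1_alt. unfold P, scale2. rewrite (ramp_final e t0 He).
      assert (H2e : 2 * e <= Rpower w (/ b)).
      { pose proof (Rmin_r t0 (Rpower w (/ b) / 2)). fold e in H. lra. }
      replace w with (Rpower (Rpower w (/ b)) b)
        by (rewrite Rpower_mult, Rinv_l, Rpower_1; lra).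
      apply Rle_Rpower_l; lra. }
    exists (sqrt (P t0)), 0, (- sqrt (P t0)), 0.
    set (z := sqrt (P t0)) in *. assert (Hz0 : 0 < z) by apply sqrt_lt_R0, HP.
    replace (norm2 (z - - z) (0 - 0)) with (2 * z)
      by (unfold norm2; replace ((z - - z) * (z - - z) + (0 - 0) * (0 - 0)) with ((2 * z) ^ 2) by ring;
        rewrite sqrt_pow2; lra).
    assert (Hrho : rho (2 * z) < A0).
    { specialize (Hcd (2 * z)). simpl in Hcd. unfold R_dist in Hcd. rewrite Hrho0 in Hcd.
      rewrite !Rminus_0_r in Hcd.
      apply Rle_lt_trans with (Rabs (rho (2 * z))); [apply Rle_abs|]. apply Hcd.
      split; [split; [exact I | lra]|]. rewrite Rabs_pos_eq; lra. }
    apply Rlt_gt. eapply Rlt_le_trans; [exact Hrho|].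
    eapply Rle_trans; [|apply Rle_abs]. unfold odd_part in Hbump. lra.
Qed.
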